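(* Let $(\lambda_1^D,\phi_1)$ be a first Dirichlet eigenpair of $-\Delta$ on $\Omega$, i.e. $0\neq\phi_1\in H^1_0(\Omega)$, $-\Delta\phi_1=\lambda_1^D\phi_1$, so that $C_P=1/\sqrt{\lambda_1^D}$. Consider the homogeneous Dirichlet problem $-\Delta u=f$ in $\Omega$, $u=0$ on $\partial\Omega$, with $f=\lambda_1^D\phi_1$, whose solution is $u=\phi_1$. Then: (i) if $C=C_P$, every function $v=t\phi_1+c$ with $0\le t\le 1$ and $c\in\mathbb R$ is a minimizer of $\mathcal J_f^C$ over $\mathcal V$; (ii) if $0<C<C_P$, the Dirichlet solution $u=\phi_1$ is not a minimizer of $\mathcal J_f^C$ over $\mathcal V$.
   Context: $\Omega\subset\mathbb R^d$ is a bounded connected Lipschitz domain; functions are real-valued. Write $\|v\|_0=\|v\|_{L^2(\Omega)}$ and $|v|_1=\|\nabla v\|_{L^2(\Omega)}$. The space $\mathcal V=\{v\in H^1(\Omega):\Delta v\in L^2(\Omega)\}$, where the Laplacian is understood in the distributional sense. For $C>0$ and $f\in L^2(\Omega)$ define $$\mathcal J_f^C(v)=C\|\Delta v+f\|_0+|v|_1,\qquad v\in\mathcal V .$$ The constant $C_P$ is the sharp Dirichlet Poincaré constant of $\Omega$: $C_P:=\sup_{0\ne w\in H^1_0(\Omega)}\|w\|_0/|w|_1=1/\sqrt{\lambda_1^D}$, where $\lambda_1^D$ is the first (smallest) Dirichlet eigenvalue of $-\Delta$ on $\Omega$. *)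

(* Defs.v *)
From HB Require Import structures.
From mathcomp Require Import all_boot all_order all_algebra.
From mathcomp Require Import all_classical all_reals all_analysis.

Set Implicit Arguments.
Unset Strict Implicit.
Unset Printing Implicit Defensive.

Import Order.TTheory GRing.Theory Num.Theory.
Import numFieldNormedType.Exports.

Local Open Scope classical_set_scope.
Local Open Scope ring_scope.

(* The sigma-algebra on R^n generated by the coordinate functions, i.e. the
   Borel sigma-algebra. *)
Section measurable_rV.
Context {R : realType} (n : nat).

Definition rV_coord (i : 'I_n) : 'rV[R]_n -> measurableTypeR R :=
  fun x => x ord0 i.

Let rV_set0 : g_sigma_preimage rV_coord set0.
Proof. exact: sigma_algebra0. Qed.

Let rV_setC A : g_sigma_preimage rV_coord A -> g_sigma_preimage rV_coord (~` A).
Proof. exact: sigma_algebraC. Qed.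

Let rV_bigcup (F : _^nat) : (forall i, g_sigma_preimage rV_coord (F i)) ->
  g_sigma_preimage rV_coord (\bigcup_i (F i)).
Proof. exact: sigma_algebra_bigcup. Qed.

HB.instance Definition _ := @isMeasurable.Build default_measure_display
  'rV[R]_n (g_sigma_preimage rV_coord) rV_set0 rV_setC rV_bigcup.

Lemma measurable_rV_coord (i : 'I_n) : measurable_fun [set: 'rV[R]_n] (rV_coord i).
Proof.
move=> _ Y mY; rewrite setTI; apply: sub_sigma_algebra => /=.
rewrite -bigcup_seq/=; exists i => /=; first by rewrite mem_index_enum.
by exists Y => //; rewrite setTI.
Qed.

Lemma measurable_fun_rVP d (T : measurableType d) (f : T -> 'rV[R]_n) :
  (forall i, measurable_fun [set: T] (rV_coord i \o f)) ->
  measurable_fun [set: T] f.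
Proof.
move=> mf _ Y mY; rewrite setTI.
suff : @measurable _ 'rV[R]_n `<=` [set A | measurable (f @^-1` A)].
  by move=> /(_ _ mY).
apply: smallest_sub.
  split => [|A mA|F mF] /=.
  - by rewrite preimage_set0.
  - by rewrite setTD preimage_setC; exact: measurableC.
  - by rewrite preimage_bigcup; apply: bigcup_measurable => k _; exact: mF.
move=> A; rewrite -bigcup_seq => -[i _ [B mB <-]] /=.
by rewrite setTI -[X in measurable X]setTI -comp_preimage; exact: mf.
Qed.

End measurable_rV.

Section rV_cons.
Context {R : realType} (n : nat).

Definition rV_cons (p : measurableTypeR R * 'rV[R]_n) : 'rV[R]_n.+1 :=
  \row_i (if unlift ord0 i is Some j then p.2 ord0 j else p.1).

Definition rV_uncons (x : 'rV[R]_n.+1) : measurableTypeR R * 'rV[R]_n :=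
  (x ord0 ord0, \row_j x ord0 (lift ord0 j)).

Lemma rV_consK : cancel rV_cons rV_uncons.
Proof.
move=> [a y]; congr (_, _); first by rewrite mxE unlift_none.
by apply/rowP => j; rewrite !mxE liftK.
Qed.

Lemma measurable_rV_cons : measurable_fun setT rV_cons.
Proof.
apply: measurable_fun_rVP => i; case: (unliftP ord0 i) => [j|] ->.
  rewrite (_ : _ \o _ = rV_coord j \o snd); last first.
    by apply/funext => p; rewrite /= /rV_coord mxE liftK.
  by apply: measurableT_comp; [exact: measurable_rV_coord|exact: measurable_snd].
rewrite (_ : _ \o _ = fst); first exact: measurable_fst.
by apply/funext => p; rewrite /= /rV_coord mxE unlift_none.
Qed.

Lemma measurable_rV_uncons : measurable_fun setT rV_uncons.
Proof.
apply/measurable_fun_pairP; split; first exact: measurable_rV_coord.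
apply: measurable_fun_rVP => i.
rewrite (_ : _ \o _ = rV_coord (lift ord0 i)); first exact: measurable_rV_coord.
by apply/funext => p; rewrite /= /rV_coord mxE.
Qed.

End rV_cons.

Section product_lebesgue.
Local Open Scope ereal_scope.
Context {R : realType} d d' (T : measurableType d) (T' : measurableType d').
Variable mu : {sigma_finite_measure set T -> \bar R}.
Variables (f : measurableTypeR R * T -> T') (g : T' -> measurableTypeR R * T).

(* The hypotheses on f are arguments so that the measure instances below can
   depend on them. *)
Definition product_lebesgue_of of measurable_fun setT f & measurable_fun setT g
  & cancel f g : set T' -> \bar R := pushforward (@lebesgue_measure R \x mu) f.

Hypotheses (mf : measurable_fun setT f) (mg : measurable_fun setT g).
Hypothesis fK : cancel f g.
Local Notation m := (product_lebesgue_of mf mg fK).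

Let m0 : m set0 = 0.
Proof. by rewrite /product_lebesgue_of /pushforward preimage_set0 measure0. Qed.

Let m_ge0 A : 0 <= m A.
Proof. by rewrite /product_lebesgue_of /pushforward measure_ge0. Qed.

Let m_sigma_additive : semi_sigma_additive m.
Proof.
move=> F mF tF mUF; rewrite /product_lebesgue_of /pushforward preimage_bigcup.
apply: measure_semi_sigma_additive.
- by move=> k; rewrite -[X in measurable X]setTI; exact: mf.
- apply/trivIsetP => /= i j _ _ ij; rewrite -preimage_setI.
  by move/trivIsetP : tF => /(_ _ _ _ _ ij) ->//; rewrite preimage_set0.
- by rewrite -preimage_bigcup -[X in measurable X]setTI; exact: mf.
Qed.

HB.instance Definition _ := isMeasure.Build _ _ _ m m0 m_ge0 m_sigma_additive.

Let m_sigma_finite : sigma_finite setT m.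
Proof.
have /sigma_finiteP[F [FT ndF Foo]] := sigma_finiteT (@lebesgue_measure R).
have /sigma_finiteP[G [GT ndG Goo]] := sigma_finiteT mu.
exists (fun k => g @^-1` (F k `*` G k)).
  rewrite -preimage_bigcup -[LHS](@preimage_setT _ _ g); congr (_ @^-1` _).
  rewrite -setXTT FT GT predeqE => -[x y]; split.
    move=> [/= [k _ Fkx] [l _ Gly]]; exists (maxn k l) => //; split.
    - by move: x Fkx; exact/subsetPset/ndF/leq_maxl.
    - by move: y Gly; exact/subsetPset/ndG/leq_maxr.
  by move=> [k _ []/= ? ?]; split; exists k.
move=> k; have [mF Fk] := Foo k; have [mG Gk] := Goo k; split.
  by rewrite -[X in measurable X]setTI; apply: mg => //; exact: measurableX.
rewrite /product_lebesgue_of /pushforward -comp_preimage.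
rewrite (_ : _ \o _ = id) ?preimage_id; last by apply/funext => p; exact: fK.
by rewrite product_measure1E// lte_mul_pinfty// ge0_fin_numE.
Qed.

HB.instance Definition _ := Measure_isSigmaFinite.Build _ _ _ m m_sigma_finite.

Definition product_lebesgue : {sigma_finite_measure set T' -> \bar R} := m.

End product_lebesgue.

(* Lebesgue measure on R^n as the n-fold product of the one-dimensional
   Lebesgue measure; R^0 is a single point of mass 1. *)
Fixpoint lebesgue_rV (R : realType) (n : nat) :
    {sigma_finite_measure set 'rV[R]_n -> \bar R} :=
  match n return {sigma_finite_measure set 'rV[R]_n -> \bar R} with
  | 0 => \d_(0 : 'rV[R]_0)
  | m.+1 => product_lebesgue (lebesgue_rV R m) (@measurable_rV_cons R m)
              (@measurable_rV_uncons R m) (@rV_consK R m)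
  end.

Lemma lebesgue_rV_box (R : realType) (n : nat) (a b : 'rV[R]_n) :
  (forall i, a ord0 i <= b ord0 i) ->
  lebesgue_rV R n [set x | forall i, x ord0 i \in `[a ord0 i, b ord0 i]] =
  (\prod_i (b ord0 i - a ord0 i))%:E.
Proof.
elim: n a b => [|n IHn] a b ab /=.
  by rewrite big_ord0 diracE mem_set// => -[].
pose a' := (rV_uncons a).2; pose b' := (rV_uncons b).2.
have mbox : measurable [set x : 'rV[R]_n | forall i, x ord0 i \in `[a' ord0 i, b' ord0 i]].
  rewrite (_ : mkset _ = \big[setI/setT]_(i < n) (rV_coord i @^-1` `[a' ord0 i, b' ord0 i])).
    by apply: bigsetI_measurable => i _; rewrite -[X in measurable X]setTI; exact: measurable_rV_coord.
  rewrite -bigcap_seq; apply/seteqP; split => [x xab i _|x xab i] /=; first exact: xab.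
  by apply: xab; rewrite /= mem_index_enum.
rewrite /product_lebesgue_of /pushforward.
rewrite (_ : _ @^-1` _ = `[a ord0 ord0, b ord0 ord0] `*`
    [set x : 'rV[R]_n | forall i, x ord0 i \in `[a' ord0 i, b' ord0 i]]); last first.
  apply/seteqP; split => [[x y] /= H|[x y] /= [H1 H2] i].
    split; first by have := H ord0; rewrite mxE unlift_none.
    by move=> i; have := H (lift ord0 i); rewrite !mxE liftK.
  case: (unliftP ord0 i) => [j|] ->; rewrite mxE ?liftK ?unlift_none//.
  by have := H2 j; rewrite !mxE.
rewrite product_measure1E// IHn; last by move=> i; rewrite !mxE.
rewrite big_ord_recl EFinM; congr (_ * _)%E; last first.
  by congr EFin; apply: eq_bigr => i _; rewrite !mxE.
apply: etrans (lebesgue_measure_itv _) _; rewrite /= lte_fin.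
case: ifPn => [//|]; rewrite -leNgt => ba.
by rewrite (@le_anti _ _ (a ord0 ord0) (b ord0 ord0)) ?subrr// ab ba.
Qed.

Section sobolev.
Context {R : realType} {d : nat}.
Implicit Types (Omega : set 'rV[R]_d) (u v w f : 'rV[R]_d -> R).

Local Notation mu := (lebesgue_rV R d).

Definition unit_rV (i : 'I_d) : 'rV[R]_d := delta_mx ord0 i.

Definition partial (i : 'I_d) f : 'rV[R]_d -> R := fun x => 'D_(unit_rV i) f x.

Definition laplacian f : 'rV[R]_d -> R :=
  fun x => \sum_(i < d) partial i (partial i f) x.

Definition smooth f : Prop := forall s : seq 'I_d,
  continuous (foldr partial f s) /\
  forall i x, derivable (foldr partial f s) x (unit_rV i).

(* C_c^oo(Omega), extended by zero to the whole space *)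
Definition test_function Omega f : Prop :=
  [/\ smooth f, compact (closure [set x | f x != 0]) &
      closure [set x | f x != 0] `<=` Omega].

(* Functions are defined on the whole space, but only their values on Omega
   matter; functions equal almost everywhere on Omega are not identified. *)
Definition L2 Omega v : Prop := (v \_ Omega : 'rV[R]_d -> R) \in Lfun mu 2%:E.

Definition norm0 Omega v : R := fine 'N[mu]_2%:E[EFin \o (v \_ Omega)].

Definition is_grad Omega v (g : 'I_d -> 'rV[R]_d -> R) : Prop :=
  forall i, L2 Omega (g i) /\
    forall phi, test_function Omega phi ->
      \int[mu]_(x in Omega) (v x * partial i phi x) =
      - \int[mu]_(x in Omega) (g i x * phi x).

Definition is_laplacian Omega v w : Prop :=
  L2 Omega w /\
  forall phi, test_function Omega phi ->
    \int[mu]_(x in Omega) (v x * laplacian phi x) =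
    \int[mu]_(x in Omega) (w x * phi x).

Definition H1 Omega v : Prop := L2 Omega v /\ exists g, is_grad Omega v g.

(* Representatives of the weak gradient and of the distributional Laplacian;
   they are unique up to a null set when they exist. *)
Definition grad Omega v : 'I_d -> 'rV[R]_d -> R :=
  xget (fun _ _ => 0) [set g | is_grad Omega v g].

Definition dlaplacian Omega v : 'rV[R]_d -> R :=
  xget (fun=> 0) [set w | is_laplacian Omega v w].

Definition seminorm1 Omega v : R :=
  Num.sqrt (\sum_(i < d) norm0 Omega (grad Omega v i) ^+ 2).

(* H^1_0(Omega), the closure of C_c^oo(Omega) in H^1(Omega) *)
Definition H10 Omega v : Prop :=
  H1 Omega v /\
  forall e : R, 0 < e -> exists phi, test_function Omega phi /\
    Num.sqrt (norm0 Omega (v \- phi) ^+ 2 + seminorm1 Omega (v \- phi) ^+ 2) < e.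

Definition spaceV Omega v : Prop :=
  H1 Omega v /\ exists w, is_laplacian Omega v w.

Definition J Omega (C : R) f v : R :=
  C * norm0 Omega (dlaplacian Omega v \+ f) + seminorm1 Omega v.

Definition minimizer Omega (C : R) f v : Prop :=
  spaceV Omega v /\ forall w, spaceV Omega w -> J Omega C f v <= J Omega C f w.

(* -Delta u = f in Omega, u = 0 on the boundary *)
Definition dirichlet_solution Omega f u : Prop :=
  H10 Omega u /\ is_laplacian Omega u (\- f).

Definition ae_zero Omega v : Prop := v = cst 0 %[ae mu in Omega].

Definition dirichlet_eigenpair Omega (lambda : R) u : Prop :=
  ~ ae_zero Omega u /\ dirichlet_solution Omega (fun x => lambda * u x) u.

Definition first_dirichlet_eigenpair Omega (lambda : R) u : Prop :=
  dirichlet_eigenpair Omega lambda u /\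
  forall m w, dirichlet_eigenpair Omega m w -> lambda <= m.

(* For bounded Omega the set is bounded above, so that the real-valued
   supremum is the true one. *)
Definition poincare_constant Omega : R :=
  sup [set norm0 Omega w / seminorm1 Omega w | w in
       [set w | H10 Omega w /\ ~ ae_zero Omega w]].

End sobolev.

Section lipschitz_domain.
Context {R : realType} {n : nat}.

(* Near each boundary point, after a rigid change of coordinates, Omega is the
   strict epigraph of a Lipschitz function.  Balls are for the sup norm, which
   is immaterial since the radius is arbitrary. *)
Definition lipschitz_boundary (Omega : set 'rV[R]_n.+1) : Prop :=
  forall x0, (closure Omega `\` Omega^°) x0 ->
  exists (r : R) (Q : 'M[R]_n.+1) (gamma : 'rV[R]_n -> R),
    [/\ 0 < r, Q *m Q^T = 1%:M, lipschitz gamma &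
        forall x, ball x0 r x ->
          let y := (x - x0) *m Q in
          Omega x <-> gamma (\row_j y ord0 (lift ord0 j)) < y ord0 ord0].

Definition lipschitz_domain (Omega : set 'rV[R]_n.+1) : Prop :=
  [/\ open Omega, Omega !=set0, connected Omega, bounded_set Omega &
      lipschitz_boundary Omega].

End lipschitz_domain.

(* Main.v *)
Require Import Defs.
From mathcomp Require Import all_boot all_order all_algebra.
From mathcomp Require Import all_classical all_reals all_analysis.
From mathcomp Require Import measurable_realfun.
From mathcomp Require Import ring lra.

Set Implicit Arguments.
Unset Strict Implicit.
Unset Printing Implicit Defensive.

Import Order.TTheory GRing.Theory Num.Theory.
Import numFieldNormedType.Exports.

Local Open Scope classical_set_scope.
Local Open Scope ring_scope.

(** Why the theorem is true.

    Write [a] for the Dirichlet form, [r] for the square root of [lambda1] and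
    [N] for the norm of [phi1].  For a competitor [w], Green's formula against
    [phi1] reads: the inner product of [Delta w + f] with [phi1] is
    [- a(w, phi1) + lambda1 * N ^+ 2].  The Cauchy-Schwarz inequality bounds the
    left-hand side by the norm of the residual times [N], and [a(w, phi1)] by
    the seminorm of [w] times that of [phi1], which is [r * N].  Dividing by
    [r * N] gives [r * N <= r^-1 * residual + seminorm], that is, the functional
    with weight [r^-1] is at least [r * N] ([J_ge]).  On [t * phi1 + c] both
    terms are explicit ([J_affine]) and they add up to [r * N] when the weight
    is [r^-1], whatever [t] between zero and one.  With a smaller weight the
    zero function does strictly better than [phi1].

    It remains to see that the Poincare constant is [r^-1]
    ([poincare_constantE]).  The eigenfunction itself gives one inequality.  The
    other one requires that the supremum of the Rayleigh quotient be attained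
    ([maximizer_pair]): a maximizer solves the Euler-Lagrange equation, hence is
    an eigenfunction ([exists_eigenpair]), and the eigenvalue [lambda1] is the
    least one ([rayleighE]).

    Attainment is a compactness statement.  Translating a test function by [h]
    changes it in the mean by at most [h] times its derivative
    ([nrm_translate_sub]); averaging over small cubes then shows that finitely
    many linear functionals control the norm up to a small fraction of the
    energy ([rellich_test]).  Along an ultrafilter all these functionals
    converge, so a maximizing sequence is Cauchy in the mean, and the
    parallelogram law makes it Cauchy in energy ([maximizing_cauchy]).  The
    limit exists by completeness of the space of square-integrable functions
    ([riesz_fischer]).

    Finally the gradient and the Laplacian in the definition of the functional
    are arbitrary representatives.  Their norms are determined because a
    square-integrable function orthogonal to all test functions vanishes almost
    everywhere ([fundamental_lemma]), which rests on explicit bump functions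
    approximating the indicators of open sets ([open_test_approx]). *)

(** * Square-integrable functions *)

Section square_integrable.
Context d (T : measurableType d) (R : realType).
Variables (mu : {measure set T -> \bar R}) (D : set T).
Hypothesis mD : measurable D.
Implicit Types u v w : T -> R.

Definition sqint u : Prop :=
  measurable_fun D u /\ mu.-integrable D (EFin \o (fun x => u x ^+ 2)).

Definition dot u v : R := \int[mu]_(x in D) (u x * v x).

Definition nrm u : R := Num.sqrt (dot u u).

Lemma sqint_measurable u : sqint u -> measurable_fun D u. Proof. by case. Qed.

Lemma sqint_mul u v : sqint u -> sqint v ->
  mu.-integrable D (EFin \o (fun x => u x * v x)).
Proof.
move=> [mu_ iu] [mv iv].
have iuv := integrableD mD iu iv.
apply: (le_integrable mD _ _ iuv) => [|x Dx /=].
  by apply/measurable_EFinP; exact: measurable_funM.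
rewrite lee_fin (ger0_norm (_ : 0 <= u x ^+ 2 + v x ^+ 2)); last first.
  by rewrite addr_ge0// sqr_ge0.
rewrite ler_norml; apply/andP; split; nra.
Qed.

Lemma sqintD u v : sqint u -> sqint v -> sqint (u \+ v).
Proof.
move=> su sv; split.
  by apply: measurable_funD; [exact: (proj1 su)|exact: (proj1 sv)].
have i1 := integrableD mD (proj2 su) (proj2 sv).
have i2 := integrableD mD i1 (integrableZl mD 2 (sqint_mul su sv)).
apply: (le_integrable mD _ _ i2) => [|x Dx /=].
  apply/measurable_EFinP; apply: measurable_funX.
  by apply: measurable_funD; [exact: (proj1 su)|exact: (proj1 sv)].
by rewrite lee_fin le_eqVlt; apply/orP; left; apply/eqP; congr `|_|; ring.
Qed.

Lemma sqintZ a u : sqint u -> sqint (fun x => a * u x).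
Proof.
move=> su; split; first by apply: measurable_funM => //; exact: (proj1 su).
have i2 := integrableZl mD (a ^+ 2) (proj2 su).
apply: (le_integrable mD _ _ i2) => [|x Dx /=].
  apply/measurable_EFinP; apply: measurable_funX.
  by apply: measurable_funM => //; exact: (proj1 su).
by rewrite lee_fin exprMn.
Qed.

Lemma sqintN u : sqint u -> sqint (\- u).
Proof.
move=> /(sqintZ (-1)); rewrite (_ : (fun x => -1 * u x) = \- u)//.
by apply/funext => x; rewrite mulN1r.
Qed.

Lemma sqintB u v : sqint u -> sqint v -> sqint (u \- v).
Proof. by move=> su sv; apply: sqintD => //; exact: sqintN. Qed.

Lemma sqint0 : sqint (fun=> 0).
Proof.
split; first exact: measurable_cst.
rewrite (_ : _ \o _ = cst 0%E); first exact: integrable0.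
by apply/funext => x /=; rewrite expr0n.
Qed.

Lemma sqint_sum (I : eqType) (s : seq I) (u : I -> T -> R) :
  (forall i, sqint (u i)) -> sqint (fun x => \sum_(i <- s) u i x).
Proof.
move=> su; elim: s => [|i s IH].
  by under eq_fun do rewrite big_nil; exact: sqint0.
under eq_fun do rewrite big_cons.
exact: (sqintD (su i) IH).
Qed.

Lemma dotC u v : dot u v = dot v u.
Proof. by apply: eq_Rintegral => x _; rewrite mulrC. Qed.

Lemma dotDl u v w : sqint u -> sqint v -> sqint w ->
  dot (u \+ v) w = dot u w + dot v w.
Proof.
move=> su sv sw; rewrite /dot -RintegralD//; try exact: sqint_mul.
by apply: eq_Rintegral => x _; rewrite mulrDl.
Qed.

Lemma dotDr u v w : sqint u -> sqint v -> sqint w ->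
  dot w (u \+ v) = dot w u + dot w v.
Proof. by move=> su sv sw; rewrite dotC dotDl// !(dotC w). Qed.

Lemma dotZl a u v : sqint u -> sqint v ->
  dot (fun x => a * u x) v = a * dot u v.
Proof.
move=> su sv; rewrite /dot -RintegralZl//; try exact: sqint_mul.
by apply: eq_Rintegral => x _; rewrite mulrA.
Qed.

Lemma dotZr a u v : sqint u -> sqint v ->
  dot v (fun x => a * u x) = a * dot v u.
Proof. by move=> su sv; rewrite dotC dotZl// dotC. Qed.

Lemma dotNl u v : sqint u -> sqint v -> dot (\- u) v = - dot u v.
Proof.
move=> su sv; rewrite -[RHS]mulN1r -dotZl//.
by apply: eq_Rintegral => x _; rewrite mulN1r.
Qed.

Lemma dotBl u v w : sqint u -> sqint v -> sqint w ->
  dot (u \- v) w = dot u w - dot v w.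
Proof. by move=> su sv sw; rewrite dotDl ?dotNl//; exact: sqintN. Qed.

Lemma dotBr u v w : sqint u -> sqint v -> sqint w ->
  dot w (u \- v) = dot w u - dot w v.
Proof. by move=> su sv sw; rewrite dotC dotBl// !(dotC w). Qed.

Lemma dot_ge0 u : 0 <= dot u u.
Proof. by apply: Rintegral_ge0 => x _; rewrite -expr2 sqr_ge0. Qed.

Lemma nrm_ge0 u : 0 <= nrm u. Proof. exact: sqrtr_ge0. Qed.

Lemma nrm2 u : nrm u ^+ 2 = dot u u.
Proof. by rewrite sqr_sqrtr// dot_ge0. Qed.

Lemma dot_addself u v : sqint u -> sqint v ->
  dot (u \+ v) (u \+ v) = dot u u + 2 * dot u v + dot v v.
Proof.
by move=> su sv; rewrite dotDl// ?dotDr// ?(dotC v u); [ring|exact: sqintD].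
Qed.

Lemma dot_subself u v : sqint u -> sqint v ->
  dot (u \- v) (u \- v) = dot u u - 2 * dot u v + dot v v.
Proof.
by move=> su sv; rewrite dotBl// ?dotBr// ?(dotC v u); [ring|exact: sqintB].
Qed.

End square_integrable.

(** The common core of the Cauchy-Schwarz inequalities and of the Euler-Lagrange
    equation: evaluate the quadratic function at its vertex. *)
Lemma quadratic_ge0_disc (R : realFieldType) (a b c : R) :
  (forall t, 0 <= a * t ^+ 2 + 2 * b * t + c) -> 0 <= a -> b ^+ 2 <= a * c.
Proof.
move=> H a0; have c0 : 0 <= c by have := H 0; rewrite expr0n/= !mulr0 !add0r.
have [a_0|an0] := eqVneq a 0.
  have [->|bn0] := eqVneq b 0; first by rewrite expr0n a_0 mul0r.
  have := H (- (c + 1) / (2 * b)); rewrite a_0 mul0r add0r.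
  rewrite [X in X + c](_ : _ = - (c + 1)); last by field.
  by lra.
have ap : 0 < a by rewrite lt_neqAle eq_sym an0.
have := H (- b / a).
rewrite (_ : a * _ + _ + _ = (a * c - b ^+ 2) / a); last by field.
by rewrite pmulr_lge0 ?invr_gt0// subr_ge0.
Qed.

Section square_integrable_norm.
Context d (T : measurableType d) (R : realType).
Variables (mu : {measure set T -> \bar R}) (D : set T).
Hypothesis mD : measurable D.
Implicit Types u v w : T -> R.
Local Notation sqint := (sqint mu D).
Local Notation dot := (dot mu D).
Local Notation nrm := (nrm mu D).

Lemma cauchy_schwarz_sqr u v : sqint u -> sqint v ->
  dot u v ^+ 2 <= dot u u * dot v v.
Proof.
move=> su sv; rewrite mulrC; apply: quadratic_ge0_disc; last exact: dot_ge0.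
move=> t; have := dot_ge0 mu D (u \+ (fun x => t * v x)).
have stv := sqintZ mD t sv.
rewrite (dot_addself mD)// !(dotZr mD)// (dotZl mD)//.
by congr (0 <= _); ring.
Qed.

Lemma cauchy_schwarz u v : sqint u -> sqint v -> dot u v <= nrm u * nrm v.
Proof.
move=> su sv; rewrite -sqrtrM ?dot_ge0//.
rewrite (le_trans (ler_norm _))// -sqrtr_sqr ler_wsqrtr//.
exact: cauchy_schwarz_sqr.
Qed.

Lemma nrmD u v : sqint u -> sqint v -> nrm (u \+ v) <= nrm u + nrm v.
Proof.
move=> su sv; rewrite -(@ler_pXn2r _ 2)// ?nnegrE ?addr_ge0 ?nrm_ge0//.
rewrite nrm2 (dot_addself mD)// sqrrD !nrm2.
by have := cauchy_schwarz su sv; rewrite -mulr_natl; lra.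
Qed.

Lemma nrmN u : nrm (\- u) = nrm u.
Proof. by congr Num.sqrt; apply: eq_Rintegral => x _; rewrite mulrNN. Qed.

Lemma nrmB u v : sqint u -> sqint v -> nrm (u \- v) <= nrm u + nrm v.
Proof.
by move=> su sv; rewrite (le_trans (nrmD su _)) ?nrmN//; exact: sqintN.
Qed.

Lemma nrmZ a u : sqint u -> nrm (fun x => a * u x) = `|a| * nrm u.
Proof.
move=> su; have sau := sqintZ mD a su.
rewrite /nrm (dotZr mD)// (dotZl mD)// mulrA sqrtrM; last first.
  by rewrite -expr2 sqr_ge0.
by rewrite -expr2 sqrtr_sqr.
Qed.

Lemma dot_eq0_ae u : sqint u -> dot u u = 0 -> u = cst 0 %[ae mu in D].
Proof.
move=> su u0.
have mu2 : measurable_fun D (EFin \o (fun x => u x ^+ 2)).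
  by case: su => _ /integrableP[].
have : (\int[mu]_(x in D) `|(EFin \o (fun x => (u x ^+ 2)%R)) x|)%E = 0%E.
  have := integrable_fin_num mD (proj2 su) => fin.
  transitivity (\int[mu]_(x in D) (EFin \o (fun x => (u x ^+ 2)%R)) x)%E.
    by apply: eq_integral => x _; rewrite gee0_abs// lee_fin sqr_ge0.
  rewrite -[LHS]fineK//; congr EFin; apply: etrans u0.
  by rewrite /dot; apply: eq_Rintegral => x _; rewrite /= expr2.
move/(ae_eq_integral_abs mu mD mu2); apply: filterS => x H Dx.
by have /eqP := H Dx; rewrite eqe sqrf_eq0 => /eqP.
Qed.

Lemma eq_ae_dotr u v w : measurable_fun D u -> measurable_fun D v ->
  measurable_fun D w -> v = w %[ae mu in D] -> dot u v = dot u w.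
Proof.
move=> mu_ mv mw vw; congr fine; apply: ae_eq_integral => //.
- by apply/measurable_EFinP; exact: measurable_funM.
- by apply/measurable_EFinP; exact: measurable_funM.
- by apply: filterS vw => x H Dx /=; rewrite H.
Qed.

Lemma eq_ae_nrm u v : measurable_fun D u -> measurable_fun D v ->
  u = v %[ae mu in D] -> nrm u = nrm v.
Proof.
move=> mu_ mv uv; congr Num.sqrt.
by rewrite (eq_ae_dotr mu_ mu_ mv)// (dotC mu D) (eq_ae_dotr mv mu_ mv).
Qed.

Lemma sqint_bounded u (M : R) : (mu D < +oo)%E -> measurable_fun D u ->
  (forall x, D x -> `|u x| <= M) -> sqint u.
Proof.
move=> fD mu_ ub; split=> //.
have iM : mu.-integrable D (EFin \o cst (M ^+ 2)).
  apply/integrableP; split; first by apply/measurable_EFinP.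
  rewrite (integral_cst mu mD (`|M ^+ 2|%:E)) lte_mul_pinfty//.
apply: (le_integrable mD _ _ iM) => [|x Dx].
  by apply/measurable_EFinP; exact: measurable_funX.
rewrite lee_fin/= normrX [leRHS]ger0_norm ?sqr_ge0//.
by rewrite ler_pXn2r ?nnegrE ?normr_ge0 ?(le_trans _ (ub _ Dx))// ub.
Qed.

Lemma sqint_cst (a : R) : (mu D < +oo)%E -> sqint (fun=> a).
Proof. by move=> fD; apply: (sqint_bounded (M := `|a|)). Qed.

End square_integrable_norm.

Lemma sqintS d (T : measurableType d) (R : realType)
  (mu : {measure set T -> \bar R}) (D : set T) (u : T -> R) :
  measurable D -> sqint mu setT u -> sqint mu D u.
Proof.
move=> mD [mf fi]; split; first exact: (measurable_funS measurableT).
exact: (integrableS measurableT mD).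
Qed.

Lemma dot_sumr d (T : measurableType d) (R : realType)
  (mu : {measure set T -> \bar R}) (D : set T) (I : eqType) (s : seq I)
  (f : T -> R) (F : I -> T -> R) : measurable D -> sqint mu D f ->
  (forall i, sqint mu D (F i)) ->
  dot mu D f (fun x => \sum_(i <- s) F i x) = \sum_(i <- s) dot mu D f (F i).
Proof.
move=> mD sf sF; elim: s => [|i s IH].
  rewrite big_nil -[RHS](mul0r (dot mu D f f)) -(dotZr mD)//.
  by apply: eq_Rintegral => x _; rewrite big_nil mul0r.
rewrite big_cons -IH -(dotDr mD)//; last exact: sqint_sum.
by apply: eq_Rintegral => x _; rewrite big_cons.
Qed.

Section norm0_nrm.
Context {R : realType} {n : nat}.
Variables (Omega : set 'rV[R]_n).
Hypothesis mO : measurable Omega.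
Local Notation mu := (lebesgue_rV R n).

Lemma L2_sqint v : L2 Omega v <-> sqint mu Omega v.
Proof.
split=> [|[mv iv]].
  move=> l2v; have := Lfun2_integrable_sqr l2v => iv.
  have mv : measurable_fun Omega v.
    apply/measurable_restrictT => //.
    by move: l2v; rewrite /L2 inE => /andP[+ _]; rewrite inE.
  split=> //; apply/(integrable_mkcond _ mO).
  rewrite (_ : _ \_ _ = EFin \o (fun x => (v \_ Omega) x ^+ 2))//.
  apply/funext => x /=; rewrite !patchE; case: ifPn => //= _.
  by rewrite expr0n.
rewrite /L2 inE; apply/andP; split.
  by rewrite inE/=; apply/(measurable_restrictT v mO).
rewrite inE /= /finite_norm unlock; apply: poweR_lty.
have := integrable_lty mO iv; rewrite integral_mkcond.
apply: le_lt_trans; rewrite le_eqVlt; apply/orP; left; apply/eqP.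
apply: eq_integral => x _.
rewrite /= !patchE /=; case: ifPn => _ /=; last first.
  by rewrite normr0 powR0.
by rewrite powR_mulrn// real_normK ?num_real.
Qed.

Lemma norm0E v : sqint mu Omega v -> norm0 Omega v = nrm mu Omega v.
Proof.
move=> sv; rewrite /norm0 unlock.
rewrite (_ : (\int[mu]_x _)%E = (dot mu Omega v v)%:E).
  by rewrite poweR_EFin /= powR12_sqrt// dot_ge0.
have fin := integrable_fin_num mO (proj2 sv).
rewrite /dot /Rintegral.
transitivity (\int[mu]_(x in Omega) (EFin \o (fun x => (v x ^+ 2)%R)) x)%E.
  rewrite [RHS]integral_mkcond; apply: eq_integral => x _.
  rewrite /= !patchE /=; case: ifPn => _ /=; last first.
    by rewrite normr0 powR0.
  by rewrite powR_mulrn// real_normK ?num_real.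
by rewrite -[LHS]fineK.
Qed.

End norm0_nrm.

Section riesz_fischer.
Context d (T : measurableType d) (R : realType).
Variables (mu : {measure set T -> \bar R}) (D : set T).
Hypothesis mD : measurable D.
Local Notation sqint := (sqint mu D).
Local Notation dot := (dot mu D).
Local Notation nrm := (nrm mu D).

Variable u_ : nat -> T -> R.
Hypothesis su : forall n, sqint (u_ n).
Hypothesis cu : forall n, nrm (u_ n.+1 \- u_ n) <= 4^-1 ^+ n.

Let sdu n : sqint (u_ n.+1 \- u_ n). Proof. exact: sqintB. Qed.

(** The factor vanishing at [m = 0] is what lets the induction on [m] close. *)
Lemma fast_cauchy_nrm N m :
  nrm (u_ (N + m)%N \- u_ N) <= 2 * 4^-1 ^+ N * (1 - 4^-1 ^+ m).
Proof.
elim: m => [|m IH].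
  rewrite addn0 expr0 subrr mulr0.
  rewrite (_ : _ \- _ = fun x => 0 * u_ N x); last first.
    by apply/funext => x /=; rewrite subrr mul0r.
  by rewrite nrmZ// normr0 mul0r.
rewrite (_ : _ \- _ = (u_ (N + m).+1 \- u_ (N + m)%N) \+ (u_ (N + m)%N \- u_ N)); last first.
  by apply/funext => x /=; rewrite addnS; ring.
rewrite (le_trans (nrmD mD _ _))//; first exact: sqintB.
rewrite (le_trans (lerD (cu _) IH))// exprD exprS.
have : 0 <= 4^-1 ^+ N * 4^-1 ^+ m :> R by rewrite mulr_ge0 ?exprn_ge0.
set a := _ ^+ N; set b := _ ^+ m; nra.
Qed.

(* The squared increments are at most 16 ^- n in the mean, so the weights 4 ^ n
   leave a convergent series; where its sum is finite, the increments are of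
   order 2 ^- n. *)
Let S x : \bar R := (\sum_(0 <= n <oo) (4 ^+ n * (u_ n.+1 x - u_ n x) ^+ 2)%:E)%E.

Let mS_ n : measurable_fun D
  (fun x => (4 ^+ n * (u_ n.+1 x - u_ n x) ^+ 2)%:E).
Proof.
apply/measurable_EFinP; apply: measurable_funM => //.
apply: measurable_funX; exact: (sqint_measurable (sdu n)).
Qed.

Let S_ge0 n x : (0%:E <= (4 ^+ n * (u_ n.+1 x - u_ n x) ^+ 2)%:E :> \bar R)%E.
Proof. by rewrite lee_fin; apply: mulr_ge0; [exact: exprn_ge0|exact: sqr_ge0]. Qed.

Let int_S n : (\int[mu]_(x in D) (4 ^+ n * (u_ n.+1 x - u_ n x) ^+ 2)%:E
  <= (4^-1 ^+ n)%:E)%E.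
Proof.
have i1 := proj2 (sdu n).
have -> : (\int[mu]_(x in D) (4 ^+ n * (u_ n.+1 x - u_ n x) ^+ 2)%:E =
  (4 ^+ n * dot (u_ n.+1 \- u_ n) (u_ n.+1 \- u_ n))%:E)%E.
  have fin := integrable_fin_num mD (integrableZl mD (4 ^+ n) i1).
  transitivity (\int[mu]_(x in D) ((4 ^+ n)%:E *
    (EFin \o (fun x => ((u_ n.+1 \- u_ n) x ^+ 2)%R)) x))%E.
    by apply: eq_integral => x _; rewrite /= EFinM.
  rewrite -[LHS]fineK// -(dotZl mD)//; congr EFin; congr fine.
  by apply: eq_integral => x _; rewrite /= -EFinM expr2 mulrA.
rewrite lee_fin -nrm2.
have := cu n; have := nrm_ge0 mu D (u_ n.+1 \- u_ n).
set a := nrm _ => a0 ale.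
have a2 : a ^+ 2 <= 4^-1 ^+ n * 4^-1 ^+ n.
  by rewrite expr2 ler_pM.
rewrite (le_trans (ler_wpM2l _ a2)) ?exprn_ge0//.
by rewrite mulrA -exprMn mulfV// expr1n mul1r.
Qed.

Lemma fast_cauchy_ae : \forall x \ae mu, D x -> cvgn (u_ ^~ x).
Proof.
have iS : (\int[mu]_(x in D) S x <= 2%:E)%E.
  rewrite integral_nneseries//; apply: lime_le.
    by apply: is_cvg_nneseries => n _ _; apply: integral_ge0 => x _; exact: S_ge0.
  near=> N; apply: (@le_trans _ _ (\sum_(0 <= k < N) (4^-1 ^+ k)%:E)%E).
    by apply: lee_sum => k _; exact: int_S.
  rewrite sumEFin lee_fin.
  have : \sum_(0 <= k < N) 4^-1 ^+ k <= 2 * (1 - 4^-1 ^+ N) :> R.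
    elim: (N) => [|k IH]; first by rewrite big_nil expr0 subrr mulr0.
    rewrite big_nat_recr//= exprS; have : 0 <= 4^-1 ^+ k :> R by exact: exprn_ge0.
    by move: IH; lra.
  have : 0 <= 4^-1 ^+ N :> R by exact: exprn_ge0.
  by lra.
have mS : measurable_fun D S by apply: ge0_emeasurable_sum => // n x _ _; exact: S_ge0.
have integS : mu.-integrable D S.
  apply/integrableP; split=> //.
  rewrite (le_lt_trans _ (ltry 2))// (le_trans _ iS)//.
  apply: ge0_le_integral => //; first by apply: measurableT_comp.
  by move=> x _; rewrite gee0_abs// nneseries_ge0// => k _ _; exact: S_ge0.
have := integrable_ae mD integS; apply: filterS => x H Dx.
have := H Dx; rewrite fin_num_abs => SxM.
pose M := fine (S x).
have SxE : S x = M%:E by rewrite fineK// H.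
have M0 : 0 <= M by rewrite -lee_fin -SxE nneseries_ge0// => k _ _; exact: S_ge0.
have bd n : `|u_ n.+1 x - u_ n x| <= Num.sqrt M * 2^-1 ^+ n.
  have : (4 ^+ n * (u_ n.+1 x - u_ n x) ^+ 2) <= M.
    rewrite -lee_fin -SxE.
    have := @nneseries_lim_ge R (fun k => (4 ^+ k * (u_ k.+1 x - u_ k x) ^+ 2)%:E)
      xpredT 0%N n.+1 (fun k _ _ => S_ge0 k x).
    rewrite big_nat_recr//=; apply: le_trans.
    by rewrite leeDr// sume_ge0// => k _; exact: S_ge0.
  move=> le4; rewrite -(@ler_pXn2r _ 2)// ?nnegrE ?mulr_ge0 ?sqrtr_ge0 ?exprn_ge0//.
  rewrite exprMn sqr_sqrtr// real_normK ?num_real// exprAC.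
  rewrite (_ : 2^-1 ^+ 2 = 4^-1 :> R); last by rewrite expr2 -invfM -natrM.
  by rewrite exprVn ler_pdivlMr ?exprn_gt0// mulrC.
have cs : cvgn (series (telescope (u_ ^~ x))).
  apply: normed_cvg; apply: (@series_le_cvg _ _ (geometric (Num.sqrt M) 2^-1)).
  - by move=> n; exact: normr_ge0.
  - by move=> n; rewrite /= mulr_ge0 ?sqrtr_ge0 ?exprn_ge0.
  - by move=> n; exact: bd.
  - by apply: is_cvg_geometric_series; rewrite ger0_norm// invf_lt1// ltr1n.
rewrite (_ : u_ ^~ x = cst (u_ 0%N x) + series (telescope (u_ ^~ x))).
  by apply: is_cvgD => //; exact: is_cvg_cst.
by apply/funext => n; rewrite (eq_sum_telescope (u_ ^~ x) n).
Unshelve. all: by end_near. Qed.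

(** The limit is pointwise almost everywhere because the weighted sum of the
    squared increments is integrable, hence finite almost everywhere; Fatou's
    lemma turns it into a limit in the mean. *)
Theorem riesz_fischer : exists u, sqint u /\
  forall N, nrm (u_ N \- u) <= 2 * 4^-1 ^+ N.
Proof.
pose u x := fine (limn_esup (fun n => (u_ n x)%:E)).
have mu_u : measurable_fun D u.
  apply: (measurableT_comp (fine_measurable measurableT)).
  apply: measurable_fun_limn_esup => n; apply/measurable_EFinP.
  exact: sqint_measurable.
have uae : \forall x \ae mu, D x -> u_ n x @[n --> \oo] --> u x.
  apply: filterS fast_cauchy_ae => x H Dx.
  have /cvg_ex[l ul] := H Dx.
  suff -> : u x = l by [].
  have /cvg_limn_einf_sup[_ luE] : (u_ n x)%:E @[n --> \oo] --> l%:E.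
    by apply/fine_cvgP; split; [exact: nearW|].
  by rewrite /u luE.
have key N : (\int[mu]_(x in D) ((u_ N x - u x) ^+ 2)%:E <=
    ((2 * 4^-1 ^+ N) ^+ 2)%:E)%E.
  have mf m : measurable_fun D (fun x => ((u_ N x - u_ (N + m)%N x) ^+ 2)%:E).
    apply/measurable_EFinP; apply: measurable_funX.
    apply: measurable_funB; exact: sqint_measurable.
  have F0 m x : D x -> (0 <= ((u_ N x - u_ (N + m)%N x) ^+ 2)%:E :> \bar R)%E.
    by rewrite lee_fin sqr_ge0.
  apply: le_trans (le_trans (fatou mu mD mf F0) _).
  - rewrite le_eqVlt; apply/orP; left; apply/eqP; apply: ae_eq_integral => //.
    + apply/measurable_EFinP; apply: measurable_funX.
      by apply: measurable_funB => //; exact: sqint_measurable.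
    + apply: measurableT_comp => //; apply: measurable_fun_limn_esup => m.
      by apply: measurableT_comp => //; exact: mf.
    apply: filterS uae => x H Dx; have ux := H Dx.
    have /cvg_limn_einf_sup[-> _]// :
      ((u_ N x - u_ (N + m)%N x) ^+ 2)%:E @[m --> \oo] --> ((u_ N x - u x) ^+ 2)%:E.
    apply/fine_cvgP; split; first exact: nearW.
    have c1 : (fun m => u_ N x - u_ (N + m)%N x) @ \oo --> u_ N x - u x.
      apply: cvgB; first exact: cvg_cst.
      rewrite (_ : (fun m => _) = (fun m => u_ (m + N)%N x)); last first.
        by apply/funext => m; rewrite addnC.
      by rewrite (cvg_shiftn N (u_ ^~ x)).
    exact: (cvgM c1 c1).
  rewrite limn_einf_lim; apply: lime_le; first exact: is_cvg_einfs.
  apply: nearW => k; apply: (@le_trans _ _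
      (\int[mu]_(x in D) ((u_ N x - u_ (N + k)%N x) ^+ 2)%:E)%E).
    by apply: ereal_inf_lbound; exists k => /=.
  have sNk : sqint (u_ N \- u_ (N + k)%N) by exact: sqintB.
  have fin := integrable_fin_num mD (proj2 sNk).
  have -> : (\int[mu]_(x in D) ((u_ N x - u_ (N + k)%N x) ^+ 2)%:E =
      (nrm (u_ (N + k)%N \- u_ N) ^+ 2)%:E)%E.
    rewrite -[LHS]fineK// -nrmN nrm2; congr EFin; congr fine.
    by apply: eq_integral => x _; rewrite /= expr2; congr EFin; ring.
  have p0 j : 0 <= 4^-1 ^+ j :> R by exact: exprn_ge0.
  rewrite lee_fin ler_pXn2r ?nnegrE ?nrm_ge0 ?mulr_ge0//.
  apply: (le_trans (fast_cauchy_nrm N k)).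
  by have := p0 N; have := p0 k; nra.
have sNu N : sqint (u_ N \- u).
  split; first by apply: measurable_funB => //; exact: sqint_measurable.
  apply/integrableP; split.
    apply/measurable_EFinP; apply: measurable_funX.
    by apply: measurable_funB => //; exact: sqint_measurable.
  rewrite (le_lt_trans _ (ltry ((2 * 4^-1 ^+ N) ^+ 2)))// (le_trans _ (key N))//.
  rewrite le_eqVlt; apply/orP; left; apply/eqP; apply: eq_integral => x _.
  by rewrite /= ger0_norm ?sqr_ge0.
have su' : sqint u.
  rewrite (_ : u = u_ 0%N \- (u_ 0%N \- u)); first exact: sqintB.
  by apply/funext => x /=; ring.
exists u; split=> // N.
rewrite -(@ler_pXn2r _ 2)// ?nnegrE ?nrm_ge0 ?mulr_ge0 ?exprn_ge0//.
have fin := integrable_fin_num mD (proj2 (sNu N)).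
rewrite nrm2 -lee_fin (le_trans _ (key N))//.
rewrite le_eqVlt; apply/orP; left; apply/eqP.
by rewrite -[RHS]fineK.
Qed.

End riesz_fischer.

(** * Euclidean space as a measure space *)

Section rV_topology.
Context {R : realType} {n : nat}.
Implicit Types (x c : 'rV[R]_n) (U : set 'rV[R]_n).

Lemma ball_rVP c r x :
  ball c r x <-> 0 < r /\ forall i, `|c ord0 i - x ord0 i| < r.
Proof.
split=> [[r0 H]|[r0 H]]; split=> // i; first exact: H.
by move=> j; rewrite (ord1 i); exact: H.
Qed.

(** The cubes with rational centre and inverse integer radius are countably
    many.  The factor 2 puts the closure of each cube inside the open set, so
    that a bump function on the cube is a test function of the open set. *)
Lemma open_bigcup_ball U : open U ->
  exists (P : set nat) (c : nat -> 'rV[R]_n) (r : nat -> R),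
    (forall k, P k -> 0 < r k /\ ball (c k) (2 * r k) `<=` U) /\
    U = \bigcup_(k in P) ball (c k) (r k).
Proof.
move=> oU.
pose c (p : 'rV[rat]_n * nat) : 'rV[R]_n := map_mx ratr p.1.
pose r (p : 'rV[rat]_n * nat) : R := p.2.+1%:R^-1.
pose p0 : 'rV[rat]_n * nat := (0, 0%N).
pose e k := odflt p0 (unpickle k).
exists [set k | ball (c (e k)) (2 * r (e k)) `<=` U], (c \o e), (r \o e).
split; first by move=> k /= H; split=> //; rewrite invr_gt0 ltr0n.
apply/seteqP; split=> [x Ux|x [k /= kU] xk]; last first.
  apply: kU; apply: le_ball xk; rewrite /= ler_peMl ?ler1n//.
  by rewrite invr_ge0.
have /nbhs_ballP[d /= d0 dU] : nbhs x U by exact: open_nbhs_nbhs.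
have [m md] : exists m : nat, m.+1%:R^-1 < d / 3.
  have /ltr_add_invr[m] : 0 < d / 3 by rewrite divr_gt0.
  by rewrite add0r => ?; exists m.
have m0 : 0 < m.+1%:R^-1 :> R by rewrite invr_gt0 ltr0n.
have qP i : {q : rat | `|ratr q - x ord0 i| < m.+1%:R^-1}.
  apply: cid.
  have /rat_in_itvoo[q] : x ord0 i - m.+1%:R^-1 < x ord0 i + m.+1%:R^-1.
    by rewrite ltrBlDr -addrA ltrDl addr_gt0.
  by rewrite in_itv/= => qx; exists q; rewrite ltr_distl.
pose q : 'rV[rat]_n := \row_i proj1_sig (qP i).
exists (pickle (q, m)); last first.
  rewrite /= /e pickleK /= /c /r /=; apply/ball_rVP; split=> // i.
  by rewrite !mxE; case: (qP i).
rewrite /= /e pickleK /= /c /r /= => y /ball_rVP[_ yq].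
apply: dU; apply/ball_rVP; split=> // i.
have := yq i; rewrite !mxE; case: (qP i) => z /=; move: md.
set w := _^-1 => md.
have -> : x ord0 i - y ord0 i =
  (ratr z - y ord0 i) - (ratr z - x ord0 i) by ring.
move=> h1 h2; apply: (le_lt_trans (ler_normB _ _)); lra.
Qed.

Lemma measurable_box_rV (A : 'I_n -> set (measurableTypeR R)) :
  (forall i, measurable (A i)) ->
  measurable [set x : 'rV[R]_n | forall i, A i (x ord0 i)].
Proof.
move=> mA; rewrite (_ : mkset _ =
    \bigcap_(i in [set: 'I_n]) (rV_coord i @^-1` A i)); last first.
  by apply/seteqP; split=> [x H i _|x H i]; [exact: H|exact: (H i I)].
apply: fin_bigcap_measurable; first exact: finite_finset.
by move=> i _; rewrite -[X in measurable X]setTI; apply: measurable_rV_coord.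
Qed.

Lemma measurable_ball_rV c r : measurable (ball c r).
Proof.
have [r0|r0] := ltP 0 r; last first.
  rewrite (_ : ball c r = set0)//; apply/seteqP; split=> // x /ball_rVP[].
  by rewrite ltNge r0.
rewrite (_ : ball c r = [set x : 'rV[R]_n | forall i,
    (fun i => `]c ord0 i - r, c ord0 i + r[%classic) i (x ord0 i)]).
  by apply: (@measurable_box_rV (fun i => `]c ord0 i - r, c ord0 i + r[%classic)).
apply/seteqP; split=> [x /ball_rVP[_ H] i|x H].
  by have := H i; rewrite /= in_itv /= distrC ltr_distl.
apply/ball_rVP; split=> // i.
by have := H i; rewrite /= in_itv /= distrC ltr_distl.
Qed.

Lemma open_measurable_rV U : open U -> measurable U.
Proof.
move=> /open_bigcup_ball[P [c [r [_ ->]]]].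
by apply: bigcup_measurable => k _; exact: measurable_ball_rV.
Qed.

Lemma continuous_measurable_rV (f : 'rV[R]_n -> R) :
  continuous f -> measurable_fun setT f.
Proof.
move=> cf; apply: (measurability _ (RGenOInfty.measurableE R)).
move=> _ [_ [a ->] <-]; rewrite setTI; apply: open_measurable_rV.
by apply: open_comp => // x _; exact: cf.
Qed.

End rV_topology.

Section rV_shift.
Context {R : realType}.

Lemma measurable_add_rV n : measurable_fun setT
  (fun p : 'rV[R]_n * 'rV[R]_n => p.2 + p.1).
Proof.
apply: measurable_fun_rVP => i.
rewrite (_ : _ \o _ = (rV_coord i \o snd) \+ (rV_coord i \o fst)); last first.
  by apply/funext => p; rewrite /= /rV_coord mxE.
apply: measurable_funD; apply: measurableT_comp => //; exact: measurable_rV_coord.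
Qed.

Definition shift_rV {n} (v x : 'rV[R]_n) : 'rV[R]_n := x + v.

Lemma measurable_shift_rV n (v : 'rV[R]_n) : measurable_fun setT (shift_rV v).
Proof.
apply: measurable_fun_rVP => i.
rewrite (_ : _ \o _ = fun x => rV_coord i x + v ord0 i); last first.
  by apply/funext => x; rewrite /= /shift_rV /rV_coord mxE.
apply: measurable_funD => //; exact: measurable_rV_coord.
Qed.

Lemma lebesgue_measure_shift (a : R) (A : set (measurableTypeR R)) : measurable A ->
  pushforward (@lebesgue_measure R) (fun x : measurableTypeR R => (x + a : measurableTypeR R)) A =
  lebesgue_measure A.
Proof.
move=> mA; apply/esym/lebesgue_measure_unique => //=.
  by apply: measurable_funD.
move=> _ _ [[b c]] _ <-; rewrite /pushforward.
rewrite (_ : _ @^-1` _ = `]b - a, c - a]%classic); last first.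
  by apply/seteqP; split=> x /=; rewrite !in_itv/= ltrBlDr lerBrDr.
rewrite !lebesgue_measure_itv /= !lte_fin ltrD2r.
by case: ifP => // _; rewrite -!EFinB; congr EFin; ring.
Qed.

(** By induction on the dimension: a translated product measure takes the
    right values on rectangles, which determine it. *)
Lemma lebesgue_rV_shift n (v : 'rV[R]_n) (A : set 'rV[R]_n) : measurable A ->
  pushforward (lebesgue_rV R n) (shift_rV v) A = lebesgue_rV R n A.
Proof.
elim: n v A => [|n IH] v A mA.
  rewrite /pushforward (_ : _ @^-1` A = A)//.
  by apply/seteqP; split=> x /=; rewrite (_ : shift_rV v x = x)//; apply/rowP; case.
pose v' := (rV_uncons v).2.
pose sh (p : measurableTypeR R * 'rV[R]_n) : measurableTypeR R * 'rV[R]_n :=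
  ((p.1 + v ord0 ord0), shift_rV v' p.2).
have msh : measurable_fun setT sh.
  apply/measurable_fun_pairP; split.
    by apply: measurable_funD => //; exact: measurable_fst.
  exact: (measurableT_comp (measurable_shift_rV v') measurable_snd).
rewrite /= /product_lebesgue_of /pushforward.
rewrite (_ : _ @^-1` (_ @^-1` A) = sh @^-1` (rV_cons (n := n) @^-1` A)); last first.
  apply/seteqP; split=> -[a y] /=; congr A; apply/rowP => i; rewrite /shift_rV !mxE;
    by case: (unliftP ord0 i) => [j|] ->; rewrite ?liftK ?unlift_none ?mxE.
have mA' : measurable (rV_cons (n := n) @^-1` A).
  by rewrite -[X in measurable X]setTI; exact: measurable_rV_cons.
apply/esym; apply: (@product_measure_unique _ _ _ _ R lebesgue_measure (lebesgue_rV R n)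
  (pushforward (lebesgue_measure \x lebesgue_rV R n)%E sh)) => // B C mB mC.
transitivity ((lebesgue_measure \x lebesgue_rV R n)%E
  ((fun x : measurableTypeR R => (x + v ord0 ord0 : measurableTypeR R)) @^-1` B
  `*` (shift_rV v' @^-1` C))); first by [].
rewrite product_measure1E//; last 2 first.
- by rewrite -[X in measurable X]setTI; apply: measurable_funD.
- by rewrite -[X in measurable X]setTI; exact: measurable_shift_rV.
by congr (_ * _)%E; [exact: lebesgue_measure_shift|exact: IH].
Qed.

End rV_shift.

Section rV_integral_shift.
Context {R : realType} {n : nat}.
Local Notation mu := (lebesgue_rV R n).

Lemma ge0_integral_shift (v : 'rV[R]_n) (f : 'rV[R]_n -> \bar R) :
  measurable_fun setT f -> (forall x, (0 <= f x)%E) ->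
  (\int[mu]_x f (shift_rV v x) = \int[mu]_x f x)%E.
Proof.
move=> mf f0.
rewrite -[RHS](@eq_measure_integral _ _ _ setT (lebesgue_rV R n)
  (pushforward (lebesgue_rV R n) (shift_rV v))).
  exact: measurable_shift_rV.
move=> mS; rewrite ge0_integral_pushforward//.
by move=> mS A mA _; exact: (lebesgue_rV_shift v mA).
Qed.

Lemma integrable_shift (v : 'rV[R]_n) (f : 'rV[R]_n -> R) :
  mu.-integrable setT (EFin \o f) ->
  mu.-integrable setT (EFin \o (f \o shift_rV v)).
Proof.
move=> /integrableP[mf fi]; apply/integrableP; split.
  by apply: (measurableT_comp mf); exact: measurable_shift_rV.
by rewrite (ge0_integral_shift v (f := fun x => `|(f x)%:E|%E))//;
  exact: measurableT_comp.
Qed.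

Lemma Rintegral_shift (v : 'rV[R]_n) (f : 'rV[R]_n -> R) :
  mu.-integrable setT (EFin \o f) ->
  \int[mu]_x f (shift_rV v x) = \int[mu]_x f x.
Proof.
move=> fi; congr fine.
rewrite -[RHS](@eq_measure_integral _ _ _ setT (lebesgue_rV R n)
  (pushforward (lebesgue_rV R n) (shift_rV v))).
  exact: measurable_shift_rV.
move=> mS; rewrite integral_pushforward//.
- by case/integrableP: fi.
- by rewrite preimage_setT; exact: (integrable_shift v fi).
by move=> mS A mA _; exact: (lebesgue_rV_shift v mA).
Qed.

End rV_integral_shift.

Section rV_bounded.
Context {R : realType} {n : nat}.
Local Notation mu := (lebesgue_rV R n).

Definition cube (M : R) : set 'rV[R]_n :=
  [set x | forall i, x ord0 i \in `[- M, M]].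

Lemma cubeP M x : cube M x <-> forall i, `|x ord0 i| <= M.
Proof. by split=> H i; have := H i; rewrite in_itv/= ler_norml. Qed.

Lemma measurable_cube M : measurable (cube M).
Proof. exact: (@measurable_box_rV _ _ (fun=> `[- M, M]%classic)). Qed.

Lemma lebesgue_cube M : 0 <= M -> mu (cube M) = ((2 * M) ^+ n)%:E.
Proof.
move=> M0; pose a : 'rV[R]_n := const_mx (- M); pose b : 'rV[R]_n := const_mx M.
have -> : cube M = [set x | forall i, x ord0 i \in `[a ord0 i, b ord0 i]].
  by apply/seteqP; split=> x H i; have := H i; rewrite !mxE.
rewrite lebesgue_rV_box; last by move=> i; rewrite !mxE; lra.
congr EFin; rewrite (eq_bigr (fun=> 2 * M)); last first.
  by move=> i _; rewrite !mxE; ring.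
by rewrite prodr_const card_ord.
Qed.

Lemma bounded_cube (A : set 'rV[R]_n) : bounded_set A ->
  exists2 M, 0 < M & A `<=` cube M.
Proof.
move=> [M [Mreal H]]; exists (`|M| + 1).
  by rewrite ltr_wpDl.
move=> x Ax; apply/cubeP => i.
have /H/(_ x Ax) : M < `|M| + 1 by rewrite (le_lt_trans (ler_norm M))// ltrDl.
apply: le_trans; rewrite [leRHS]/Num.norm /= mx_normrE; apply/bigmax_geP; right => /=.
by exists (ord0, i).
Qed.

End rV_bounded.

(** * Smooth functions and bump functions *)

Section line_derivative.
Context {R : realType} {n : nat}.

(** A directional derivative is a derivative along a line; this transports
    one-variable calculus to the coordinate derivatives. *)
Lemma is_derive_line (f : 'rV[R]_n -> R) (x v : 'rV[R]_n) (t df : R) :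
  is_derive (t *: v + x) v f df <->
  is_derive t 1 (fun s : R => f (s *: v + x)) df.
Proof.
have E : (fun h : R => h^-1 *: ((f \o shift (t *: v + x)) (h *: v) - f (t *: v + x))) =
  (fun h : R => h^-1 *: (((fun s : R => f (s *: v + x)) \o shift t) (h *: 1) - f (t *: v + x))).
  apply/funext => h; congr (_ *: (_ - _)); rewrite /= /shift.
  by congr f; rewrite addrA -scalerDl; congr (_ *: _ + _); rewrite /GRing.scale/= mulr1.
split=> -[H1 H2]; apply: DeriveDef.
- by rewrite /derivable -E.
- by rewrite /derive -E.
- by rewrite /derivable E.
- by rewrite /derive E.
Qed.

Lemma is_derive_line0 (f : 'rV[R]_n -> R) (x v : 'rV[R]_n) (df : R) :
  is_derive x v f df <-> is_derive (0 : R) 1 (fun s : R => f (s *: v + x)) df.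
Proof. by have := is_derive_line f x v 0 df; rewrite scale0r add0r. Qed.

Lemma is_derive_comp_rV (f : 'rV[R]_n -> R) (g : R -> R) x v (df dg : R) :
  is_derive (f x) 1 g dg -> is_derive x v f df ->
  is_derive x v (g \o f) (dg * df).
Proof.
move=> hg /is_derive_line0 hf; apply/is_derive_line0.
have hg' : is_derive (f (0 *: v + x)) 1 g dg by rewrite scale0r add0r.
exact: (is_derive1_comp hg' hf).
Qed.

Lemma is_derive_coord (i j : 'I_n) (x : 'rV[R]_n) :
  is_derive x (unit_rV i) (fun y : 'rV[R]_n => y ord0 j) (i == j)%:R.
Proof.
apply/is_derive_line0.
rewrite (_ : (fun s : R => _) = (fun s : R => s * (i == j)%:R + x ord0 j)).
  by apply: is_derive_eq; rewrite /GRing.scale/=; ring.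
by apply/funext => s; rewrite !mxE eqxx /= eq_sym.
Qed.

End line_derivative.

Section Ck.
Context {R : realType} {n : nat}.
Implicit Types f g : 'rV[R]_n -> R.

(** Differentiability up to a given order, by recursion on the order: closure
    under sums and products is then a plain induction. *)
Fixpoint Ck (k : nat) f : Prop := continuous f /\
  if k is k'.+1 then
    forall i, (forall x, derivable f x (unit_rV i)) /\ Ck k' (partial i f)
  else True.

Lemma Ck_continuous k f : Ck k f -> continuous f.
Proof. by case: k => [|k] []. Qed.

Lemma partialE i f g :
  (forall x, is_derive x (unit_rV i) f (g x)) -> partial i f = g.
Proof. by move=> fg; apply/funext => x; rewrite /partial (@derive_val _ _ _ _ _ _ _ (fg x)). Qed.

Lemma CkS k f : continuous f ->
  (forall i, exists2 g, (forall x, is_derive x (unit_rV i) f (g x)) & Ck k g) ->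
  Ck k.+1 f.
Proof.
move=> cf H; split=> // i; have [g fg gk] := H i; split.
  by move=> x; have := fg x; case.
by rewrite (partialE fg).
Qed.

Lemma CkS_derive k f i x : Ck k.+1 f -> is_derive x (unit_rV i) f (partial i f x).
Proof. by case=> _ /(_ i)[H _]; apply: DeriveDef => //; exact: H. Qed.

Lemma CkS_partial k f i : Ck k.+1 f -> Ck k (partial i f).
Proof. by case=> _ /(_ i)[]. Qed.

Lemma CkW k f : Ck k.+1 f -> Ck k f.
Proof.
elim: k f => [|k IH] f [cf H]; first by split.
by split=> // i; have [H1 H2] := H i; split=> //; exact: IH.
Qed.

Lemma Ck_cst k (a : R) : Ck k (fun=> a).
Proof.
elim: k a => [|k IH] a; first by split=> //; exact: cst_continuous.
apply: CkS => [|i]; first exact: cst_continuous.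
by exists (fun=> 0) => // x; exact: is_derive_cst.
Qed.

Lemma CkD k f g : Ck k f -> Ck k g -> Ck k (f \+ g).
Proof.
elim: k f g => [|k IH] f g Cf Cg.
  by split=> // x; apply: continuousD; [exact: (Ck_continuous Cf)|exact: (Ck_continuous Cg)].
apply: CkS => [x|i].
  by apply: continuousD; [exact: (Ck_continuous Cf)|exact: (Ck_continuous Cg)].
exists (partial i f \+ partial i g); last by apply: IH; exact: CkS_partial.
by move=> x; exact: (is_deriveD (CkS_derive i x Cf) (CkS_derive i x Cg)).
Qed.

Lemma CkM k f g : Ck k f -> Ck k g -> Ck k (f \* g).
Proof.
elim: k f g => [|k IH] f g Cf Cg.
  by split=> // x; apply: continuousM; [exact: (Ck_continuous Cf)|exact: (Ck_continuous Cg)].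
apply: CkS => [x|i].
  by apply: continuousM; [exact: (Ck_continuous Cf)|exact: (Ck_continuous Cg)].
exists ((f \* partial i g) \+ (g \* partial i f)).
  by move=> x; exact: (is_deriveM (CkS_derive i x Cf) (CkS_derive i x Cg)).
by apply: CkD; apply: IH; try exact: CkW; exact: CkS_partial.
Qed.

Lemma CkZ k (a : R) f : Ck k f -> Ck k (fun x => a * f x).
Proof. exact: (CkM (Ck_cst k a)). Qed.

Lemma Ck_coord k (j : 'I_n) : Ck k (fun x : 'rV[R]_n => x ord0 j).
Proof.
case: k => [|k]; first by split=> //; exact: coord_continuous.
apply: CkS => [|i]; first exact: coord_continuous.
exists (fun=> (i == j)%:R); last exact: Ck_cst.
by move=> x; exact: is_derive_coord.
Qed.

Lemma Ck_prod k (I : Type) (s : seq I) (f : I -> 'rV[R]_n -> R) :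
  (forall i, Ck k (f i)) -> Ck k (fun x => \prod_(i <- s) f i x).
Proof.
move=> Cf; elim: s => [|i s IH].
  by under eq_fun do rewrite big_nil; exact: Ck_cst.
by under eq_fun do rewrite big_cons; exact: (CkM (Cf i) IH).
Qed.

Lemma smooth_partial f i : smooth f -> smooth (partial i f).
Proof. by move=> sf s; rewrite -foldr_rcons; exact: sf. Qed.

(** In [smooth] the last direction of a list is differentiated first, hence the
    induction from the right end of the list. *)
Lemma smoothP f : smooth f <-> forall k, Ck k f.
Proof.
split=> [sf k|].
  elim: k f sf => [|k IH] f sf; have [cf df] := sf [::]; split=> // i.
  by split; [exact: df|apply: IH; exact: smooth_partial].
move=> Cf s; elim/last_ind: s f Cf => [|s i IH] f Cf.
  split; first exact: Ck_continuous (Cf 0%N).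
  by move=> i x; have [_ /(_ i)[]] := Cf 1%N.
rewrite foldr_rcons; apply: IH => k.
exact: CkS_partial (Cf k.+1).
Qed.

End Ck.

Section flat_function.
Context {R : realType}.

(** The smooth function [exp (- 1 / s)] cut off at the origin.  The powers
    [s ^- m] make the family closed under differentiation, so that a single
    derivative computation yields smoothness. *)
Definition flat (m : nat) (s : R) : R :=
  if 0 < s then s^-1 ^+ m * expR (- s^-1) else 0.

Lemma flat_ge0 m s : 0 <= flat m s.
Proof.
rewrite /flat; case: ifPn => // s0.
by rewrite mulr_ge0 ?expR_ge0 ?exprn_ge0 ?invr_ge0 ?ltW.
Qed.

(** A quadratic bound is what makes the difference quotients at the origin tend
    to zero. *)
Lemma flat_le_sqr m s : flat m s <= m.+2`!%:R * s ^+ 2.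
Proof.
rewrite /flat; case: ifPn => s0; last by rewrite mulr_ge0 ?sqr_ge0.
have si : 0 < s^-1 by rewrite invr_gt0.
have := expR_ge1Dxn m.+1 (ltW si); set F : R := m.+2`!%:R => H.
have F0 : 0 < F by rewrite ltr0n fact_gt0.
have e1 : s^-1 ^+ m.+2 / F <= expR s^-1 by lra.
rewrite expRN ler_pdivrMr ?expR_gt0//.
move: e1; rewrite ler_pdivrMr// => e1.
have s2 : 0 <= s ^+ 2 by exact: sqr_ge0.
have -> : s^-1 ^+ m = s ^+ 2 * s^-1 ^+ m.+2.
  by rewrite -[m.+2]addn2 exprD mulrCA -exprMn mulfV ?gt_eqF// expr1n mulr1.
rewrite [leRHS](_ : _ = s ^+ 2 * (expR s^-1 * F)); last by ring.
exact: ler_wpM2l.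
Qed.

Lemma is_derive_flat (m : nat) (s : R) :
  is_derive s (1 : R) (flat m) (flat m.+2 s - m%:R * flat m.+1 s).
Proof.
have [s0|s0|<-{s}] := ltgtP 0 s.
- have E : \near s, (fun y : R => y^-1 ^+ m * expR (- y^-1)) s = flat m s.
    near=> y; rewrite /flat ifT//; near: y; exact: lt_nbhsr.
  have sn0 : s != 0 by rewrite gt_eqF.
  have dV : is_derive s 1 (fun y : R => y^-1) (- s ^- 2).
    by apply: is_derive_eq; [exact: is_deriveV|rewrite /GRing.scale/= mulr1].
  have dN : is_derive s 1 (fun y : R => - y^-1) (s ^- 2).
    by have := is_deriveN dV; rewrite opprK.
  have dE := @is_derive1_comp _ expR (fun y : R => - y^-1) s _ _ (is_derive_expR (- s^-1)) dN.
  have dX : is_derive s (1 : R) (fun y : R => y^-1 ^+ m) (- (m%:R * s^-1 ^+ m.+1)).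
    elim: (m) => [|k IH].
      by rewrite mul0r oppr0; exact: is_derive_cst.
    have := is_deriveM dV IH.
    rewrite (_ : _ * _ = (fun y : R => y^-1 ^+ k.+1)); last first.
      by apply/funext => y; rewrite exprS.
    move/is_derive_eq; apply; rewrite /GRing.scale/= -natr1 -exprVn.
    by rewrite !exprS expr0 mulr1; ring.
  have [d1 d2] := is_deriveM dX dE.
  apply: DeriveDef; first exact: near_eq_derivable E d1.
  rewrite -(near_eq_derive (1 : R) E) [LHS]d2 /flat s0 /= /GRing.scale/=.
  rewrite -exprVn !exprS expr0 mulr1.
  by set x := s^-1; set y := expR _; set z := x ^+ m; ring.
- have E : \near s, (fun=> 0) s = flat m s.
    near=> y; rewrite /flat ifF//; apply: lt_gtF.
    by near: y; exact: lt_nbhsl.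
  have [d1 d2] := is_derive_cst (0 : R) s 1.
  apply: DeriveDef; first exact: near_eq_derivable E d1.
  rewrite -(near_eq_derive (1 : R) E) [LHS]d2 /flat (lt_gtF s0).
  by rewrite mulr0 subr0.
have E0 k : flat k 0 = 0 by rewrite /flat ltxx.
rewrite !E0 mulr0 subr0.
have C : h^-1 *: ((flat m \o shift 0) (h *: 1) - flat m 0) @[h --> 0^'] --> (0 : R).
  apply/cvgrPdist_le => e e0; near=> h.
  rewrite sub0r normrN E0 subr0 /= /shift addr0 /GRing.scale/= mulr1.
  rewrite normrM normfV ger0_norm ?flat_ge0//.
  have h0 : h != 0 by near: h; exact: nbhs_dnbhs_neq.
  rewrite ler_pdivrMl ?normr_gt0// (le_trans (flat_le_sqr _ _))//.
  rewrite -[h ^+ 2]ger0_norm ?sqr_ge0// expr2 normrM mulrCA.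
  rewrite ler_wpM2l// -ler_pdivlMl ?ltr0n ?fact_gt0//.
  near: h; apply: dnbhs0_le; rewrite mulr_gt0// invr_gt0 ltr0n fact_gt0//.
apply: DeriveDef; first by apply/cvg_ex; exists 0.
exact: cvg_lim C.
Unshelve. all: by end_near. Qed.

Lemma continuous_flat m : continuous (flat m).
Proof.
move=> s; apply: differentiable_continuous; apply/derivable1_diffP.
by case: (is_derive_flat m s).
Qed.

Lemma flat0_le1 s : flat 0 s <= 1.
Proof.
rewrite /flat expr0 mul1r; case: ifPn => // s0.
by rewrite expR_le1 oppr_le0 invr_ge0 ltW.
Qed.

Lemma flat0_neq0 s : (flat 0 s != 0) = (0 < s).
Proof.
rewrite /flat expr0 mul1r; case: ifPn => [s0|_]; last by rewrite eqxx.
by rewrite gt_eqF// expR_gt0.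
Qed.

Lemma cvg_flat0 s : 0 < s -> flat 0 (k.+1%:R * s) @[k --> \oo] --> (1 : R).
Proof.
move=> s0; rewrite -[X in _ --> X]expR0.
rewrite (_ : (fun k => _) = (fun k => expR (- (s^-1 * k.+1%:R^-1)))); last first.
  apply/funext => k; rewrite /flat expr0 mul1r ifT ?mulr_gt0//.
  by congr (expR (- _)); rewrite invfM mulrC.
have c0 : - (s^-1 * k.+1%:R^-1) @[k --> \oo] --> (0 : R).
  rewrite -[X in _ --> X]oppr0; apply: cvgN; rewrite -[X in _ --> X](mulr0 s^-1).
  apply: cvgMr; exact: cvg_harmonic.
exact: (continuous_cvg _ (@continuous_expR R 0) c0).
Qed.

End flat_function.

(** Differentiation raises [m], so the induction on the order is uniform in
    [m]. *)
Lemma Ck_flat (R : realType) n k m (f : 'rV[R]_n -> R) :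
  (forall k, Ck k f) -> Ck k (flat m \o f).
Proof.
move=> Cf; elim: k m => [|k IH] m.
  split=> // x; apply: continuous_comp; first exact: (Ck_continuous (Cf 0%N)).
  exact: continuous_flat.
apply: CkS => [x|i].
  apply: continuous_comp; first exact: (Ck_continuous (Cf 0%N)).
  exact: continuous_flat.
exists (((flat m.+2 \o f) \+ (fun x => - m%:R * (flat m.+1 \o f) x)) \* partial i f).
  move=> x; have := is_derive_comp_rV (is_derive_flat m (f x)) (CkS_derive i x (Cf 1%N)).
  by move/is_derive_eq; apply; rewrite /= mulNr.
apply: CkM; last exact: CkS_partial (Cf k.+1).
by apply: CkD; [exact: IH|apply: CkZ; exact: IH].
Qed.

(** * Test functions *)

Section test_functions.
Context {R : realType} {n : nat}.
Implicit Types (Omega A : set 'rV[R]_n) (f g phi : 'rV[R]_n -> R).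

Lemma test_Ck Omega phi k : test_function Omega phi -> Ck k phi.
Proof. by case=> /smoothP. Qed.

Lemma test_continuous Omega phi : test_function Omega phi -> continuous phi.
Proof. by move=> /(test_Ck 0)/Ck_continuous. Qed.

Lemma test_measurable Omega phi D : measurable D ->
  test_function Omega phi -> measurable_fun D phi.
Proof.
move=> mD /test_continuous cphi; apply: (measurable_funS measurableT) => //.
exact: continuous_measurable_rV.
Qed.

Lemma test_in_support Omega phi x : test_function Omega phi ->
  phi x != 0 -> closure [set y | phi y != 0] x.
Proof. by move=> _ px; exact: subset_closure. Qed.

Lemma test_out Omega phi x : test_function Omega phi -> ~ Omega x -> phi x = 0.
Proof.
move=> tphi nOx; apply/eqP; apply: contrapT => /negP px.
by apply: nOx; have [_ _] := tphi; apply; exact: (test_in_support tphi).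
Qed.

(** A compact set is closed, so it contains the closure of the nonzero locus as
    soon as it contains that locus. *)
Lemma test_functionI Omega A f : (forall k, Ck k f) -> compact A ->
  A `<=` Omega -> [set x | f x != 0] `<=` A -> test_function Omega f.
Proof.
move=> Cf cA AO fA.
have clA : closed A by apply: compact_closed => //; exact: norm_hausdorff.
have sub : closure [set x | f x != 0] `<=` A.
  by rewrite closureE => x; apply; split.
split; first exact/smoothP.
  by apply: (subclosed_compact _ cA) => //; exact: closed_closure.
exact: (subset_trans sub).
Qed.

(** Off the support the function vanishes near each point, and so does its
    derivative. *)
Lemma test_partial Omega phi i : test_function Omega phi ->
  test_function Omega (partial i phi).
Proof.
move=> tphi; have [sphi cphi phiO] := tphi.
apply: test_functionI cphi phiO _; first by apply/smoothP; exact: smooth_partial.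
move=> x /=; apply: contraNP => nx; apply/eqP.
have o : open (~` closure [set y | phi y != 0]) by exact/closed_openC/closed_closure.
have E : \near x, (fun=> 0) x = phi x.
  have : \near x, (~` closure [set y | phi y != 0]) x by exact: open_nbhs_nbhs.
  apply: filterS => y ny; apply/esym/eqP; apply: contrapT => /negP py.
  by apply: ny; exact: subset_closure.
rewrite /partial -(near_eq_derive (unit_rV i) E).
exact: (@derive_val _ _ _ _ _ _ _ (is_derive_cst (0 : R) x (unit_rV i))).
Qed.

Lemma test0 Omega : test_function Omega (fun=> 0).
Proof.
apply: (@test_functionI _ set0); [|exact: compact0|by []|].
  by move=> k; exact: Ck_cst.
by move=> x /=; rewrite eqxx.
Qed.

Lemma testD Omega f g : test_function Omega f -> test_function Omega g ->
  test_function Omega (f \+ g).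
Proof.
move=> tf tg; have [_ cf fO] := tf; have [_ cg gO] := tg.
apply: (test_functionI _ (compactU cf cg)).
- by move=> k; apply: CkD; [exact: (test_Ck _ tf)|exact: (test_Ck _ tg)].
- by move=> x [/fO|/gO].
- move=> x /= fg; apply: contrapT => /not_orP[nf ng]; move/negP: fg; apply.
  have /negP := contra_not (test_in_support tf) nf; rewrite negbK => /eqP ->.
  have /negP := contra_not (test_in_support tg) ng; rewrite negbK => /eqP ->.
  by rewrite addr0.
Qed.

Lemma testM Omega f g : (forall k, Ck k f) -> test_function Omega g ->
  test_function Omega (f \* g).
Proof.
move=> Cf tg; have [_ cg gO] := tg.
apply: (test_functionI _ cg gO).
- by move=> k; apply: CkM => //; exact: (test_Ck _ tg).
- move=> x /= fg; apply: (test_in_support tg); apply: contra fg => /eqP ->.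
  by rewrite mulr0.
Qed.

Lemma testZ Omega (a : R) g : test_function Omega g ->
  test_function Omega (fun x => a * g x).
Proof. by apply: testM => k; exact: Ck_cst. Qed.

Lemma testB Omega f g : test_function Omega f -> test_function Omega g ->
  test_function Omega (f \- g).
Proof.
move=> tf tg; rewrite (_ : _ \- _ = f \+ (fun x => -1 * g x)).
  by apply: testD => //; exact: testZ.
by apply/funext => x /=; rewrite mulN1r.
Qed.

Lemma partialD i f g : Ck 1 f -> Ck 1 g ->
  partial i (f \+ g) = partial i f \+ partial i g.
Proof.
move=> Cf Cg; apply: partialE => x.
exact: (is_deriveD (CkS_derive i x Cf) (CkS_derive i x Cg)).
Qed.

Lemma partialM i f g : Ck 1 f -> Ck 1 g ->
  partial i (f \* g) = (f \* partial i g) \+ (g \* partial i f).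
Proof.
move=> Cf Cg; apply: partialE => x.
exact: (is_deriveM (CkS_derive i x Cf) (CkS_derive i x Cg)).
Qed.

Lemma partial_cst i (a : R) : partial i (fun=> a) = (fun=> 0) :> ('rV[R]_n -> R).
Proof. by apply: partialE => x; exact: is_derive_cst. Qed.

Lemma partialZ i (a : R) f : Ck 1 f ->
  partial i (fun x => a * f x) = (fun x => a * partial i f x).
Proof.
move=> Cf; rewrite (partialM i (Ck_cst 1 a) Cf) partial_cst.
by apply/funext => x /=; rewrite mulr0 addr0.
Qed.

Lemma partialB i f g : Ck 1 f -> Ck 1 g ->
  partial i (f \- g) = partial i f \- partial i g.
Proof.
move=> Cf Cg; rewrite (_ : f \- g = f \+ (fun x => -1 * g x)); last first.
  by apply/funext => x /=; rewrite mulN1r.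
rewrite partialD//; last exact: CkZ.
by rewrite partialZ//; apply/funext => x /=; rewrite mulN1r.
Qed.

Lemma test_bounded Omega phi : test_function Omega phi ->
  exists2 M, 0 < M & forall x, `|phi x| <= M.
Proof.
move=> tphi; have [_ cphi _] := tphi.
have : compact (phi @` closure [set y | phi y != 0]).
  apply: continuous_compact cphi; apply: continuous_subspaceT.
  exact: (test_continuous tphi).
move=> /compact_bounded[M [Mr H]]; exists (`|M| + 1).
  by rewrite ltr_wpDl.
move=> x; have [->|px] := eqVneq (phi x) 0; first by rewrite normr0 addr_ge0.
apply: (H (`|M| + 1)); first by rewrite (le_lt_trans (ler_norm M))// ltrDl.
by exists x => //; exact: subset_closure.
Qed.

End test_functions.

Section bump.
Context {R : realType} {n : nat}.

(** One factor per coordinate, so that the nonzero locus is a cube, that is, a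
    ball of the sup norm.  As [k] grows the bump tends to the indicator of that
    cube. *)
Definition bump_rV (c : 'rV[R]_n) (r : R) (k : nat) (x : 'rV[R]_n) : R :=
  \prod_(i < n) flat 0 (k.+1%:R * (r ^+ 2 - (x ord0 i - c ord0 i) ^+ 2)).

Lemma Ck_bump c r k m : Ck m (bump_rV c r k).
Proof.
apply: Ck_prod => i; apply: (@Ck_flat _ _ _ 0 (fun x : 'rV[R]_n =>
  k.+1%:R * (r ^+ 2 - (x ord0 i - c ord0 i) ^+ 2))) => j.
apply: CkZ.
rewrite (_ : (fun x : 'rV[R]_n => _) = (fun=> r ^+ 2) \+ (fun x : 'rV[R]_n => -1 *
  (((fun x : 'rV[R]_n => x ord0 i) \+ (fun=> - c ord0 i)) \*
   ((fun x : 'rV[R]_n => x ord0 i) \+ (fun=> - c ord0 i))) x)); last first.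
  by apply/funext => x /=; rewrite mulN1r expr2.
apply: CkD; first exact: Ck_cst.
by apply: CkZ; apply: CkM; apply: CkD; (exact: Ck_coord || exact: Ck_cst).
Qed.

Lemma bump_ge0 c r k x : 0 <= bump_rV c r k x.
Proof. by apply: prodr_ge0 => i _; exact: flat_ge0. Qed.

Lemma bump_le1 c r k x : bump_rV c r k x <= 1.
Proof.
apply: (@prodr_ile1 _ _ _ _ (fun i => flat 0 _)) => i _.
by rewrite flat_ge0 flat0_le1.
Qed.

Lemma bump_neq0 c r k x : 0 < r -> bump_rV c r k x != 0 -> ball c r x.
Proof.
move=> r0 /prodf_neq0 H; apply/ball_rVP; split=> // i.
have := H i isT; rewrite flat0_neq0 pmulr_rgt0// subr_gt0 => lt2.
rewrite distrC -(@ltr_pXn2r _ 2)// ?nnegrE//; last exact: ltW.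
by rewrite real_normK// num_real.
Qed.

Lemma cvg_bump c r x : ball c r x -> bump_rV c r k x @[k --> \oo] --> (1 : R).
Proof.
move=> /ball_rVP[r0 H].
rewrite /bump_rV; elim: (index_enum _) => [|i s IH].
  by under eq_fun do rewrite big_nil; exact: cvg_cst.
have s0 : 0 < r ^+ 2 - (x ord0 i - c ord0 i) ^+ 2.
  rewrite subr_gt0 -[ltLHS]real_normK ?num_real// ltr_pXn2r ?nnegrE ?(ltW r0)//.
  by rewrite distrC.
have H1 := cvg_flat0 s0; have H2 := cvgM H1 IH; rewrite mulr1 in H2.
under eq_fun do rewrite big_cons.
exact: H2.
Qed.

Lemma closed_ball_compact (c : 'rV[R]_n) (r : R) :
  compact [set x : 'rV[R]_n | forall i, `|x ord0 i - c ord0 i| <= r].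
Proof.
rewrite (_ : [set x | _] = [set x : 'rV[R]_n | forall i,
    (fun i => `[c ord0 i - r, c ord0 i + r]%classic) i (x ord0 i)]).
  apply: (@rV_compact _ _ (fun i => `[c ord0 i - r, c ord0 i + r]%classic)).
  by move=> i; exact: segment_compact.
by apply/seteqP; split=> x H i; have := H i; rewrite /= in_itv/= ler_distl.
Qed.

Lemma test_bump Omega c r k : 0 < r -> ball c (2 * r) `<=` Omega ->
  test_function Omega (bump_rV c r k).
Proof.
move=> r0 sub.
apply: (@test_functionI _ _ _
  [set x : 'rV[R]_n | forall i, `|x ord0 i - c ord0 i| <= r]).
- by move=> m; exact: Ck_bump.
- exact: closed_ball_compact.
- move=> x /= H; apply: sub; apply/ball_rVP; split=> [|i]; first by rewrite mulr_gt0.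
  by rewrite distrC (le_lt_trans (H i))// ltr_pMl// ltr1n.
- move=> x /= /(bump_neq0 r0)/ball_rVP[_ H] i.
  by rewrite distrC ltW.
Qed.

End bump.

(** * Translates of test functions *)

Section bounded_support.
Context {R : realType} {n : nat}.
Local Notation mu := (lebesgue_rV R n).
Implicit Types g : 'rV[R]_n -> R.

Lemma integrable_cube g (M B : R) : measurable_fun setT g ->
  (forall x, `|g x| <= B) -> (forall x, g x != 0 -> cube M x) ->
  mu.-integrable setT (EFin \o g).
Proof.
move=> mg gB gM.
pose C : set 'rV[R]_n := cube `|M|.
have mC : measurable C by exact: measurable_cube.
have iB : mu.-integrable setT (EFin \o (fun x => B * \1_C x)).
  apply: (integrableZl measurableT B (f := EFin \o \1_C)).
  apply/integrableP; split; first exact/measurable_EFinP.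
  have -> : (\int[mu]_x `|(EFin \o \1_C) x| = mu C)%E.
    rewrite -[in RHS](setIT C) -integral_indic//; apply: eq_integral => x _.
    by rewrite /= ger0_norm.
  by rewrite /C lebesgue_cube ?ltry.
apply: (le_integrable measurableT _ _ iB); first exact/measurable_EFinP.
move=> x _ /=; rewrite lee_fin.
have B0 : 0 <= B by exact: le_trans (gB x).
rewrite [leRHS]ger0_norm ?mulr_ge0// indicE.
have [->|gx] := eqVneq (g x) 0; first by rewrite normr0 mulr_ge0.
rewrite mem_set ?mulr1//; apply/cubeP => i.
exact: le_trans ((cubeP _ _).1 (gM x gx) i) (ler_norm _).
Qed.

Lemma sqint_cube g (M B : R) : measurable_fun setT g ->
  (forall x, `|g x| <= B) -> (forall x, g x != 0 -> cube M x) ->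
  sqint mu setT g.
Proof.
move=> mg gB gM; split=> //; apply: (@integrable_cube _ M (B ^+ 2)).
- exact: measurable_funX.
- by move=> x; rewrite normrX ler_pXn2r ?nnegrE ?(le_trans _ (gB x)).
- by move=> x; rewrite sqrf_eq0; exact: gM.
Qed.

Definition translate (v : 'rV[R]_n) g : 'rV[R]_n -> R := g \o shift_rV v.

Lemma measurable_translate v g : measurable_fun setT g ->
  measurable_fun setT (translate v g).
Proof. by move=> mg; apply: (measurableT_comp mg); exact: measurable_shift_rV. Qed.

Lemma sqint_translate v g : sqint mu setT g -> sqint mu setT (translate v g).
Proof.
move=> [mg ig]; split; first exact: measurable_translate.
exact: (integrable_shift v ig).
Qed.

Lemma dot_translate v g h : sqint mu setT g -> sqint mu setT h ->
  dot mu setT (translate v g) (translate v h) = dot mu setT g h.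
Proof.
move=> sg sh.
exact: (Rintegral_shift v (f := fun x => g x * h x) (sqint_mul measurableT sg sh)).
Qed.

Lemma nrm_translate v g : sqint mu setT g ->
  nrm mu setT (translate v g) = nrm mu setT g.
Proof. by move=> sg; rewrite /nrm dot_translate. Qed.

End bounded_support.

Section test_integrals.
Context {R : realType} {n : nat}.
Variable Omega : set 'rV[R]_n.
Hypothesis bO : bounded_set Omega.
Local Notation mu := (lebesgue_rV R n).
Implicit Types u phi psi : 'rV[R]_n -> R.

Lemma test_cube : exists2 M, 0 < M &
  forall u, test_function Omega u -> forall x, u x != 0 -> cube M x.
Proof.
have [M M0 OM] := bounded_cube bO; exists M => // u tu x ux; apply: OM.
by apply: contrapT => /(test_out tu) u0; rewrite u0 eqxx in ux.
Qed.

Lemma test_integrable u : test_function Omega u ->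
  mu.-integrable setT (EFin \o u).
Proof.
move=> tu; have [M _ uM] := test_cube; have [B _ uB] := test_bounded tu.
apply: integrable_cube uB (uM _ tu); exact: (test_measurable _ tu).
Qed.

Lemma test_sqint u : test_function Omega u -> sqint mu setT u.
Proof.
move=> tu; have [M _ uM] := test_cube; have [B _ uB] := test_bounded tu.
apply: sqint_cube uB (uM _ tu); exact: (test_measurable _ tu).
Qed.

Lemma integrable_translate_mul v u psi : test_function Omega u ->
  mu.-integrable setT (EFin \o psi) ->
  mu.-integrable setT (EFin \o (translate v u \* psi)).
Proof.
move=> tu ipsi; have [B B0 uB] := test_bounded tu.
have iB := integrableZl measurableT B ipsi.
apply: (le_integrable measurableT _ _ iB).
  apply/measurable_EFinP; apply: measurable_funM.
    by apply: measurable_translate; exact: (test_measurable _ tu).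
  by case/integrableP: ipsi => /measurable_EFinP.
by move=> x _ /=; rewrite lee_fin !normrM ler_wpM2r// (le_trans (uB _))// ler_norm.
Qed.

(** Differentiation under the integral sign gives both the vanishing of the
    integral of a derivative and the estimate of difference quotients. *)
Lemma is_derive_integral_translate i u psi (t : R) : test_function Omega u ->
  mu.-integrable setT (EFin \o psi) ->
  is_derive t (1 : R)
    (fun s : R => \int[mu]_x (translate (s *: unit_rV i) u x * psi x))
    (\int[mu]_x (translate (t *: unit_rV i) (partial i u) x * psi x)).
Proof.
move=> tu ipsi; have tdu := test_partial i tu.
have [B B0 uB] := test_bounded tdu.
pose f (s : R) x := translate (s *: unit_rV i) u x * psi x.
have df (s : R) x : is_derive s (1 : R) (f ^~ x)
    (translate (s *: unit_rV i) (partial i u) x * psi x).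
  have := (is_derive_line u x (unit_rV i) s _).1
    (CkS_derive i (s *: unit_rV i + x) (test_Ck 1 tu)).
  move=> d1; have d2 := is_deriveM d1 (is_derive_cst (psi x) s (1 : R)).
  rewrite (_ : f ^~ x = (fun s : R => u (s *: unit_rV i + x)) * cst (psi x)).
    apply: is_derive_eq; rewrite /GRing.scale/= mulr0 add0r mulrC.
    by rewrite /translate /= /shift_rV addrC.
  by apply/funext => s'; rewrite /f /translate /= /shift_rV addrC.
have pE s x : partial1of2 f s x = translate (s *: unit_rV i) (partial i u) x * psi x.
  by rewrite partial1of2E; exact: (@derive_val _ _ _ _ _ _ _ (df s x)).
pose G x := B * `|psi x|.
have iG : mu.-integrable setT (EFin \o G).
  exact: (integrableZl measurableT B (integrable_norm ipsi)).
have C := @cvg_differentiation_under_integral R _ _ mu f setT measurableT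
  t (t - 1) (t + 1) _ _ _ G _ iG _.
have {}C : h^-1 *: (\int[mu]_y f (h + t) y - \int[mu]_y f t y) @[h --> 0^']
   --> \int[mu]_y partial1of2 f t y.
  apply: C.
  - by rewrite /= in_itv/= ltrBlDr ltrDl ltr01.
  - by move=> s _; exact: integrable_translate_mul.
  - by move=> s x _ _; case: (df s x).
  - by move=> x; rewrite mulr_ge0// ltW.
  - by move=> s x _ _; rewrite pE normrM ler_wpM2r// uB.
rewrite (_ : \int[mu]_x _ = \int[mu]_y partial1of2 f t y); last first.
  by apply: eq_Rintegral => x _; rewrite pE.
pose F (s : R) := \int[mu]_x f s x.
have E : (fun h : R => h^-1 *: ((F \o shift t) (h *: (1 : R)) - F t)) =
    (fun h : R => h^-1 *: (F (h + t) - F t)).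
  by apply/funext => h; rewrite /= /shift /GRing.scale/= mulr1.
have C' : h^-1 *: ((F \o shift t) (h *: (1 : R)) - F t) @[h --> 0^'] -->
   \int[mu]_y partial1of2 f t y by rewrite E.
apply: DeriveDef; first by apply/cvg_ex; exists (\int[mu]_y partial1of2 f t y).
exact: cvg_lim C'.
Qed.

(** The integral of [u] does not change under translation, and its derivative
    along the translations is the integral of the partial derivative. *)
Lemma Rintegral_partial i u : test_function Omega u ->
  \int[mu]_x partial i u x = 0.
Proof.
move=> tu; have [M M0 uM] := test_cube; have tdu := test_partial i tu.
(* An integrable weight equal to one on the supports of all translates of
   length at most one. *)
pose psi : 'rV[R]_n -> R := \1_(cube (M + 1)).
have psi1 x : cube (M + 1) x -> psi x = 1 by move=> xM; rewrite /psi indicE mem_set.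
have ipsi : mu.-integrable setT (EFin \o psi).
  apply: (@integrable_cube _ _ _ (M + 1) 1).
  - exact: measurable_indic (measurable_cube _).
  - by move=> x; rewrite /psi indicE; case: (_ \in _); rewrite ?normr1 ?normr0.
  - move=> x; rewrite /psi indicE.
    by case: (boolP (x \in cube (M + 1))) => [/set_mem//|_]; rewrite eqxx.
have [d1 d2] := is_derive_integral_translate i 0 tu ipsi.
rewrite -[RHS](@derive_val _ _ _ _ _ _ _ (is_derive_cst (\int[mu]_x u x) (0 : R) (1 : R))).
transitivity (\int[mu]_x (translate (0 *: unit_rV i) (partial i u) x * psi x)).
  apply: eq_Rintegral => x _.
  rewrite /translate /= /shift_rV scale0r addr0.
  have [->|ux] := eqVneq (partial i u x) 0; first by rewrite mul0r.
  rewrite psi1 ?mulr1//; apply/cubeP => j.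
  by rewrite (le_trans ((cubeP _ _).1 (uM _ tdu x ux) j))// lerDl.
rewrite -[LHS]d2; apply: near_eq_derive.
near=> s; rewrite /cst -(Rintegral_shift (s *: unit_rV i) (test_integrable tu)).
apply: eq_Rintegral => x _; rewrite /translate /=.
have [->|ux] := eqVneq (u (shift_rV (s *: unit_rV i) x)) 0; first by rewrite mul0r.
rewrite psi1 ?mulr1//; apply/cubeP => j.
have := (cubeP _ _).1 (uM _ tu _ ux) j; rewrite /shift_rV !mxE.
have s1 : `|s| <= 1.
  near: s; apply/nbhs_ballP; exists 1 => //= z.
  by rewrite -ball_normE /ball_ /= sub0r normrN => /ltW.
have : `|s * ((ord0 == ord0 :> 'I_1) && (j == i))%:R| <= 1.
  by case: (_ && _); rewrite ?mulr1 ?mulr0 ?normr0.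
set w := s * _ => w1 xw; rewrite -[x ord0 j](addrK w).
by rewrite (le_trans (ler_normB _ _))// lerD.
Unshelve. all: by end_near. Qed.

Lemma integration_by_parts_test i phi psi : test_function Omega phi ->
  test_function Omega psi ->
  dot mu setT phi (partial i psi) = - dot mu setT (partial i phi) psi.
Proof.
move=> tphi tpsi; have [sphi sdphi] := (test_sqint tphi, test_sqint (test_partial i tphi)).
have [spsi sdpsi] := (test_sqint tpsi, test_sqint (test_partial i tpsi)).
apply/eqP; rewrite -subr_eq0 opprK; apply/eqP.
rewrite -(Rintegral_partial i (testM (fun k => test_Ck k tphi) tpsi)).
rewrite partialM; [|exact: (test_Ck _ tphi)|exact: (test_Ck _ tpsi)].
rewrite (dotC _ _ (partial i phi)) -RintegralD//; exact: sqint_mul.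
Qed.

(** Pair the translates of [u] with the difference [psi] itself: by the mean
    value theorem the squared norm of [psi] is at most [t] times the product of
    the norms of [psi] and of the partial derivative. *)
Lemma nrm_translate_sub_pos i u (t : R) : test_function Omega u -> 0 < t ->
  nrm mu setT (translate (t *: unit_rV i) u \- u) <= t * nrm mu setT (partial i u).
Proof.
move=> tu t0; have su := test_sqint tu; have sdu := test_sqint (test_partial i tu).
set psi := _ \- _.
have spsi : sqint mu setT psi by apply: sqintB => //; exact: sqint_translate.
have ipsi : mu.-integrable setT (EFin \o psi).
  have -> : EFin \o psi =
      ((EFin \o (u \o shift_rV (t *: unit_rV i))) \- (EFin \o u))%E.
    by apply/funext => x; rewrite /psi /= EFinB.
  have iu := test_integrable tu.
  exact: (integrableB measurableT (integrable_shift _ iu) iu).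
pose F s := \int[mu]_x (translate (s *: unit_rV i) u x * psi x).
have dF (s : R) := is_derive_integral_translate i s tu ipsi.
have cF : {within `[0, t], continuous F}.
  apply: continuous_subspaceT => s; apply: differentiable_continuous.
  by apply/derivable1_diffP; case: (dF s).
have [c _ Fc] := MVT t0 (fun s _ => dF s) cF.
have FE : F t - F 0 = nrm mu setT psi ^+ 2.
  rewrite nrm2 /F -!/(dot mu setT _ _) -(dotBl measurableT)//; try exact: sqint_translate.
  by congr (dot _ _ _ _); apply/funext => x; rewrite /psi /translate /= /shift_rV scale0r addr0.
have : nrm mu setT psi ^+ 2 <= nrm mu setT (partial i u) * nrm mu setT psi * t.
  rewrite -FE Fc subr0 ler_wpM2r ?(ltW t0)//.
  apply: (le_trans (cauchy_schwarz measurableT (sqint_translate (c *: unit_rV i) sdu) spsi)).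
  by rewrite nrm_translate.
have := nrm_ge0 mu setT psi; rewrite le_eqVlt => /predU1P[<- _|psi0].
  by rewrite mulr_ge0 ?nrm_ge0// ltW.
by rewrite mulrAC expr2 ler_pM2r// mulrC.
Qed.

Lemma translate_sub_symm v u : sqint mu setT u ->
  nrm mu setT (translate (- v) u \- u) = nrm mu setT (translate v u \- u).
Proof.
move=> su; rewrite -(nrm_translate v); last first.
  by apply: sqintB => //; exact: sqint_translate.
rewrite -nrmN; congr nrm; apply/funext => x.
by rewrite /translate /= /shift_rV addrK opprB.
Qed.

Lemma nrm_translate_sub1 i u (t : R) : test_function Omega u ->
  nrm mu setT (translate (t *: unit_rV i) u \- u) <= `|t| * nrm mu setT (partial i u).
Proof.
move=> tu; have [t0|t0|<-] := ltgtP 0 t.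
- by rewrite gtr0_norm//; exact: nrm_translate_sub_pos.
- rewrite -translate_sub_symm; last exact: test_sqint.
  by rewrite -scaleNr ltr0_norm//; apply: nrm_translate_sub_pos => //; rewrite oppr_gt0.
- rewrite normr0 mul0r (_ : _ \- _ = fun x => 0 * u x).
    by rewrite (nrmZ measurableT); [rewrite normr0 mul0r|exact: test_sqint].
  by apply/funext => x; rewrite /translate /= /shift_rV scale0r addr0 subrr mul0r.
Qed.

Lemma nrm_translate_add v w u : sqint mu setT u ->
  nrm mu setT (translate (v + w) u \- u) <=
  nrm mu setT (translate v u \- u) + nrm mu setT (translate w u \- u).
Proof.
move=> su; have sv := sqint_translate v su; have sw := sqint_translate w su.
rewrite -(nrm_translate w (sqintB measurableT sv su)).
rewrite (_ : translate (v + w) u \- u =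
  translate w (translate v u \- u) \+ (translate w u \- u)).
  apply: nrmD => //; last exact: sqintB.
  by apply: sqint_translate; exact: sqintB.
apply/funext => x; rewrite /translate /= /shift_rV.
by rewrite addrA addrAC subrKA.
Qed.

(** Translate along one coordinate after the other; translations being
    isometries, the errors add up. *)
Lemma nrm_translate_sub v u : test_function Omega u ->
  nrm mu setT (translate v u \- u) <= \sum_i `|v ord0 i| * nrm mu setT (partial i u).
Proof.
move=> tu; rewrite {1}(row_sum_delta v).
elim: (index_enum _) => [|i s IH].
  have := nrm_translate_sub1; move=> _; rewrite !big_nil.
  rewrite (_ : _ \- _ = fun x => 0 * u x).
    by rewrite (nrmZ measurableT); [rewrite normr0 mul0r|exact: test_sqint].
  by apply/funext => x; rewrite /translate /= /shift_rV addr0 subrr mul0r.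
rewrite !big_cons (le_trans (nrm_translate_add _ _ (test_sqint tu)))// lerD//.
exact: nrm_translate_sub1.
Qed.

End test_integrals.

(** A translate of length exceeding the diameter has disjoint support, which
    turns the translation estimate into the Poincare inequality. *)
Lemma poincare_test (R : realType) n (Omega : set 'rV[R]_n.+1) :
  bounded_set Omega -> exists2 K, 0 < K & forall u, test_function Omega u ->
  dot (lebesgue_rV R n.+1) setT u u <=
  K * dot (lebesgue_rV R n.+1) setT (partial ord0 u) (partial ord0 u).
Proof.
move=> bO; have [M M0 uM] := test_cube bO; set mu := lebesgue_rV R n.+1.
pose t := 2 * M + 1; have t0 : 0 < t by rewrite /t; lra.
exists (t ^+ 2); first by rewrite exprn_gt0.
move=> u tu; have su := test_sqint bO tu.
have stu : sqint mu setT (translate (t *: unit_rV ord0) u) by exact: sqint_translate.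
have := nrm_translate_sub1 bO ord0 t tu; rewrite gtr0_norm// => le1.
have le2 : nrm mu setT (translate (t *: unit_rV ord0) u \- u) ^+ 2 <=
   (t * nrm mu setT (partial ord0 u)) ^+ 2.
  by rewrite ler_pXn2r ?nnegrE ?nrm_ge0 ?mulr_ge0 ?nrm_ge0// ltW.
move: le2; rewrite exprMn !nrm2 (dot_subself measurableT)// dot_translate//.
rewrite (_ : dot mu setT (translate _ u) u = 0); last first.
  transitivity (\int[mu]_(x in setT) (0 : R)); last first.
    by rewrite Rintegral_cst// mul0r.
  apply: eq_Rintegral => x _ /=.
  have [->|ux] := eqVneq (u x) 0; first by rewrite mulr0.
  have [->|utx] := eqVneq (translate (t *: unit_rV ord0) u x) 0; first by rewrite mul0r.
  have := (cubeP _ _).1 (uM _ tu _ ux) ord0.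
  have := (cubeP _ _).1 (uM _ tu _ utx) ord0.
  rewrite /shift_rV !mxE !eqxx /= mulr1 !ler_norml /t; lra.
have := dot_ge0 mu setT u; lra.
Qed.

(** * Test functions determine square-integrable functions *)

Section fundamental_lemma.
Context {R : realType} {n : nat}.
Local Notation mu := (lebesgue_rV R n).
Implicit Types (V Omega : set 'rV[R]_n).

(** Coordinate preimages of half-lines are open.  Generation by open sets is what
    Dynkin's lemma needs below. *)
Lemma measurable_rV_open :
  @measurable _ 'rV[R]_n = <<s @open 'rV[R]_n >>.
Proof.
apply/seteqP; split; last first.
  apply: smallest_sub; first exact: sigma_algebra_measurable.
  by move=> U; exact: open_measurable_rV.
apply: smallest_sub; first exact: smallest_sigma_algebra.
move=> A; rewrite -bigcup_seq => -[i _ [B mB <-]] /=; rewrite setTI.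
pose T := g_sigma_algebraType (@open 'rV[R]_n).
have mf : measurable_fun [set: T] (fun x : T => (x : 'rV[R]_n) ord0 i).
  apply: (measurability _ (RGenOInfty.measurableE R)).
  move=> _ [_ [a ->] <-]; rewrite setTI; apply: sub_sigma_algebra.
  apply: (@open_comp _ _ (fun x : 'rV[R]_n => x ord0 i)) => // x _.
  exact: coord_continuous.
by have := mf measurableT _ mB; rewrite setTI.
Qed.

(** The bumps on finitely many cubes of [V] are combined by the probabilistic sum
    [a + b - a * b], which keeps the values in the unit interval; more cubes and
    sharper bumps come in as [N] grows. *)
Lemma open_test_approx Omega V : open V -> V `<=` Omega ->
  exists phi : nat -> 'rV[R]_n -> R, forall N,
    [/\ test_function Omega (phi N), forall x, 0 <= phi N x <= 1,
        forall x, ~ V x -> phi N x = 0 &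
        forall x, V x -> phi N x @[N --> \oo] --> (1 : R)].
Proof.
move=> oV VO; have [P [c [r [Pr VE]]]] := open_bigcup_ball oV.
pose th (k j : nat) x := if j \in P then bump_rV (c j) (r j) k x else 0.
have th01 k j x : 0 <= th k j x <= 1.
  by rewrite /th; case: ifP => _; rewrite ?bump_ge0 ?bump_le1 ?lexx ?ler01.
have tht k j : test_function Omega (th k j).
  rewrite /th; case: (boolP (j \in P)) => [/set_mem Pj|_]; last exact: test0.
  have [r0 sub] := Pr _ Pj.
  by apply: test_bump => //; exact: subset_trans VO.
have thV k j x : ~ V x -> th k j x = 0.
  rewrite /th; case: (boolP (j \in P)) => // /set_mem Pj nVx.
  have [r0 sub] := Pr _ Pj; apply/eqP; apply: contrapT => /negP bx; apply: nVx.
  by rewrite VE; exists j => //; exact: bump_neq0 bx.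
pose Phi k := fix F (N : nat) : 'rV[R]_n -> R :=
  if N is N'.+1 then (F N' \+ th k N') \- (F N' \* th k N') else fun=> 0.
have Phi01 k N x : 0 <= Phi k N x <= 1.
  elim: N => [|N /=]; first by rewrite /= lexx ler01.
  by have := th01 k N x; nra.
have Phit k N : test_function Omega (Phi k N).
  elim: N => [|N IH] /=; first exact: test0.
  apply: testB; first exact: testD.
  by apply: testM => // m; exact: (test_Ck _ IH).
have PhiV k N x : ~ V x -> Phi k N x = 0.
  by move=> nVx; elim: N => //= N ->; rewrite thV// mulr0 subr0 addr0.
have Phige k N j x : (j < N)%N -> th k j x <= Phi k N x.
  elim: N => // N IH; rewrite ltnS leq_eqVlt /=.
  have := th01 k N x; have := Phi01 k N x; have := th01 k j x.
  by move=> h1 h2 h3 /predU1P[->|/IH]; nra.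
exists (fun N => Phi N N) => N; split=> //; first by move=> x; exact: PhiV.
move=> x; rewrite {1}VE => -[j Pj xj].
apply: (squeeze_cvgr _ (cvg_bump xj) (cvg_cst (1 : R))).
near=> k; rewrite (andP (Phi01 _ _ _)).2 andbT.
have := Phige k k j x; rewrite /th mem_set//; apply.
by near: k; exact: nbhs_infty_gt.
Unshelve. all: by end_near. Qed.

Section with_domain.
Variable Omega : set 'rV[R]_n.
Hypothesis oO : open Omega.
Hypothesis bO : bounded_set Omega.

Lemma measurable_domain : measurable Omega. Proof. exact: open_measurable_rV. Qed.
Let mO := measurable_domain.

Lemma domain_lty : (mu Omega < +oo)%E.
Proof.
have [M M0 OM] := bounded_cube bO.
apply: (@le_lt_trans _ _ (mu (cube M))); last by rewrite lebesgue_cube ?ltry// ltW.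
by apply: le_measure; rewrite ?inE//; exact: measurable_cube.
Qed.

Lemma sqint_domain_cst (a : R) : sqint mu Omega (fun=> a).
Proof.
exact: (sqint_cst mO _ domain_lty).
Qed.

Lemma sqint_domain_integrable h : sqint mu Omega h -> mu.-integrable Omega (EFin \o h).
Proof.
move=> sh; have := sqint_mul mO sh (sqint_domain_cst 1).
by under eq_fun do rewrite mulr1.
Qed.

Lemma test_sqint_domain phi : test_function Omega phi -> sqint mu Omega phi.
Proof.
move=> tphi; have [mphi iphi] := test_sqint bO tphi.
split; first exact: measurable_funS mphi.
exact: integrableS iphi.
Qed.

(** Dominated convergence along test functions tending to the indicator of
    [V]. *)
Lemma integral_open_eq0 h V : open V -> V `<=` Omega -> sqint mu Omega h ->
  (forall phi, test_function Omega phi -> dot mu Omega h phi = 0) ->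
  (\int[mu]_(x in V) (h x)%:E)%E = 0%E.
Proof.
move=> oV VO sh h0; have [phi phiP] := open_test_approx oV VO.
have mV : measurable V by exact: open_measurable_rV.
have ih := sqint_domain_integrable sh.
have mh := sqint_measurable sh.
have [] := @dominated_convergence _ _ _ mu Omega mO
  (fun N x => (h x * phi N x)%:E) (fun x => (h x * \1_V x)%:E) (fun x => `|h x|%:E).
- move=> N; apply/measurable_EFinP; apply: measurable_funM => //.
  by have [tphi _ _ _] := phiP N; exact: (test_measurable mO tphi).
- apply/measurable_EFinP; exact: measurable_funM.
- apply: aeW => x Ox.
  apply/fine_cvgP; split; first exact: nearW.
  apply: (@cvgM _ _ _ _ (cst (h x)) (fun N => phi N x)); first exact: cvg_cst.
  rewrite indicE; have [Vx|nVx] := pselect (V x).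
    by rewrite mem_set//; have [_ _ _] := phiP 0%N; apply.
  rewrite memNset//; apply: cvg_near_cst; apply: nearW => N.
  by have [_ _ + _] := phiP N; apply.
- exact: integrable_norm ih.
- apply: aeW => x N _; rewrite lee_fin normrM ler_piMr//.
  by have [_ /(_ x)/andP[p0 p1] _ _] := phiP N; rewrite ger0_norm.
move=> _ _ C.
have : (fun=> 0%E : \bar R) @ \oo --> (\int[mu]_(x in Omega) (h x * \1_V x)%:E)%E.
  apply: cvg_trans C; apply: near_eq_cvg; apply: nearW => N /=.
  have [tphi _ _ _] := phiP N.
  have fin := integrable_fin_num mO (sqint_mul mO sh (test_sqint_domain tphi)).
  by rewrite -[LHS]fineK// [fine _](h0 _ tphi).
have c0 : (fun=> 0%E : \bar R) @ \oo --> (0%E : \bar R) by exact: cvg_cst.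
move=> C'.
have -> : (\int[mu]_(x in V) (h x)%:E = \int[mu]_(x in Omega) (h x * \1_V x)%:E)%E.
  rewrite -{1}(setIidr VO) integral_mkcondr; apply: eq_integral => x _.
  rewrite patchE indicE; case: ifPn => _; first by rewrite mulr1.
  by rewrite mulr0.
rewrite -(cvg_lim (@ereal_hausdorff R) C').
exact: (cvg_lim (@ereal_hausdorff R) c0).
Qed.

(** The fundamental lemma of the calculus of variations.  Vanishing of the
    integral passes from open sets to Borel sets by Dynkin's lemma. *)
Lemma fundamental_lemma h : sqint mu Omega h ->
  (forall phi, test_function Omega phi -> dot mu Omega h phi = 0) ->
  h = cst 0 %[ae mu in Omega].
Proof.
move=> sh h0; have ih := sqint_domain_integrable sh.
pose h' := (EFin \o h) \_ Omega.
have ih' : mu.-integrable setT h' by exact/(integrable_mkcond _ mO).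
have mh' : measurable_fun setT h' by case/integrableP: ih'.
have int0 A : measurable A -> (\int[mu]_(x in A) h' x = 0)%E.
  rewrite measurable_rV_open.
  apply: (dynkin_induction (G := @open 'rV[R]_n)
    (P := fun A => (\int[mu]_(x in A) h' x = 0)%E)).
  - exact: measurable_rV_open.
  - by move=> U W; exact: openI.
  - rewrite /h' -integral_mkcond; exact: integral_open_eq0.
  - move=> U oU; rewrite /= /h' -integral_mkcondr.
    by apply: integral_open_eq0 => //; exact: openI.
  - move=> S mS S0; have := integral_setU mu mS (measurableC mS) (f := h').
    rewrite setUv S0 add0e => <- //.
    + by rewrite /h' -integral_mkcond; exact: integral_open_eq0.
    + by rewrite disj_set2E setICr.
  - move=> F mF tF F0; rewrite integral_bigcup//.
      by rewrite eseries0// => k _ _; exact: F0.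
    by apply: integrableS ih' => //; exact: bigcup_measurable.
have : ae_eq mu Omega (EFin \o h) (cst 0%E).
  apply: integral_ae_eq => //.
  move=> E EO mE; rewrite integral_cst// mul0e -(int0 E mE).
  apply: eq_integral => x; rewrite inE => Ex.
  by rewrite /h' patchE mem_set//; exact: EO.
by apply: filterS => x H Ox; have [] := H Ox.
Qed.

End with_domain.
End fundamental_lemma.

(** * Compactness of bounded families of test functions *)

Section variance.
Context d (T : measurableType d) (R : realType).
Variables (mu : {measure set T -> \bar R}) (Q : set T) (u : T -> R).
Hypotheses (mQ : measurable Q) (Qlty : (mu Q < +oo)%E) (su : sqint mu Q u).

Lemma dot_cst (a b : R) : dot mu Q (fun=> a) (fun=> b) = a * b * fine (mu Q).
Proof. exact: Rintegral_cst. Qed.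

Lemma dot_cstl (a : R) v : sqint mu Q v ->
  dot mu Q (fun=> a) v = a * dot mu Q (fun=> 1) v.
Proof.
move=> sv; rewrite -(dotZl mQ)//; last exact: (sqint_cst mQ).
by apply: eq_Rintegral => x _; rewrite mulr1.
Qed.

(** A double integral of squared differences, which translation estimates
    control, gives the norm of [u] up to its mean value. *)
Lemma variance_identity :
  (\int[mu]_(x in Q) \int[mu]_(y in Q) ((u x - u y) ^+ 2)%:E =
   (2 * (fine (mu Q) * dot mu Q u u - dot mu Q (fun=> 1%R) u ^+ 2))%:E)%E.
Proof.
set m := fine _; set I := dot _ _ (fun=> 1) u; set S := dot _ _ u u.
have s1 a : sqint mu Q (fun=> a) by exact: (sqint_cst mQ).
have inner x : (\int[mu]_(y in Q) ((u x - u y) ^+ 2)%:E =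
    (m * (u x * u x) + (- (2 * I)) * u x + S)%:E)%E.
  have sxu : sqint mu Q ((fun=> u x) \- u) by exact: sqintB.
  rewrite -[LHS](fineK (integrable_fin_num mQ (proj2 sxu))); congr EFin.
  transitivity (dot mu Q ((fun=> u x) \- u) ((fun=> u x) \- u)); first by [].
  by rewrite (dot_subself mQ)// dot_cst dot_cstl// -/I -/S -/m; ring.
under eq_integral => x _ do rewrite inner.
pose g x := (m * (u x * u x) + (- (2 * I)) * u x + S).
have iuu := sqint_mul mQ su su.
have iu : mu.-integrable Q (EFin \o u).
  by have := sqint_mul mQ (s1 1) su; under eq_fun do rewrite mul1r.
have i1 : mu.-integrable Q (EFin \o (fun x => m * (u x * u x))).
  exact: (integrableZl mQ m iuu).
have i2 : mu.-integrable Q (EFin \o (fun x => (- (2 * I)) * u x)).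
  exact: (integrableZl mQ (- (2 * I)) iu).
have i3 : mu.-integrable Q (EFin \o (fun=> S : R)).
  by have := sqint_mul mQ (s1 S) (s1 1); under eq_fun do rewrite mulr1.
have i12 : mu.-integrable Q (EFin \o (fun x => m * (u x * u x) + (- (2 * I)) * u x)).
  exact: (integrableD mQ i1 i2).
have ig : mu.-integrable Q (EFin \o g) by exact: (integrableD mQ i12 i3).
rewrite -[LHS](fineK (integrable_fin_num mQ ig)); congr EFin.
transitivity (\int[mu]_(x in Q) g x); first by [].
rewrite /g RintegralD// RintegralD// RintegralZl// RintegralZl// Rintegral_cst//.
rewrite -/m -[\int[mu]_(x in Q) (u x * u x)]/(dot mu Q u u) -/S.
rewrite (_ : \int[mu]_(x in Q) u x = I); first by ring.
by apply: eq_Rintegral => x _; rewrite mul1r.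
Qed.

End variance.

Section cells.
Context {R : realType} {n : nat}.
Variables (M : R) (N : nat).
Hypothesis M0 : 0 < M.
Local Notation mu := (lebesgue_rV R n).

Definition cell_size : R := 2 * M / N.+1%:R.
Local Notation delta := cell_size.

(** The cubes are half-open so as to be pairwise disjoint. *)
Definition cell (k : {ffun 'I_n -> 'I_N.+1}) : set 'rV[R]_n :=
  [set x | forall i, - M + (k i)%:R * delta <= x ord0 i < - M + (k i).+1%:R * delta].

Lemma cell_size_gt0 : 0 < delta.
Proof. by rewrite divr_gt0// mulr_gt0. Qed.

Lemma measurable_cell k : measurable (cell k).
Proof.
rewrite (_ : cell k = [set x : 'rV[R]_n | forall i, (fun i =>
    `[- M + (k i)%:R * delta, - M + (k i).+1%:R * delta[%classic) i (x ord0 i)]).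
  by apply: (@measurable_box_rV _ _ (fun i =>
    `[- M + (k i)%:R * delta, - M + (k i).+1%:R * delta[%classic)).
by apply/seteqP; split=> x H i; have := H i; rewrite /= in_itv.
Qed.

Lemma cell_inj k k' x : cell k x -> cell k' x -> k = k'.
Proof.
move=> kx k'x; apply/ffunP => i; apply/val_inj => /=.
have /andP[a1 a2] := kx i; have /andP[b1 b2] := k'x i.
have d0 := cell_size_gt0; apply/eqP; rewrite eqn_leq.
have aux (a b : nat) : - M + a%:R * delta < - M + b.+1%:R * delta -> (a <= b)%N.
  by rewrite ltrD2l ltr_pM2r// ltr_nat ltnS.
by rewrite !aux ?(le_lt_trans a1 b2) ?(le_lt_trans b1 a2).
Qed.

Lemma cell_cover (x : 'rV[R]_n) : (forall i, - M <= x ord0 i < M) -> exists k, cell k x.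
Proof.
move=> xM; have d0 := cell_size_gt0.
pose y i := (x ord0 i + M) / delta.
have y0 i : 0 <= y i.
  by rewrite divr_ge0 ?(ltW d0)//; have := xM i; lra.
have yN i : (Num.truncn (y i) < N.+1)%N.
  rewrite truncn_lt_nat// ltr_pdivrMr// /delta mulrC mulfVK ?pnatr_eq0//.
  by have := xM i; lra.
exists [ffun i => Ordinal (yN i)] => i; rewrite ffunE /=.
have /andP[] := truncn_itv (y0 i); set a := Num.truncn _.
rewrite ler_pdivlMr// ltr_pdivrMr// => h1 h2.
by apply/andP; split; lra.
Qed.

Lemma cell_sub k x y : cell k x -> cell k y -> cube delta (y - x).
Proof.
move=> kx ky; apply/cubeP => i; rewrite !mxE.
have /andP[a1 a2] := kx i; have /andP[b1 b2] := ky i.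
move: a2 b2; rewrite -natr1 mulrDl mul1r => a2 b2.
by rewrite ler_norml; apply/andP; split; lra.
Qed.

Lemma cell_sub_cube k : cell k `<=` cube M.
Proof.
have d0 := cell_size_gt0; move=> x kx; apply/cubeP => i; have /andP[a1 a2] := kx i.
have k1 : (k i).+1%:R * delta <= 2 * M.
  rewrite /delta mulrCA -[leRHS]mulr1 ler_pM2l ?mulr_gt0//.
  by rewrite ler_pdivrMr// mul1r ler_nat.
have k0 : 0 <= (k i)%:R * delta by rewrite mulr_ge0// ltW.
by rewrite ler_norml; apply/andP; split; lra.
Qed.

Lemma cell_lty k : (mu (cell k) < +oo)%E.
Proof.
apply: (@le_lt_trans _ _ (mu (cube M))); last by rewrite lebesgue_cube ?ltry// ltW.
apply: le_measure; rewrite ?inE//; last exact: cell_sub_cube.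
- exact: measurable_cell.
- exact: measurable_cube.
Qed.

(** A closed cube of half the side fits in the half-open cell, and its measure is
    known exactly. *)
Lemma cell_ge k : (delta / 2) ^+ n <= fine (mu (cell k)).
Proof.
have d0 := cell_size_gt0.
pose a : 'rV[R]_n := \row_i (- M + (k i)%:R * delta + delta / 4).
pose b : 'rV[R]_n := \row_i (- M + (k i)%:R * delta + 3 * delta / 4).
pose B : set 'rV[R]_n :=
  [set x : 'rV[R]_n | forall i, x ord0 i \in `[a ord0 i, b ord0 i]].
have muB : mu B = ((delta / 2) ^+ n)%:E.
  rewrite /B lebesgue_rV_box => [|i]; last by rewrite !mxE; lra.
  congr EFin; rewrite (eq_bigr (fun=> delta / 2)); last first.
    by move=> i _; rewrite !mxE; field.
  by rewrite prodr_const card_ord.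
have mB : measurable B.
  exact: (@measurable_box_rV _ _ (fun i => `[a ord0 i, b ord0 i]%classic)).
have : (mu B <= mu (cell k))%E.
  apply: le_measure; rewrite ?inE//; first exact: measurable_cell.
  move=> x Bx i; have := Bx i; rewrite in_itv/= !mxE => /andP[h1 h2].
  rewrite -[(k i).+1%:R]natr1 mulrDl mul1r.
  by apply/andP; split; lra.
by rewrite muB -[X in (_ <= X)%E]fineK ?lee_fin// ge0_fin_numE// cell_lty.
Qed.

(** Substitute [y = x + h].  If [x] and [y] share a cell then [h] lies in a cube
    of half-side [delta], and given [x] and [h] at most one cell contains both
    points, so that summing over the cells costs nothing.  The theorem of
    Tonelli exchanges [x] and [h]. *)
Lemma sum_cell_double_integral (u : 'rV[R]_n -> R) : measurable_fun setT u ->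
  (\sum_k \int[mu]_(x in cell k) \int[mu]_(y in cell k) ((u x - u y) ^+ 2)%:E <=
   \int[mu]_(h in cube delta) \int[mu]_x ((translate h u x - u x) ^+ 2)%:E)%E.
Proof.
move=> mu_.
pose ad (p : 'rV[R]_n * 'rV[R]_n) : 'rV[R]_n := p.2 + p.1.
have mad : measurable_fun setT ad by exact: measurable_add_rV.
have mu1 : measurable_fun setT (u \o @fst 'rV[R]_n 'rV[R]_n).
  exact: measurableT_comp.
have mua : measurable_fun setT (u \o ad) by exact: measurableT_comp.
have mi k : measurable_fun setT (\1_(cell k) : 'rV[R]_n -> R).
  exact: measurable_indic (measurable_cell k).
pose g k x y : R := \1_(cell k) x * \1_(cell k) y * (u x - u y) ^+ 2.
have g0 k x y : 0 <= g k x y by rewrite mulr_ge0 ?sqr_ge0 ?mulr_ge0.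
pose G k (p : 'rV[R]_n * 'rV[R]_n) : \bar R := (g k p.1 (ad p))%:E.
have mG k : measurable_fun setT (G k).
  apply/measurable_EFinP; apply: measurable_funM; last first.
    by apply: measurable_funX; exact: measurable_funB.
  by apply: measurable_funM; exact: measurableT_comp.
have mg k x : measurable_fun setT (fun y => (g k x y)%:E).
  apply/measurable_EFinP; apply: measurable_funM; last first.
    by apply: measurable_funX; exact: measurable_funB.
  exact: measurable_funM.
pose H (p : 'rV[R]_n * 'rV[R]_n) : \bar R :=
  (\1_(cube delta) p.2 * (u (ad p) - u p.1) ^+ 2)%:E.
have mH : measurable_fun setT H.
  apply/measurable_EFinP; apply: measurable_funM; last first.
    by apply: measurable_funX; exact: measurable_funB.
  apply: (measurableT_comp (measurable_indic (measurable_cube _))).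
  exact: measurable_snd.
have H0 p : (0 <= H p)%E by rewrite lee_fin mulr_ge0// ?sqr_ge0.
have G0 k p : (0 <= G k p)%E by rewrite lee_fin g0.
have mF k : measurable_fun setT (fun x => \int[mu]_h G k (x, h))%E.
  exact: (@measurable_fun_fubini_tonelli_F _ _ _ _ R mu _ (mG k) (G0 k)).
have mHF : measurable_fun setT (fun x => \int[mu]_h H (x, h))%E.
  exact: (@measurable_fun_fubini_tonelli_F _ _ _ _ R mu _ mH H0).
have lhs k : (\int[mu]_(x in cell k) \int[mu]_(y in cell k) ((u x - u y) ^+ 2)%:E
    = \int[mu]_x \int[mu]_h G k (x, h))%E.
  rewrite integral_mkcond; apply: eq_integral => x _.
  rewrite (_ : (\int[mu]_h G k (x, h) = \int[mu]_y (g k x y)%:E)%E); last first.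
    by rewrite -[RHS](ge0_integral_shift x)// => y; rewrite lee_fin.
  rewrite patchE; case: (boolP (x \in cell k)) => xk.
    rewrite integral_mkcond; apply: eq_integral => y _.
    rewrite patchE /g !indicE xk mul1r.
    by case: ifP => yk; rewrite ?mul1r ?mul0r.
  by rewrite integral0_eq// => y _; rewrite /g indicE (negbTE xk) !mul0r.
have pointwise x h : (\sum_k G k (x, h) <= H (x, h))%E.
  have [[k [kx kh]]|nk] := pselect (exists k, cell k x /\ cell k (h + x)).
    rewrite (bigD1 k)//= big1 ?adde0; last first.
      move=> k' /eqP k'k; rewrite /G /g /= indicE memNset ?mul0r//.
      by move=> k'x; apply: k'k; exact: cell_inj k'x kx.
    rewrite lee_fin /g /ad /= !indicE !mem_set//; last first.
      by have := cell_sub kx kh; rewrite addrK.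
    by rewrite !mul1r -sqrrN opprB.
  rewrite big1// => k _; rewrite /G /g /ad /= !indicE.
  case: (boolP (x \in cell k)) => [/set_mem xk|_]; last by rewrite !mul0r.
  case: (boolP (h + x \in cell k)) => [/set_mem hk|_]; last by rewrite mulr0 mul0r.
  by exfalso; apply: nk; exists k.
rewrite (eq_bigr (fun k => (\int[mu]_x \int[mu]_h G k (x, h))%E)); last first.
  by move=> k _; exact: lhs.
have F0 k x : [set: 'rV[R]_n] x -> (0 <= \int[mu]_h G k (x, h))%E.
  by move=> _; exact: integral_ge0.
rewrite -(ge0_integral_sum mu measurableT mF F0).
apply: (@le_trans _ _ (\int[mu]_x \int[mu]_h H (x, h))%E).
  have mGx k x : measurable_fun setT (fun h => G k (x, h)).
    exact: (measurableT_comp (mG k) (pair1_measurable x)).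
  have mHx x : measurable_fun setT (fun h => H (x, h)).
    exact: (measurableT_comp mH (pair1_measurable x)).
  apply: ge0_le_integral => //.
  - by move=> x _; apply: sume_ge0 => k _; exact: integral_ge0.
  - by apply: emeasurable_sum => k; exact: mF.
  - move=> x _; rewrite -ge0_integral_sum//.
    apply: ge0_le_integral => //.
    + by move=> h _; exact: sume_ge0.
    + exact: emeasurable_sum.
rewrite (@fubini_tonelli _ _ _ _ _ mu mu _ mH H0).
rewrite [leRHS]integral_mkcond le_eqVlt; apply/orP; left; apply/eqP.
apply: eq_integral => h _; rewrite patchE.
case: (boolP (h \in cube delta)) => hd.
  apply: eq_integral => x _; rewrite /H /= indicE hd mul1r.
  by rewrite /translate /= /shift_rV /ad /= (addrC h).
by rewrite integral0_eq// => x _; rewrite /H /= indicE (negbTE hd) mul0r.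
Qed.

End cells.

Section rellich.
Context {R : realType} {n : nat}.
Variable Omega : set 'rV[R]_n.
Hypothesis bO : bounded_set Omega.
Local Notation mu := (lebesgue_rV R n).

Lemma measurable_integral_translate (u : 'rV[R]_n -> R) : measurable_fun setT u ->
  measurable_fun setT (fun h => \int[mu]_x ((translate h u x - u x) ^+ 2)%:E)%E.
Proof.
move=> mu_.
pose f (p : 'rV[R]_n * 'rV[R]_n) : \bar R := ((u (p.2 + p.1) - u p.2) ^+ 2)%:E.
have mf : measurable_fun setT f.
  apply/measurable_EFinP; apply: measurable_funX; apply: measurable_funB.
    exact: (measurableT_comp mu_ (@measurable_add_rV R n)).
  exact: (measurableT_comp mu_ measurable_snd).
have f0 p : (0 <= f p)%E by rewrite lee_fin sqr_ge0.
exact: (@measurable_fun_fubini_tonelli_F _ _ _ _ R mu _ mf f0).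
Qed.

Lemma integral_translate_sub_le u (delta : R) : test_function Omega u -> 0 < delta ->
  (\int[mu]_(h in cube delta) \int[mu]_x ((translate h u x - u x) ^+ 2)%:E <=
   ((2 * delta) ^+ n * ((n%:R * delta) ^+ 2 *
     \sum_i dot mu setT (partial i u) (partial i u)))%:E)%E.
Proof.
move=> tu d0; set A := \sum_i _.
have A0 : 0 <= A by apply: sumr_ge0 => i _; exact: dot_ge0.
have su := test_sqint bO tu.
have mC : measurable (cube delta : set 'rV[R]_n) by exact: measurable_cube.
have inner h : cube delta h ->
    (\int[mu]_x ((translate h u x - u x) ^+ 2)%:E <= ((n%:R * delta) ^+ 2 * A)%:E)%E.
  move=> /cubeP hd.
  have sd : sqint mu setT (translate h u \- u).
    by apply: sqintB => //; exact: sqint_translate.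
  have -> : (\int[mu]_x ((translate h u x - u x) ^+ 2)%:E =
      (nrm mu setT (translate h u \- u) ^+ 2)%:E)%E.
    by rewrite nrm2 -[LHS](fineK (integrable_fin_num measurableT (proj2 sd))).
  rewrite lee_fin -[A]sqr_sqrtr// -exprMn ler_pXn2r ?nnegrE ?nrm_ge0//; last first.
    by rewrite !mulr_ge0 ?sqrtr_ge0// ltW.
  rewrite (le_trans (nrm_translate_sub bO h tu))//.
  rewrite (_ : n%:R * delta * Num.sqrt A = \sum_(i < n) delta * Num.sqrt A); last first.
    by rewrite sumr_const card_ord -mulrA mulr_natl.
  apply: ler_sum => i _; rewrite ler_pM ?nrm_ge0// /nrm ler_wsqrtr//.
  by rewrite /A (bigD1 i)//= lerDl sumr_ge0// => j _; exact: dot_ge0.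
apply: (@le_trans _ _ (\int[mu]_(h in cube delta) ((n%:R * delta) ^+ 2 * A)%:E)%E).
  apply: ge0_le_integral => //.
  - by move=> h _; apply: integral_ge0 => x _; rewrite lee_fin sqr_ge0.
  - apply: (measurable_funS measurableT) => //; apply: measurable_integral_translate.
    exact: (test_measurable _ tu).
have -> : (\int[mu]_(h in cube delta) ((n%:R * delta) ^+ 2 * A)%:E =
    ((n%:R * delta) ^+ 2 * A)%:E * mu (cube delta))%E.
  exact: (integral_cst mu mC).
by rewrite lebesgue_cube ?(ltW d0)// -EFinM lee_fin mulrC.
Qed.

Lemma dot_sum_cells u (M : R) N : 0 < M -> sqint mu setT u ->
  (forall x : 'rV[R]_n, u x != 0 -> forall i, - M <= x ord0 i < M) ->
  dot mu setT u u = \sum_(k : {ffun 'I_n -> 'I_N.+1}) dot mu (cell M k) u u.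
Proof.
move=> M0 su uM; apply: EFin_inj; rewrite -sumEFin.
have mC k : measurable (@cell R n M N k) by exact: measurable_cell.
have sk (k : {ffun 'I_n -> 'I_N.+1}) : sqint mu (cell M k) u.
  by apply: sqintS.
have E D : measurable D -> sqint mu D u ->
    ((dot mu D u u)%:E = \int[mu]_(x in D) (u x ^+ 2)%:E)%E.
  by move=> mD sD; rewrite -[RHS](fineK (integrable_fin_num mD (proj2 sD))).
rewrite E//; under [RHS]eq_bigr => k _ do rewrite E//.
under [RHS]eq_bigr => k _ do rewrite integral_mkcond.
rewrite -ge0_integral_sum//; last 2 first.
- move=> k; apply/(measurable_restrictT _ (mC k)).
  by case: (sk k) => _ /integrableP[].
- by move=> k x _; rewrite patchE; case: ifP => // _; rewrite lee_fin sqr_ge0.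
apply: eq_integral => x _.
have [u0|ux] := eqVneq (u x) 0.
  rewrite u0 expr0n/= big1// => k _; rewrite patchE; case: ifP => // _.
  by rewrite u0 expr0n.
have [k kx] := cell_cover N M0 (uM x ux).
rewrite (bigD1 k)//= big1 ?adde0 => [|k' /eqP k'k]; first by rewrite patchE mem_set.
by rewrite patchE memNset// => k'x; apply: k'k; exact: cell_inj M0 _ _ _ k'x kx.
Qed.

(** The quantitative core of Rellich's theorem.  The functionals are the
    integrals over small cells; on each cell the variance identity turns the
    translation estimate into a bound of the norm. *)
Lemma rellich_test (e : R) : 0 < e ->
  exists (I : finType) (chi : I -> 'rV[R]_n -> R) (c : R),
  [/\ 0 <= c, forall k, sqint mu setT (chi k) &
   forall u, test_function Omega u ->
   dot mu setT u u <= e * \sum_i dot mu setT (partial i u) (partial i u) +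
     c * \sum_k dot mu setT u (chi k) ^+ 2].
Proof.
move=> e0; have [M M0 uM] := test_cube bO.
have M1 : 0 < M + 1 by rewrite addr_gt0.
(* With N.+1 cells per axis the energy comes with the coefficient
   K / (2 * N.+1 ^ 2). *)
pose K : R := 4 ^+ n * n%:R ^+ 2 * (2 * (M + 1)) ^+ 2.
have K0 : 0 <= K by rewrite mulr_ge0 ?sqr_ge0// mulr_ge0 ?sqr_ge0// exprn_ge0.
pose N := Num.truncn (K / e).
pose delta := cell_size (M + 1) N.
have d0 : 0 < delta by exact: cell_size_gt0.
have dK : 2^-1 * 4 ^+ n * (n%:R * delta) ^+ 2 <= e.
  have KN : K < N.+1%:R * e.
    by rewrite -ltr_pdivrMr//; exact: truncnS_gt.
  have N1 : 1 <= N.+1%:R :> R by rewrite ler1n.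
  rewrite (_ : _ * _ = 2^-1 * K / N.+1%:R ^+ 2); last first.
    have : N.+1%:R != 0 :> R by rewrite pnatr_eq0.
    by rewrite /K /delta /cell_size; set x := N.+1%:R => x0; field.
  rewrite ler_pdivrMr ?exprn_gt0//.
  have xe : N.+1%:R * e <= N.+1%:R * e * N.+1%:R by rewrite ler_peMr// mulr_ge0// ltW.
  rewrite [leRHS](_ : _ = N.+1%:R * e * N.+1%:R); last by ring.
  rewrite (le_trans _ xe)// (le_trans _ (ltW KN))//.
  by rewrite ler_piMl// invf_le1// ler1n.
pose Q (k : {ffun 'I_n -> 'I_N.+1}) : set 'rV[R]_n := cell (M + 1) k.
have mQ k : measurable (Q k) by exact: measurable_cell.
pose q : R := (delta / 2) ^+ n.
have q0 : 0 < q by rewrite exprn_gt0// divr_gt0.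
exists {ffun 'I_n -> 'I_N.+1}, (fun k => \1_(Q k)), q^-1; split.
- by rewrite invr_ge0 ltW.
- move=> k; apply: (@sqint_cube _ _ _ (M + 1) 1).
  + exact: measurable_indic (mQ k).
  + by move=> x; rewrite indicE; case: (_ \in _); rewrite ?normr1 ?normr0.
  + move=> x; rewrite indicE; case: (boolP (x \in Q k)) => [/set_mem kx _|_]; last by rewrite eqxx.
    exact: (cell_sub_cube M1 kx).
move=> u tu; have su := test_sqint bO tu.
set A := \sum_i dot _ _ _ _.
have sk k : sqint mu (Q k) u.
  by apply: sqintS.
have Qlty k : (mu (Q k) < +oo)%E by exact: cell_lty.
pose m k := fine (mu (Q k)).
pose S k := dot mu (Q k) u u.
pose I k := dot mu (Q k) (fun=> 1) u.
have IE k : dot mu setT u (\1_(Q k)) = I k.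
  rewrite /I /dot [RHS]Rintegral_mkcond; apply: eq_Rintegral => x _.
  by rewrite patchE indicE; case: ifP; rewrite ?mulr1 ?mul1r ?mulr0.
have H1 : \sum_k 2 * (m k * S k - I k ^+ 2) <=
    (2 * delta) ^+ n * ((n%:R * delta) ^+ 2 * A).
  rewrite -lee_fin -sumEFin.
  have B := sum_cell_double_integral N M1 (test_measurable measurableT tu).
  apply: le_trans (le_trans B (integral_translate_sub_le tu d0)).
  rewrite le_eqVlt; apply/orP; left; apply/eqP; apply: eq_bigr => k _.
  by rewrite (variance_identity (mQ k) (Qlty k) (sk k)).
have H2 : dot mu setT u u = \sum_k S k.
  apply: dot_sum_cells => // x ux i.
  have := (cubeP _ _).1 (uM _ tu _ ux) i.
  by rewrite ler_norml => /andP[h1 h2]; apply/andP; split; lra.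
have H3 : q * \sum_k S k <= \sum_k m k * S k.
  rewrite mulr_sumr; apply: ler_sum => k _; rewrite ler_wpM2r ?dot_ge0//.
  exact: cell_ge.
rewrite H2 -(ler_pM2l q0) (le_trans H3)// mulrDr mulrA mulVKf ?gt_eqF//.
have -> : \sum_k dot mu setT u (\1_(Q k)) ^+ 2 = \sum_k I k ^+ 2.
  by apply: eq_bigr => k _; rewrite IE.
move: H1; rewrite -mulr_sumr sumrB => H1.
have A0 : 0 <= A by apply: sumr_ge0 => i _; exact: dot_ge0.
have H4 : 2^-1 * ((2 * delta) ^+ n * ((n%:R * delta) ^+ 2 * A)) <= q * e * A.
  rewrite [leLHS](_ : _ = q * (2^-1 * 4 ^+ n * (n%:R * delta) ^+ 2) * A); last first.
    have -> : (2 * delta) ^+ n = q * 4 ^+ n by rewrite /q -exprMn; congr (_ ^+ _); field.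
    by ring.
  by rewrite ler_wpM2r// ler_pM2l.
by lra.
Qed.

End rellich.

(** * Weak derivatives and the energy space *)

(** Restricting to [e <= 1] lets errors quadratic in [e] be absorbed in the
    constant [K]. *)
Lemma le0_eps (R : realType) (x K : R) :
  (forall e : R, 0 < e -> e <= 1 -> x <= K * e) -> x <= 0.
Proof.
move=> H; apply/ler_addgt0Pr => e e0.
have K0 : 0 < `|K| + 1 by rewrite ltr_wpDl.
pose d := Num.min 1 (e / (`|K| + 1)).
have d0 : 0 < d by rewrite lt_min ltr01 divr_gt0.
have d1 : d <= 1 by rewrite ge_min lexx.
rewrite add0r (le_trans (H d d0 d1))//.
have h1 : K * d <= (`|K| + 1) * d.
  by rewrite ler_wpM2r ?(ltW d0)// (le_trans (ler_norm K))// lerDl.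
rewrite (le_trans h1)// mulrC -ler_pdivlMr//.
by rewrite /d ge_min lexx orbT.
Qed.

Lemma eq0_eps (R : realType) (x K : R) :
  (forall e : R, 0 < e -> `|x| <= K * e) -> x = 0.
Proof.
move=> H; apply/eqP; rewrite -normr_le0.
by apply: (@le0_eps _ _ K) => e e0 _; exact: H.
Qed.

Section sobolev_facts.
Context {R : realType} {n : nat}.
Variable Omega : set 'rV[R]_n.
Hypotheses (oO : open Omega) (bO : bounded_set Omega).
Local Notation mu := (lebesgue_rV R n).
Local Notation sqO := (sqint mu Omega).
Local Notation dotO := (dot mu Omega).
Local Notation nrmO := (nrm mu Omega).
Implicit Types (u v w f phi : 'rV[R]_n -> R) (g h : 'I_n -> 'rV[R]_n -> R).

Let mO : measurable Omega. Proof. exact: measurable_domain. Qed.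

Definition energy g h : R := \sum_i dotO (g i) (h i).

Definition grad_test phi : 'I_n -> 'rV[R]_n -> R := fun i => partial i phi.

Lemma energy_ge0 g : 0 <= energy g g.
Proof. by apply: sumr_ge0 => i _; exact: dot_ge0. Qed.

Lemma dot_testr v phi : test_function Omega phi ->
  dotO v phi = dot mu setT v phi.
Proof.
move=> tphi; rewrite /dot [LHS]Rintegral_mkcond; apply: eq_Rintegral => x _.
rewrite patchE; case: (boolP (x \in Omega)) => // xO.
by rewrite (test_out tphi) ?mulr0// => /mem_set; apply/negP.
Qed.

Lemma test_sum phi (s : seq 'I_n) (F : 'I_n -> 'rV[R]_n -> R) :
  (forall i, test_function Omega (F i)) ->
  test_function Omega (fun x => \sum_(i <- s) F i x).
Proof.
move=> tF; elim: s => [|i s IH].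
  by under eq_fun do rewrite big_nil; exact: test0.
by under eq_fun do rewrite big_cons; exact: (testD (tF i) IH).
Qed.

Lemma test_laplacian phi : test_function Omega phi ->
  test_function Omega (laplacian phi).
Proof. by move=> tphi; apply: test_sum => // i; do 2! apply: test_partial. Qed.

Let stest phi : test_function Omega phi -> sqO phi.
Proof. exact: test_sqint_domain. Qed.

Lemma is_gradP v g : is_grad Omega v g <->
  forall i, sqO (g i) /\ forall phi, test_function Omega phi ->
    dotO v (partial i phi) = - dotO (g i) phi.
Proof. by split=> H i; have [/(L2_sqint mO) ? ?]:= H i; split=> //; apply/(L2_sqint mO). Qed.

Lemma is_grad_test phi : test_function Omega phi ->
  is_grad Omega phi (grad_test phi).
Proof.
move=> tphi; apply/is_gradP => i; split; first exact/stest/test_partial.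
move=> psi tpsi; rewrite !dot_testr//; last exact: test_partial.
exact: (integration_by_parts_test bO).
Qed.

Lemma is_gradD u v g h : sqO u -> sqO v ->
  is_grad Omega u g -> is_grad Omega v h ->
  is_grad Omega (u \+ v) (fun i => g i \+ h i).
Proof.
move=> su sv /is_gradP ug /is_gradP vh; apply/is_gradP => i.
have [sg gP] := ug i; have [sh hP] := vh i; split; first exact: sqintD.
move=> phi tphi; have sp := stest tphi; have sdp := stest (test_partial i tphi).
by rewrite !(dotDl mO)// gP// hP// opprD.
Qed.

Lemma is_gradZ a u g : sqO u -> is_grad Omega u g ->
  is_grad Omega (fun x => a * u x) (fun i x => a * g i x).
Proof.
move=> su /is_gradP ug; apply/is_gradP => i.
have [sg gP] := ug i; split; first exact: sqintZ.
move=> phi tphi; have sp := stest tphi; have sdp := stest (test_partial i tphi).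
by rewrite !(dotZl mO)// gP// mulrN.
Qed.

Lemma is_gradB u v g h : sqO u -> sqO v ->
  is_grad Omega u g -> is_grad Omega v h ->
  is_grad Omega (u \- v) (fun i => g i \- h i).
Proof.
move=> su sv ug vh.
have := is_gradD su (sqintZ mO (-1) sv) ug (is_gradZ (-1) sv vh).
rewrite (_ : _ \+ _ = u \- v); last by apply/funext => x /=; rewrite mulN1r.
rewrite (_ : (fun i => _ \+ _) = (fun i => g i \- h i))//.
by apply/funext => i; apply/funext => x /=; rewrite mulN1r.
Qed.

Lemma is_grad_cst (c : R) : is_grad Omega (fun=> c) (fun _ _ => 0).
Proof.
apply/is_gradP => i; split; first exact: sqint0.
move=> phi tphi; have tdp := test_partial i tphi; rewrite dot_testr//.
transitivity (c * \int[mu]_x partial i phi x).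
  rewrite -RintegralZl//; exact: (test_integrable bO).
rewrite (Rintegral_partial bO)// mulr0.
rewrite /dot; under eq_Rintegral do rewrite mul0r.
by rewrite Rintegral_cst// mul0r oppr0.
Qed.

Lemma is_grad_unique v g h i : is_grad Omega v g -> is_grad Omega v h ->
  g i = h i %[ae mu in Omega].
Proof.
move=> /is_gradP/(_ i)[sg gP] /is_gradP/(_ i)[sh hP].
have := fundamental_lemma oO bO (sqintB mO sg sh).
have H phi : test_function Omega phi -> dotO (g i \- h i) phi = 0.
  move=> tphi; rewrite (dotBl mO)//; last exact: stest.
  by apply/eqP; rewrite subr_eq0 -eqr_opp -gP// hP.
move/(_ H); apply: filterS => x E Ox; apply/eqP; rewrite -subr_eq0; apply/eqP.
exact: E.
Qed.

Lemma is_laplacian_unique v w w' : is_laplacian Omega v w ->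
  is_laplacian Omega v w' -> w = w' %[ae mu in Omega].
Proof.
move=> [/(L2_sqint mO) sw wP] [/(L2_sqint mO) sw' wP'].
have := fundamental_lemma oO bO (sqintB mO sw sw').
have H phi : test_function Omega phi -> dotO (w \- w') phi = 0.
  move=> tphi; rewrite (dotBl mO)//; last exact: stest.
  by apply/eqP; rewrite subr_eq0; apply/eqP; rewrite -[LHS]wP// -[RHS]wP'.
move/(_ H); apply: filterS => x E Ox; apply/eqP; rewrite -subr_eq0; apply/eqP.
exact: E.
Qed.

Lemma gradP v g : is_grad Omega v g -> is_grad Omega v (grad Omega v).
Proof. by move=> vg; apply: (@xgetPex _ _ [set g | is_grad Omega v g]); exists g. Qed.

Lemma dlaplacianP v w : is_laplacian Omega v w ->
  is_laplacian Omega v (dlaplacian Omega v).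
Proof. by move=> vw; apply: (@xgetPex _ _ [set w | is_laplacian Omega v w]); exists w. Qed.

Lemma seminorm1E v g : is_grad Omega v g ->
  seminorm1 Omega v = Num.sqrt (energy g g).
Proof.
move=> vg; congr Num.sqrt; apply: eq_bigr => i _.
have vg' := gradP vg.
have [sg _] := (is_gradP _ _).1 vg i; have [sg' _] := (is_gradP _ _).1 vg' i.
rewrite norm0E// (@eq_ae_nrm _ _ _ _ _ mO _ (g i)) ?nrm2//.
- exact: sqint_measurable sg'.
- exact: sqint_measurable sg.
- exact: is_grad_unique vg' vg.
Qed.

Lemma norm0_dlaplacian v w f : is_laplacian Omega v w -> sqO f ->
  norm0 Omega (dlaplacian Omega v \+ f) = nrmO (w \+ f).
Proof.
move=> vw sf; have vw' := dlaplacianP vw.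
have sw := (L2_sqint mO _).1 (proj1 vw); have sw' := (L2_sqint mO _).1 (proj1 vw').
have swf := sqintD mO sw sf; have swf' := sqintD mO sw' sf.
rewrite norm0E//; apply: (eq_ae_nrm mO).
- exact: sqint_measurable swf'.
- exact: sqint_measurable swf.
- have := is_laplacian_unique vw' vw; apply: filterS => x E Ox /=.
  by rewrite E.
Qed.

(** The pairs made of a function of the closure of the test functions and of
    its gradient, described without reference to chosen representatives. *)
Definition H10_pair w g : Prop :=
  [/\ sqO w, forall i, sqO (g i) &
   forall e : R, 0 < e -> exists phi, [/\ test_function Omega phi,
     nrmO (w \- phi) <= e & forall i, nrmO (g i \- partial i phi) <= e]].

Lemma abs_dot_le u v (e : R) : sqO u -> sqO v -> nrmO v <= e ->
  `|dotO u v| <= nrmO u * e.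
Proof.
move=> su sv ve; rewrite (le_trans _ (ler_wpM2l (nrm_ge0 _ _ _) ve))//.
rewrite ler_norml cauchy_schwarz// andbT lerNl.
rewrite -(dotNl mO)//; rewrite -(nrmN mu Omega u).
by apply: cauchy_schwarz => //; exact: sqintN.
Qed.

(** Integration by parts holds for the approximating test functions, and both of
    its sides are continuous in the mean. *)
Lemma H10_pair_is_grad w g : H10_pair w g -> is_grad Omega w g.
Proof.
move=> [sw sg H]; apply/is_gradP => i; split=> // phi tphi.
have sp := stest tphi; have sdp := stest (test_partial i tphi).
apply/eqP; rewrite -subr_eq0 opprK; apply/eqP.
apply: (@eq0_eps _ _ (nrmO (partial i phi) + nrmO phi)) => e /H[psi [tpsi we ge]].
have spsi := stest tpsi; have sdpsi := stest (test_partial i tpsi).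
have := (is_gradP _ _).1 (is_grad_test tpsi) i => -[_ /(_ _ tphi)] E.
have -> : dotO w (partial i phi) + dotO (g i) phi =
    dotO (partial i phi) (w \- psi) + dotO phi (g i \- partial i psi).
  rewrite !(dotBr mO)// (dotC _ _ _ psi) E (dotC _ _ phi (partial i psi)).
  by rewrite (dotC _ _ w) (dotC _ _ (g i)) /grad_test; ring.
rewrite (le_trans (ler_normD _ _))// mulrDl lerD//.
  by apply: abs_dot_le => //; exact: sqintB.
by apply: abs_dot_le => //; exact: sqintB.
Qed.

Lemma H10_H10_pair w : H10 Omega w -> H10_pair w (grad Omega w).
Proof.
move=> [[/(L2_sqint mO) sw [g0 wg0]] H]; have wg := gradP wg0.
have sg i := proj1 ((is_gradP _ _).1 wg i).
split=> // e /H[phi [tphi He]]; exists phi; split=> //.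
- have swp : sqO (w \- phi) by apply: sqintB => //; exact: stest.
  rewrite norm0E// in He.
  rewrite -[leLHS]ger0_norm ?nrm_ge0// -sqrtr_sqr (le_trans _ (ltW He))//.
  by rewrite ler_wsqrtr// lerDl sqr_ge0.
- move=> i; have wpg := is_gradB sw (stest tphi) wg (is_grad_test tphi).
  rewrite (seminorm1E wpg) sqr_sqrtr ?energy_ge0// in He.
  rewrite -[leLHS]ger0_norm ?nrm_ge0// -sqrtr_sqr (le_trans _ (ltW He))//.
  rewrite ler_wsqrtr// /energy (bigD1 i)//= nrm2 addrCA lerDl addr_ge0 ?sqr_ge0//.
  by apply: sumr_ge0 => j _; exact: dot_ge0.
Qed.

Lemma H10_pair_H10 w g : H10_pair w g -> H10 Omega w.
Proof.
move=> wg; have wgr := H10_pair_is_grad wg; have [sw sg H] := wg.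
split; first by split; [exact/(L2_sqint mO)|exists g].
move=> e e0; pose d := e / (n%:R + 2).
have n0 : 0 < n%:R + 2 :> R by rewrite ltr_wpDl.
have d0 : 0 < d by rewrite divr_gt0.
have [phi [tphi we ge]] := H d d0; exists phi; split=> //.
have swp : sqO (w \- phi) by apply: sqintB => //; exact: stest.
have wpg := is_gradB sw (stest tphi) wgr (is_grad_test tphi).
rewrite norm0E// (seminorm1E wpg) [Num.sqrt (energy _ _) ^+ 2]sqr_sqrtr ?energy_ge0//.
rewrite -(@ltr_pXn2r _ 2) ?nnegrE ?sqrtr_ge0 ?(ltW e0)//.
rewrite [Num.sqrt (_ + _) ^+ 2]sqr_sqrtr ?addr_ge0 ?sqr_ge0 ?energy_ge0//.
have h1 : nrmO (w \- phi) ^+ 2 <= d ^+ 2 by rewrite ler_pXn2r ?nnegrE ?nrm_ge0// ltW.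
have h2 : energy (fun i => g i \- grad_test phi i) (fun i => g i \- grad_test phi i)
    <= n%:R * d ^+ 2.
  rewrite (_ : n%:R * d ^+ 2 = \sum_(i < n) d ^+ 2); last first.
    by rewrite sumr_const card_ord mulr_natl.
  apply: ler_sum => i _; rewrite -nrm2 ler_pXn2r ?nnegrE ?nrm_ge0 ?(ltW d0)//.
have eE : e = d * (n%:R + 2) by rewrite /d mulfVK// gt_eqF.
have nn : 0 <= n%:R :> R by [].
apply: (@le_lt_trans _ _ ((n%:R + 1) * d ^+ 2)).
  by rewrite mulrDl mul1r [leRHS]addrC; exact: (lerD h1 h2).
clearbody d; rewrite eE exprMn [ltLHS]mulrC ltr_pM2l ?exprn_gt0//; nra.
Qed.

(** For a test function this is the definition of the two weak derivatives; both
    sides are continuous in the energy space. *)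
Lemma green_H10 v h w g l : sqO v -> is_grad Omega v h -> is_laplacian Omega v l ->
  H10_pair w g -> dotO l w = - energy h g.
Proof.
move=> sv /is_gradP vh [/(L2_sqint mO) sl lP] [sw sg H].
have sh i := proj1 (vh i).
have onT phi : test_function Omega phi -> dotO l phi = - energy h (grad_test phi).
  move=> tphi; rewrite -[LHS]lP// /energy -sumrN.
  transitivity (\sum_i dotO v (partial i (partial i phi))); last first.
    apply: eq_bigr => i _; have [_ ->]// := vh i; exact: test_partial.
  rewrite -(dot_sumr _ mO sv)// => i; apply: stest; do 2! apply: test_partial => //.
apply/eqP; rewrite -subr_eq0 opprK; apply/eqP.
apply: (@eq0_eps _ _ (nrmO l + \sum_i nrmO (h i))) => e /H[phi [tphi we ge]].
have sp := stest tphi; have sdp i := stest (test_partial i tphi).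
have -> : dotO l w + energy h g =
    dotO l (w \- phi) + \sum_i dotO (h i) (g i \- partial i phi).
  rewrite (dotBr mO)// (onT _ tphi).
  under [X in _ = _ + X]eq_bigr do rewrite (dotBr mO)//.
  by rewrite sumrB /energy /grad_test; ring.
rewrite (le_trans (ler_normD _ _))// mulrDl lerD//.
  by apply: abs_dot_le => //; exact: sqintB.
rewrite (le_trans (ler_norm_sum _ _ _))// mulr_suml; apply: ler_sum => i _.
by apply: abs_dot_le => //; exact: sqintB.
Qed.

End sobolev_facts.

(** * The first eigenvalue is attained *)

(** Ultrafilters replace the diagonal extraction of subsequences: along an
    ultrafilter all bounded sequences converge simultaneously. *)
Lemma ultra_bounded_cvg (R : realType) (U : set_system nat) (a : nat -> R) (B : R) :
  UltraFilter U -> (forall n, `|a n| <= B) ->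
  exists l, forall e, 0 < e -> U [set n | `|a n - l| < e].
Proof.
move=> UU aB; have PU : ProperFilter U by exact: ultra_proper.
have cB : compact `[- B, B]%classic by exact: segment_compact.
have FB : U (a @^-1` `[- B, B]%classic).
  by apply: filterS (@filterT _ U _) => n _ /=; rewrite in_itv/= -ler_norml; exact: aB.
have [l [_ lcl]] := cB _ (fmap_proper_filter a PU) FB.
exists l => e e0; have [//|nS] := in_ultra_setVsetC [set n | `|a n - l| < e] UU.
have aC : (a @ U) [set x | ~ `|x - l| < e] by [].
have [x [/= xl]] := lcl _ (ball l e) aC (nbhsx_ballx l e e0).
by rewrite -ball_normE /ball_/= distrC.
Qed.

Section dot_closeness.
Context d (T : measurableType d) (R : realType).
Variables (mu : {measure set T -> \bar R}) (D : set T).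
Hypothesis mD : measurable D.
Implicit Types u v : T -> R.

Lemma dot_le_near u v (e : R) : sqint mu D u -> sqint mu D v ->
  nrm mu D (u \- v) <= e -> dot mu D u u <= dot mu D v v + 2 * nrm mu D u * e.
Proof.
move=> su sv uve; have suv := sqintB mD su sv.
have E : dot mu D v v = dot mu D u u - 2 * dot mu D u (u \- v)
    + dot mu D (u \- v) (u \- v).
  rewrite -(dot_subself mD)//; congr (dot _ _ _ _); by apply/funext => x /=; ring.
have := cauchy_schwarz mD su suv; have := dot_ge0 mu D (u \- v).
have : nrm mu D u * nrm mu D (u \- v) <= nrm mu D u * e.
  by rewrite ler_wpM2l ?nrm_ge0.
by rewrite E -[2 * _ * e]mulrA; lra.
Qed.

Lemma nrmBC u v : nrm mu D (u \- v) = nrm mu D (v \- u).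
Proof.
by rewrite -nrmN; congr nrm; apply/funext => x /=; rewrite opprB.
Qed.

Lemma dot_ge_near u v (e : R) : sqint mu D u -> sqint mu D v ->
  nrm mu D (u \- v) <= e ->
  dot mu D v v <= dot mu D u u + 2 * nrm mu D u * e + 2 * e ^+ 2.
Proof.
move=> su sv uve; have e0 : 0 <= e by exact: le_trans (nrm_ge0 _ _ _) uve.
have := dot_le_near sv su; rewrite nrmBC => /(_ _ uve) le1.
have : nrm mu D v <= nrm mu D u + e.
  rewrite (_ : v = u \- (u \- v)); last by apply/funext => x /=; ring.
  by rewrite (le_trans (nrmB mD su (sqintB mD su sv)))// lerD2l.
by move: (nrm mu D v) (nrm mu D u) le1 => a b; rewrite expr2; nra.
Qed.

Lemma dot_parallelogram u v : sqint mu D u -> sqint mu D v ->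
  dot mu D (u \- v) (u \- v) + dot mu D (u \+ v) (u \+ v) =
  2 * dot mu D u u + 2 * dot mu D v v.
Proof. by move=> su sv; rewrite (dot_subself mD)// (dot_addself mD)//; ring. Qed.

End dot_closeness.

Section rayleigh.
Context {R : realType} {n : nat}.
Variable Omega : set 'rV[R]_n.+1.
Hypotheses (oO : open Omega) (bO : bounded_set Omega).
Local Notation mu := (lebesgue_rV R n.+1).
Local Notation sqO := (sqint mu Omega).
Local Notation dotO := (dot mu Omega).
Local Notation nrmO := (nrm mu Omega).
Local Notation E phi := (energy Omega (grad_test phi) (grad_test phi)).
Implicit Types (u v w phi : 'rV[R]_n.+1 -> R) (g : 'I_n.+1 -> 'rV[R]_n.+1 -> R).

Let mO : measurable Omega. Proof. exact: measurable_domain. Qed.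
Let stest phi : test_function Omega phi -> sqO phi.
Proof. exact: test_sqint_domain. Qed.

Lemma energy_testE u : test_function Omega u ->
  E u = \sum_i dot mu setT (partial i u) (partial i u).
Proof. by move=> tu; apply: eq_bigr => i _; rewrite dot_testr//; exact: test_partial. Qed.

Lemma poincare_energy : exists2 K, 0 < K &
  forall u, test_function Omega u -> dotO u u <= K * E u.
Proof.
have [K K0 H] := poincare_test bO; exists K => // u tu.
rewrite dot_testr// (le_trans (H u tu))// ler_pM2l// energy_testE//.
by rewrite (bigD1 ord0)//= lerDl sumr_ge0// => i _; exact: dot_ge0.
Qed.

Lemma energyZ_test (a : R) u : test_function Omega u ->
  E (fun x => a * u x) = a ^+ 2 * E u.
Proof.
move=> tu; rewrite /energy mulr_sumr; apply: eq_bigr => i _; rewrite /grad_test.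
have sdu := stest (test_partial i tu); rewrite partialZ; last exact: (test_Ck _ tu).
by rewrite (dotZl mO)// ?(dotZr mO)//; [ring|exact: sqintZ].
Qed.

Lemma energy_parallelogram u v : test_function Omega u -> test_function Omega v ->
  E (u \- v) + E (u \+ v) = 2 * E u + 2 * E v.
Proof.
move=> tu tv.
have par i := dot_parallelogram mO (stest (test_partial i tu)) (stest (test_partial i tv)).
have Cu := test_Ck 1 tu; have Cv := test_Ck 1 tv.
transitivity (\sum_i (dotO (partial i u \- partial i v) (partial i u \- partial i v)
    + dotO (partial i u \+ partial i v) (partial i u \+ partial i v))).
  rewrite big_split /=; congr (_ + _); apply: eq_bigr => i _.
    by rewrite /grad_test partialB.
  by rewrite /grad_test partialD.
rewrite (eq_bigr _ (fun i _ => par i)) big_split /=.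
by congr (_ + _); rewrite /energy mulr_sumr.
Qed.

(** The squared norms of test functions of energy at most one, rather than
    exactly one: the zero function makes the set inhabited. *)
Definition rayleigh_set : set R :=
  [set dotO u u | u in [set u | test_function Omega u /\ E u <= 1]].

Definition rayleigh : R := sup rayleigh_set.

Lemma has_sup_rayleigh : has_sup rayleigh_set.
Proof.
have [K K0 H] := poincare_energy; split.
  exists (dotO (fun=> 0) (fun=> 0)), (fun=> 0) => //; split; first exact: test0.
  rewrite /energy big1// => i _; rewrite /grad_test partial_cst /dot.
  by under eq_Rintegral do rewrite mul0r; rewrite Rintegral_cst// mul0r.
exists K => _ [u [tu Eu] <-]; rewrite (le_trans (H u tu))//.
by rewrite -[leRHS]mulr1 ler_pM2l.
Qed.

Lemma rayleigh_ge0 : 0 <= rayleigh.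
Proof.
have [[x xS] _] := has_sup_rayleigh.
apply: (@le_trans _ _ x); last exact: sup_upper_bound has_sup_rayleigh _ xS.
by case: xS => u _ <-; exact: dot_ge0.
Qed.

(** Normalize [u], unless its energy vanishes, in which case the Poincare
    inequality makes its norm vanish as well. *)
Lemma rayleigh_test u : test_function Omega u -> dotO u u <= rayleigh * E u.
Proof.
move=> tu; have [K K0 H] := poincare_energy.
have [E0|En0] := eqVneq (E u) 0.
  by have := H u tu; rewrite E0 !mulr0.
have Ep : 0 < E u by rewrite lt_neqAle eq_sym En0 energy_ge0.
pose a := (Num.sqrt (E u))^-1.
have a2 : a ^+ 2 = (E u)^-1 by rewrite exprVn sqr_sqrtr// energy_ge0.
have : dotO (fun x => a * u x) (fun x => a * u x) <= rayleigh.
  apply: sup_upper_bound has_sup_rayleigh _ _; exists (fun x => a * u x) => //.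
  by split; [exact: testZ|rewrite energyZ_test// a2 mulVf].
have su := stest tu.
rewrite (dotZl mO)// ?(dotZr mO)//; last exact: sqintZ.
by rewrite mulrA -expr2 a2 mulrC ler_pdivrMr.
Qed.

Lemma rellich_energy (e : R) : 0 < e ->
  exists (I : finType) (chi : I -> 'rV[R]_n.+1 -> R) (c : R),
  [/\ 0 <= c, forall k, sqO (chi k) &
   forall u, test_function Omega u ->
   dotO u u <= e * E u + c * \sum_k dotO u (chi k) ^+ 2].
Proof.
move=> /(rellich_test bO)[I [chi [c [c0 schi H]]]]; exists I, chi, c; split=> //.
  by move=> k; apply: sqintS.
move=> u tu; rewrite dot_testr// energy_testE//.
rewrite (eq_bigr (fun k => dot mu setT u (chi k) ^+ 2)); first exact: H.
by move=> k _; rewrite dotC dot_testr// dotC.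
Qed.

Section maximizing.
Variable u_ : nat -> 'rV[R]_n.+1 -> R.
Hypothesis tu : forall k, test_function Omega (u_ k).
Hypothesis Eu : forall k, E (u_ k) <= 1.
Hypothesis lim_u : forall e, 0 < e -> \forall k \near \oo, rayleigh - e <= dotO (u_ k) (u_ k).
Hypothesis ray0 : 0 < rayleigh.
Variable U : set_system nat.
Hypotheses (UU : UltraFilter U) (subU : \oo `<=` U).

Let PU : ProperFilter U. Proof. exact: ultra_proper. Qed.

Let stu k : sqO (u_ k). Proof. exact: stest. Qed.

Lemma maximizing_nrm_le k : nrmO (u_ k) <= Num.sqrt rayleigh.
Proof.
rewrite /nrm ler_wsqrtr// (le_trans (rayleigh_test (tu k)))//.
by rewrite -[leRHS]mulr1 ler_wpM2l// rayleigh_ge0.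
Qed.

Lemma energy_sub_le k l : E (u_ k \- u_ l) <= 4.
Proof.
have h1 := energy_parallelogram (tu k) (tu l).
have h2 := energy_ge0 Omega (grad_test (u_ k \+ u_ l)).
move: h1 h2 (Eu k) (Eu l).
by move: (E (u_ k \- u_ l)) (E (u_ k \+ u_ l)) (E (u_ k)) (E (u_ l)) => *; lra.
Qed.

(** Rellich's inequality leaves finitely many functionals to control, and these
    converge along the ultrafilter. *)
Lemma maximizing_L2_cauchy (e : R) : 0 < e -> exists2 A, U A &
  forall k l, A k -> A l -> dotO (u_ k \- u_ l) (u_ k \- u_ l) <= e.
Proof.
move=> e0; have e8 : 0 < e / 8 by rewrite divr_gt0.
have [I [chi [c [c0 schi H]]]] := rellich_energy e8.
pose N : R := #|I|%:R.
have N0 : 0 <= N by [].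
pose g2 := e / (8 * (c * N + 1)).
have cN : 0 < c * N + 1 by rewrite ltr_wpDl// mulr_ge0.
have g20 : 0 < g2 by rewrite divr_gt0// mulr_gt0.
pose ga := Num.sqrt g2; have ga0 : 0 < ga by rewrite sqrtr_gt0.
have bd i k : `|dotO (u_ k) (chi i)| <= Num.sqrt rayleigh * nrmO (chi i).
  rewrite (le_trans (abs_dot_le oO (stu k) (schi i) (lexx _)))//.
  by rewrite ler_wpM2r ?nrm_ge0// maximizing_nrm_le.
have /(_ _)/cid lP i := ultra_bounded_cvg UU (bd i).
exists [set k | forall i, `|dotO (u_ k) (chi i) - sval (lP i)| < ga].
  apply: filter_forall => i; exact: (svalP (lP i) ga ga0).
move=> k l /= kA lA.
have tkl := testB (tu k) (tu l).
rewrite (le_trans (H _ tkl))//.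
have h1 : e / 8 * E (u_ k \- u_ l) <= e / 2.
  have := energy_sub_le k l => h; have := ler_wpM2l (ltW e8) h.
  by move/le_trans; apply; lra.
have h2 : \sum_i dotO (u_ k \- u_ l) (chi i) ^+ 2 <= N * (4 * g2).
  rewrite (_ : N * (4 * g2) = \sum_(i : I) 4 * g2); last first.
    by rewrite sumr_const /N mulr_natl.
  apply: ler_sum => i _; rewrite (dotBl mO)//.
  have := kA i; have := lA i; set x := dotO _ _; set y := dotO _ _; set z := sval _.
  move=> lx ly; rewrite -[4 * g2](_ : (2 * ga) ^+ 2 = _); last first.
    by rewrite exprMn sqr_sqrtr ?(ltW g20)//; ring.
  rewrite -[leLHS]real_normK ?num_real// ler_pXn2r ?nnegrE ?mulr_ge0 ?(ltW ga0)//.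
  have -> : x - y = (x - z) - (y - z) by ring.
  by rewrite (le_trans (ler_normB _ _))//; lra.
have h3 : c * (N * (4 * g2)) <= e / 2.
  rewrite [leLHS](_ : _ = e / 2 * (c * N / (c * N + 1))); last first.
    by rewrite /g2; field; rewrite gt_eqF.
  by rewrite ler_piMr ?divr_ge0 ?(ltW e0)// ler_pdivrMr// mul1r lerDl.
by rewrite [leRHS]splitr lerD// (le_trans (ler_wpM2l c0 h2)).
Qed.

(** The sum of two almost maximizing functions that are close in the mean almost
    realizes the largest possible norm, hence has almost the largest possible
    energy; by the parallelogram law little is left for their difference. *)
Lemma maximizing_cauchy (e : R) : 0 < e -> exists2 A, U A &
  forall k, A k -> rayleigh - e <= dotO (u_ k) (u_ k) /\ forall l, A l ->
    nrmO (u_ k \- u_ l) <= e /\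
    forall i, nrmO (partial i (u_ k) \- partial i (u_ l)) <= e.
Proof.
move=> e0.
pose eta := Num.min e (Num.min (e ^+ 2) (rayleigh * e ^+ 2 / 5)).
have eta0 : 0 < eta by rewrite !lt_min e0 !mulr_gt0 ?exprn_gt0 ?invr_gt0.
have eta1 : eta <= e by rewrite ge_min lexx.
have eta2 : eta <= e ^+ 2 by rewrite !ge_min lexx /= orbT.
have eta3 : 5 * eta <= rayleigh * e ^+ 2.
  rewrite mulrC -ler_pdivlMr//; rewrite !ge_min lexx /= !orbT//.
have [A UA HA] := maximizing_L2_cauchy eta0.
have UB := subU (lim_u eta0).
exists (A `&` [set k | rayleigh - eta <= dotO (u_ k) (u_ k)]); first exact: filterI.
move=> k [Ak Bk]; split; first by rewrite (le_trans _ Bk)// lerD2l lerN2.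
move=> l [Al Bl]; have hkl := HA k l Ak Al.
have tkl := testB (tu k) (tu l).
split.
  rewrite -(@ler_pXn2r _ 2) ?nnegrE ?nrm_ge0 ?(ltW e0)//.
  by rewrite nrm2 (le_trans hkl).
move=> i; rewrite -(@ler_pXn2r _ 2) ?nnegrE ?nrm_ge0 ?(ltW e0)// nrm2.
(* Four times eta for the two norms and once for the distance in the mean. *)
have h1 : rayleigh * E (u_ k \- u_ l) <= 5 * eta.
  have p3 := rayleigh_test (testD (tu k) (tu l)).
  have p1 := energy_parallelogram (tu k) (tu l).
  have p2 := dot_parallelogram mO (stu k) (stu l).
  move: Bk Bl hkl p1 p2 p3 (Eu k) (Eu l) ray0 => /=.
  move: rayleigh (E (u_ k \- u_ l)) (E (u_ k \+ u_ l)) (E (u_ k)) (E (u_ l)).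
  move: (dotO (u_ k \- u_ l) (u_ k \- u_ l)) (dotO (u_ k \+ u_ l) (u_ k \+ u_ l)).
  move: (dotO (u_ k) (u_ k)) (dotO (u_ l) (u_ l)).
  move=> Dk Dl Dm Dp r Em Ep Ek El Bk Bl hkl p1 p2 p3 hk hl r0.
  have p4 : Ep <= 4 - Em by lra.
  have := ler_wpM2l (ltW r0) p4; rewrite mulrBr; lra.
rewrite -(ler_pM2l ray0) (le_trans _ eta3)// (le_trans _ h1)// ler_pM2l//.
rewrite -partialB; [|exact: (test_Ck _ (tu k))|exact: (test_Ck _ (tu l))].
by rewrite /energy (bigD1 i)//= lerDl sumr_ge0// => j _; exact: dot_ge0.
Qed.

(** Finite intersections of members of the ultrafilter are inhabited, so indices
    can be picked one after the other. *)
Lemma maximizing_subseq : exists s : nat -> nat, forall j,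
  [/\ rayleigh - 4^-1 ^+ j <= dotO (u_ (s j)) (u_ (s j)),
      nrmO (u_ (s j.+1) \- u_ (s j)) <= 4^-1 ^+ j &
      forall i, nrmO (partial i (u_ (s j.+1)) \- partial i (u_ (s j))) <= 4^-1 ^+ j].
Proof.
have p0 j : 0 < 4^-1 ^+ j :> R by rewrite exprn_gt0.
have AP j := cid2 (maximizing_cauchy (p0 j)).
pose A j := s2val (AP j).
have UA j : U [set k | forall i, (i <= j)%N -> A i k].
  elim: j => [|j IH].
    by apply: filterS (s2valP (AP 0%N)) => k Ak i; rewrite leqn0 => /eqP ->.
  apply: filterS (filterI IH (s2valP (AP j.+1))) => k [H Ak] i.
  by rewrite leq_eqVlt => /predU1P[->//|]; rewrite ltnS; exact: H.
have ex j : exists k, forall i, (i <= j)%N -> A i k by exact: filter_ex (UA j).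
pose s j := sval (cid (ex j)).
have sA i j : (i <= j)%N -> A i (s j) by move=> ij; exact: (svalP (cid (ex j))).
exists s => j; have [h1 _] := s2valP' (AP j) _ (sA j j (leqnn _)).
have [_ /(_ _ (sA j j (leqnn _)))[h2 h3]] := s2valP' (AP j) _ (sA j j.+1 (leqnSn _)).
by split.
Qed.

End maximizing.
End rayleigh.

Section eigenfunction.
Context {R : realType} {n : nat}.
Variable Omega : set 'rV[R]_n.+1.
Hypotheses (oO : open Omega) (bO : bounded_set Omega).
Local Notation mu := (lebesgue_rV R n.+1).
Local Notation sqO := (sqint mu Omega).
Local Notation dotO := (dot mu Omega).
Local Notation nrmO := (nrm mu Omega).
Local Notation rayleigh := (rayleigh Omega).
Implicit Types (u v w phi : 'rV[R]_n.+1 -> R) (g h : 'I_n.+1 -> 'rV[R]_n.+1 -> R).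

Let mO : measurable Omega. Proof. exact: measurable_domain. Qed.
Let stest phi : test_function Omega phi -> sqO phi.
Proof. exact: test_sqint_domain. Qed.

Lemma rayleigh_pair w g : H10_pair Omega w g ->
  dotO w w <= rayleigh * energy Omega g g.
Proof.
move=> [sw sg H]; rewrite -subr_le0.
pose S := \sum_i (2 * nrmO (g i) + 2).
apply: (@le0_eps _ _ (2 * nrmO w + rayleigh * S)) => e e0 e1.
have [phi [tphi we ge]] := H e e0.
have h1 := dot_le_near mO sw (stest tphi) we.
have h2 := rayleigh_test oO bO tphi.
have h3 : energy Omega (grad_test phi) (grad_test phi) <= energy Omega g g + S * e.
  rewrite /S mulr_suml -[leRHS]big_split; apply: ler_sum => i _ /=.
  have := dot_ge_near mO (sg i) (stest (test_partial i tphi)) (ge i).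
  have : e ^+ 2 <= e by rewrite expr2 ler_piMr// ltW.
  rewrite mulrDl /grad_test.
  move: (dotO (g i) (g i)) (dotO (partial i phi) (partial i phi)) => x y.
  by move: (2 * nrmO (g i) * e) => *; lra.
have := ler_wpM2l (rayleigh_ge0 oO bO) h3; rewrite mulrDr mulrDl mulrA.
move: h1 h2.
move: (rayleigh * energy Omega (grad_test phi) (grad_test phi)).
move: (rayleigh * energy Omega g g).
move: (dotO w w) (dotO phi phi) (rayleigh * S * e) (2 * nrmO w * e) => *; lra.
Qed.

Lemma H10_pair_add_test w g phi (t : R) : H10_pair Omega w g ->
  test_function Omega phi ->
  H10_pair Omega (w \+ (fun x => t * phi x))
    (fun i => g i \+ (fun x => t * partial i phi x)).
Proof.
move=> [sw sg H] tphi; have ttphi := testZ t tphi; split.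
- by apply: sqintD => //; exact: stest.
- by move=> i; apply: sqintD => //; apply: sqintZ => //; exact/stest/test_partial.
- move=> e /H[psi [tpsi we ge]]; exists (psi \+ (fun x => t * phi x)).
  split; first exact: testD.
    rewrite (_ : _ \- _ = w \- psi)//.
    by apply/funext => x /=; ring.
  move=> i; rewrite partialD; [|exact: (test_Ck _ tpsi)|exact: (test_Ck _ ttphi)].
  rewrite partialZ; last exact: (test_Ck _ tphi).
  rewrite (_ : _ \- _ = g i \- partial i psi)//.
  by apply/funext => x /=; ring.
Qed.

(** The supremum defining the Rayleigh constant is attained in the energy
    space: Rellich's theorem makes a maximizing sequence Cauchy in the mean,
    and the parallelogram law then makes it Cauchy in energy. *)
Lemma maximizer_pair : 0 < rayleigh ->
  exists w g, [/\ H10_pair Omega w g, 0 < dotO w w &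
    rayleigh * energy Omega g g <= dotO w w].
Proof.
move=> ray0.
have hs := has_sup_rayleigh oO bO.
have uP k : exists u, [/\ test_function Omega u,
    energy Omega (grad_test u) (grad_test u) <= 1 &
    rayleigh - k.+1%:R^-1 <= dotO u u].
  have k0 : 0 < k.+1%:R^-1 :> R by rewrite invr_gt0.
  by have [_ [u [tu Eu] <-] /ltW] := sup_adherent k0 hs; exists u.
have [u_ uE] := choice uP.
have tu k : test_function Omega (u_ k) by case: (uE k).
have Eu k : energy Omega (grad_test (u_ k)) (grad_test (u_ k)) <= 1 by case: (uE k).
have lim_u e : 0 < e -> \forall k \near \oo, rayleigh - e <= dotO (u_ k) (u_ k).
  move=> e0; near=> k; have [_ _] := uE k; apply: le_trans.
  rewrite lerD2l lerN2; apply: ltW.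
  by near: k; exact: near_infty_natSinv_lt (PosNum e0).
have [U [UU subU]] := ultraFilterLemma (F := \oo).
have [s sP] := maximizing_subseq oO bO tu Eu lim_u ray0 UU subU.
have [w [sw wP]] := riesz_fischer mO (fun j => stest (tu (s j)))
  (fun j => let: And3 _ h _ := sP j in h).
have gP i : exists gi, sqO gi /\
    forall N, nrmO (partial i (u_ (s N)) \- gi) <= 2 * 4^-1 ^+ N.
  apply: (riesz_fischer mO (fun j => stest (test_partial i (tu (s j))))) => j.
  by have [_ _] := sP j; apply.
have [g gE] := choice gP.
have sg i : sqO (g i) by case: (gE i).
have small (e : R) : 0 < e -> exists N, 2 * 4^-1 ^+ N <= e.
  move=> e0.
  have : (fun N => 2 * 4^-1 ^+ N : R) @ \oo --> (2 * 0 : R).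
    apply: cvgMr; apply: cvg_expr; rewrite ger0_norm// invf_lt1// ltr1n//.
  rewrite mulr0 => /cvgr0Pnorm_le/(_ e e0)[N _ /(_ N (leqnn N))].
  by move/(le_trans (ler_norm _)); exists N.
have approx (e : R) : 0 < e -> exists N, [/\ nrmO (w \- u_ (s N)) <= e,
    forall i, nrmO (g i \- partial i (u_ (s N))) <= e &
    rayleigh - e <= dotO (u_ (s N)) (u_ (s N))].
  move=> /small[N Ne]; exists N; split.
  - by rewrite nrmBC (le_trans (wP N)).
  - by move=> i; rewrite nrmBC; have [_ /(_ N)/le_trans] := gE i; apply.
  - have [h _ _] := sP N; rewrite (le_trans _ h)// lerD2l lerN2 (le_trans _ Ne)//.
    by rewrite ler_peMl ?exprn_ge0// ler1n.
have dw : rayleigh <= dotO w w.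
  rewrite -subr_le0; apply: (@le0_eps _ _ (1 + 2 * nrmO w + 2)) => e e0 e1.
  have [N [h1 _ h2]] := approx e e0.
  have := dot_ge_near mO sw (stest (tu (s N))) h1.
  have : e ^+ 2 <= e by rewrite expr2 ler_piMr// ltW.
  by lra.
have Eg : energy Omega g g <= 1.
  rewrite -subr_le0; apply: (@le0_eps _ _ (\sum_i 2 * nrmO (g i))) => e e0 e1.
  have [N [_ h1 _]] := approx e e0.
  have le1 : energy Omega g g <= \sum_i (dotO (partial i (u_ (s N))) (partial i (u_ (s N)))
      + 2 * nrmO (g i) * e).
    apply: ler_sum => i _.
    exact: (dot_le_near mO (sg i) (stest (test_partial i (tu (s N)))) (h1 i)).
  rewrite big_split /= -mulr_suml in le1.
  by rewrite lerBlDl (le_trans le1)// lerD2r; exact: Eu.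
exists w, g; split.
- split=> // e /approx[N [h1 h2 _]]; exists (u_ (s N)); split=> //.
- exact: lt_le_trans dw.
- by rewrite (le_trans _ dw)// ler_piMr// ltW.
Unshelve. all: by end_near. Qed.

(** The Euler-Lagrange equation: at a maximizer the nonnegative quadratic
    function obtained by adding multiples of a test function vanishes at the
    origin, so its derivative vanishes there too. *)
Lemma euler_lagrange w g phi : H10_pair Omega w g ->
  rayleigh * energy Omega g g <= dotO w w -> test_function Omega phi ->
  rayleigh * energy Omega g (grad_test phi) = dotO w phi.
Proof.
move=> wg max tphi; have [sw sg _] := wg.
have sp := stest tphi; have sdp i := stest (test_partial i tphi).
pose a := rayleigh * energy Omega (grad_test phi) (grad_test phi) - dotO phi phi.
pose b := rayleigh * energy Omega g (grad_test phi) - dotO w phi.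
pose c := rayleigh * energy Omega g g - dotO w w.
have a0 : 0 <= a by rewrite subr_ge0; exact: rayleigh_test.
have c0 : c <= 0 by rewrite subr_le0.
have q t : 0 <= a * t ^+ 2 + 2 * b * t + c.
  have := rayleigh_pair (H10_pair_add_test t wg tphi); rewrite -subr_ge0.
  have stp := sqintZ mO t sp.
  rewrite (dot_addself mO)// !(dotZr mO)// (dotZl mO)//.
  have -> : energy Omega (fun i => g i \+ (fun x => t * partial i phi x))
      (fun i => g i \+ (fun x => t * partial i phi x)) =
      energy Omega g g + 2 * t * energy Omega g (grad_test phi)
      + t ^+ 2 * energy Omega (grad_test phi) (grad_test phi).
    rewrite /energy !mulr_sumr -!big_split; apply: eq_bigr => i _ /=.
    have stdp := sqintZ mO t (sdp i).
    by rewrite (dot_addself mO)// !(dotZr mO)// (dotZl mO)// /grad_test; ring.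
  by congr (0 <= _); rewrite /a /b /c; ring.
have b2 : b ^+ 2 <= 0.
  by rewrite (le_trans (quadratic_ge0_disc q a0))// mulr_ge0_le0.
have : b = 0 by apply/eqP; rewrite -sqrf_eq0 eq_le b2 sqr_ge0.
by move/eqP; rewrite subr_eq0 => /eqP.
Qed.

Lemma ae_zeroP w : sqO w -> ae_zero Omega w <-> dotO w w = 0.
Proof.
move=> sw; split=> [w0|]; last exact: dot_eq0_ae.
rewrite (eq_ae_dotr mO (sqint_measurable sw) (sqint_measurable sw) (measurable_cst _) w0).
by rewrite /dot; under eq_Rintegral do rewrite mulr0; rewrite Rintegral_cst// mul0r.
Qed.

(** Moving the derivatives to the test function turns the Euler-Lagrange equation
    of a maximizer into the weak eigenvalue equation. *)
Lemma exists_eigenpair : 0 < rayleigh ->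
  exists w, dirichlet_eigenpair Omega rayleigh^-1 w.
Proof.
move=> ray0; have [w [g [wg w0 max]]] := maximizer_pair ray0.
have [sw sg _] := wg; exists w; split.
  by move/(ae_zeroP sw) => w00; rewrite w00 ltxx in w0.
split; first exact: H10_pair_H10 wg.
split; first by apply/(L2_sqint mO)/sqintN => //; exact: sqintZ.
move=> phi tphi; have sp := stest tphi.
have wgr := (is_gradP oO _ _).1 (H10_pair_is_grad oO bO wg).
rewrite -[LHS]/(dotO w (laplacian phi)) -[RHS]/(dotO (\- (fun x => rayleigh^-1 * w x)) phi).
rewrite (dotNl mO)//; last exact: sqintZ.
rewrite (dotZl mO)// -(euler_lagrange wg max tphi) mulKf ?gt_eqF//.
rewrite (dot_sumr _ mO sw); last by move=> i; apply/stest/test_partial/test_partial.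
rewrite /energy -sumrN; apply: eq_bigr => i _.
by have [_ ->]// := wgr i; exact: test_partial.
Qed.

End eigenfunction.

(** * Minimizers of the residual functional *)

Section energy_algebra.
Context {R : realType} {n : nat}.
Variable Omega : set 'rV[R]_n.
Hypotheses (oO : open Omega) (bO : bounded_set Omega).
Local Notation mu := (lebesgue_rV R n).
Local Notation sqO := (sqint mu Omega).
Local Notation dotO := (dot mu Omega).
Implicit Types (v w : 'rV[R]_n -> R) (g h k : 'I_n -> 'rV[R]_n -> R).

Let mO : measurable Omega. Proof. exact: measurable_domain. Qed.

Lemma energyBl g h k : (forall i, sqO (g i)) -> (forall i, sqO (h i)) ->
  (forall i, sqO (k i)) ->
  energy Omega (fun i => g i \- h i) k = energy Omega g k - energy Omega h k.
Proof.
move=> sg sh sk; rewrite /energy -sumrB; apply: eq_bigr => i _.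
exact: dotBl.
Qed.

Lemma cauchy_schwarz_energy g h : (forall i, sqO (g i)) -> (forall i, sqO (h i)) ->
  energy Omega g h <= Num.sqrt (energy Omega g g) * Num.sqrt (energy Omega h h).
Proof.
move=> sg sh; rewrite -sqrtrM ?energy_ge0//.
rewrite (le_trans (ler_norm _))// -sqrtr_sqr ler_wsqrtr// mulrC.
apply: quadratic_ge0_disc; last exact: energy_ge0.
move=> t; have := energy_ge0 Omega (fun i => g i \+ (fun x => t * h i x)).
congr (0 <= _).
transitivity (\sum_i (dotO (h i) (h i) * t ^+ 2 + 2 * dotO (g i) (h i) * t
    + dotO (g i) (g i))).
  apply: eq_bigr => i _; have st := sqintZ mO t (sh i).
  by rewrite (dot_addself mO)// !(dotZr mO)// (dotZl mO)//; ring.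
by rewrite !big_split /= -!mulr_suml -mulr_sumr.
Qed.

Lemma H10_pairB v w g h : H10_pair Omega v g -> H10_pair Omega w h ->
  H10_pair Omega (v \- w) (fun i => g i \- h i).
Proof.
move=> [sv sg Hv] [sw sh Hw]; split; [exact: sqintB|by move=> i; exact: sqintB|].
have key (a a' b b' : 'rV[R]_n -> R) (e : R) : sqO a -> sqO a' -> sqO b -> sqO b' ->
    nrm mu Omega (a \- a') <= e / 2 -> nrm mu Omega (b \- b') <= e / 2 ->
    nrm mu Omega ((a \- b) \- (a' \- b')) <= e.
  move=> sa sa' sb sb' h1 h2.
  rewrite (_ : _ \- _ = (a \- a') \- (b \- b')); last by apply/funext => x /=; ring.
  rewrite (le_trans (nrmB mO (sqintB mO sa sa') (sqintB mO sb sb')))//.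
  by rewrite [leRHS]splitr lerD.
move=> e e0; have e2 : 0 < e / 2 by rewrite divr_gt0.
have [phi [tphi v1 v2]] := Hv _ e2; have [psi [tpsi w1 w2]] := Hw _ e2.
have st := test_sqint_domain oO bO.
exists (phi \- psi); split; first exact: testB.
  by apply: key => //; exact: st.
move=> i; rewrite partialB; [|exact: (test_Ck _ tphi)|exact: (test_Ck _ tpsi)].
by apply: key => //; apply: st; exact: test_partial.
Qed.

End energy_algebra.

Section first_eigenfunction.
Context {R : realType} {n : nat}.
Variables (Omega : set 'rV[R]_n.+1) (lambda1 : R) (phi1 : 'rV[R]_n.+1 -> R).
Hypotheses (oO : open Omega) (bO : bounded_set Omega).
Hypothesis eig : first_dirichlet_eigenpair Omega lambda1 phi1.
Local Notation mu := (lebesgue_rV R n.+1).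
Local Notation sqO := (sqint mu Omega).
Local Notation dotO := (dot mu Omega).
Local Notation nrmO := (nrm mu Omega).
Local Notation rayleigh := (rayleigh Omega).
Local Notation gp := (grad Omega phi1).
Local Notation E g := (energy Omega g g).
Local Notation f := (fun x => lambda1 * phi1 x).
Implicit Types (u v w phi : 'rV[R]_n.+1 -> R).

Let mO : measurable Omega. Proof. exact: measurable_domain. Qed.

Let pair1 : H10_pair Omega phi1 gp.
Proof. by apply: H10_H10_pair => //; have [[_ []]] := eig. Qed.

Let s1 : sqO phi1. Proof. by case: pair1. Qed.
Let sg1 i : sqO (gp i). Proof. by case: pair1. Qed.
Let sf : sqO f. Proof. exact: sqintZ. Qed.
Let grad1 : is_grad Omega phi1 gp. Proof. exact: H10_pair_is_grad. Qed.

Let lap1 : is_laplacian Omega phi1 (\- f).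
Proof. by have [[_ []]] := eig. Qed.

Lemma phi1_gt0 : 0 < dotO phi1 phi1.
Proof.
rewrite lt_neqAle dot_ge0 andbT eq_sym; apply/eqP => /(ae_zeroP oO s1).
by have [[]] := eig.
Qed.

Lemma energy_phi1 : E gp = lambda1 * dotO phi1 phi1.
Proof.
have := green_H10 oO bO s1 grad1 lap1 pair1.
by rewrite (dotNl mO)// (dotZl mO)// => /eqP; rewrite eqr_opp => /eqP.
Qed.

(** The variational characterization of the first eigenvalue: the Rayleigh
    constant is attained at an eigenfunction, and the eigenvalue of that
    function cannot lie below the first one. *)
Lemma rayleighE : 0 < lambda1 /\ rayleigh = lambda1^-1.
Proof.
have p0 := phi1_gt0.
have := rayleigh_pair oO bO pair1; rewrite energy_phi1 => le1.
have r0 : 0 < rayleigh.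
  rewrite lt_neqAle rayleigh_ge0// andbT eq_sym; apply/eqP => r0.
  by move: le1; rewrite r0 mul0r leNgt p0.
have l1 : 1 <= rayleigh * lambda1.
  by rewrite -(ler_pM2r p0) mul1r -mulrA.
have l0 : 0 < lambda1.
  by rewrite -(pmulr_rgt0 _ r0) (lt_le_trans ltr01).
have [w weig] := exists_eigenpair oO bO r0.
have [_ /(_ _ _ weig) l2] := eig; split=> //.
apply/eqP; rewrite eq_le; apply/andP; split.
  by rewrite -[leLHS]invrK lef_pV2 ?posrE ?invr_gt0.
by rewrite -[leLHS]mul1r ler_pdivrMr.
Qed.

Let l0 : 0 < lambda1. Proof. by case: rayleighE. Qed.

Let N := nrmO phi1.
Let N0 : 0 < N. Proof. by rewrite sqrtr_gt0 phi1_gt0. Qed.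

Let sqrt_l0 : 0 < Num.sqrt lambda1. Proof. by rewrite sqrtr_gt0. Qed.

Lemma sqrt_energy_phi1 : Num.sqrt (E gp) = Num.sqrt lambda1 * N.
Proof. by rewrite energy_phi1 sqrtrM// ltW. Qed.

Lemma H10_poincare w g : H10_pair Omega w g ->
  nrmO w <= (Num.sqrt lambda1)^-1 * Num.sqrt (E g).
Proof.
move=> wg; rewrite -sqrtrV ?(ltW l0)// -sqrtrM ?invr_ge0 ?(ltW l0)//.
by rewrite ler_wsqrtr// -(proj2 rayleighE); exact: rayleigh_pair.
Qed.

(** The supremum is attained at [phi1]. *)
Lemma poincare_constantE : poincare_constant Omega = (Num.sqrt lambda1)^-1.
Proof.
have ub : ubound [set norm0 Omega w / seminorm1 Omega w | w in
    [set w | H10 Omega w /\ ~ ae_zero Omega w]] (Num.sqrt lambda1)^-1.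
  move=> _ [w [Hw wn0] <-]; have wg := H10_H10_pair oO bO Hw; have [sw _ _] := wg.
  rewrite norm0E// (seminorm1E oO bO (H10_pair_is_grad oO bO wg)).
  have le1 := H10_poincare wg.
  have w0 : 0 < nrmO w.
    rewrite sqrtr_gt0 lt_neqAle dot_ge0 andbT eq_sym; apply/eqP.
    by move/(ae_zeroP oO sw).
  have e0 : 0 < Num.sqrt (E (grad Omega w)).
    rewrite lt_neqAle sqrtr_ge0 andbT eq_sym; apply/eqP => e0.
    by move: le1; rewrite e0 mulr0 leNgt w0.
  by rewrite ler_pdivrMr.
have mem : [set norm0 Omega w / seminorm1 Omega w | w in
    [set w | H10 Omega w /\ ~ ae_zero Omega w]] (Num.sqrt lambda1)^-1.
  exists phi1; first by have [[? []]] := eig.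
  rewrite norm0E// (seminorm1E oO bO grad1) sqrt_energy_phi1 -/N.
  by rewrite invfM mulrCA mulfV ?mulr1// gt_eqF.
apply/eqP; rewrite eq_le; apply/andP; split.
  by apply: ge_sup => //; exists (Num.sqrt lambda1)^-1.
by apply: ub_le_sup => //; exists (Num.sqrt lambda1)^-1.
Qed.

(** Green's formula against the difference of two solutions shows that this
    difference has no energy. *)
Lemma dirichlet_solution_unique u : dirichlet_solution Omega f u ->
  u = phi1 %[ae mu in Omega].
Proof.
move=> [Hu lapu]; have ug := H10_H10_pair oO bO Hu; have [su sgu _] := ug.
have dg := H10_pairB oO bO ug pair1; have [sd sgd _] := dg.
have g1 := green_H10 oO bO su (H10_pair_is_grad oO bO ug) lapu dg.
have g2 := green_H10 oO bO s1 grad1 lap1 dg.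
have e0 : E (fun i => grad Omega u i \- gp i) = 0.
  rewrite energyBl//; apply/eqP; rewrite subr_eq0 -eqr_opp; apply/eqP.
  exact: (etrans (esym g1) g2).
have := rayleigh_pair oO bO dg; rewrite e0 mulr0 => le0.
have : dotO (u \- phi1) (u \- phi1) = 0.
  by apply/eqP; rewrite eq_le le0 dot_ge0.
move/(dot_eq0_ae mO sd); apply: filterS => x H Ox.
by apply/eqP; rewrite -subr_eq0; apply/eqP; exact: H.
Qed.

Let affine t c : 'rV[R]_n.+1 -> R := fun x => t * phi1 x + c.

Lemma affine_grad t c : sqO (affine t c) /\
  is_grad Omega (affine t c) (fun i x => t * gp i x).
Proof.
have sc := sqint_domain_cst oO bO c; have st := sqintZ mO t s1.
split; first exact: (sqintD mO st sc).
have := is_gradD oO bO st sc (is_gradZ oO bO t s1 grad1) (is_grad_cst oO bO c).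
rewrite (_ : (fun i => _ \+ _) = (fun i x => t * gp i x))//.
by apply/funext => i; apply/funext => x /=; rewrite addr0.
Qed.

Lemma affine_laplacian t c :
  is_laplacian Omega (affine t c) (fun x => t * (\- f) x).
Proof.
have sc := sqint_domain_cst oO bO c; have st := sqintZ mO t s1.
have sNf := sqintN mO sf.
split; first by apply/(L2_sqint mO); exact: sqintZ.
move=> phi tphi; have st' := test_sqint_domain oO bO.
have tl := test_laplacian tphi.
rewrite -[LHS]/(dotO ((fun x => t * phi1 x) \+ (fun=> c)) (laplacian phi)).
rewrite -[RHS]/(dotO (fun x => t * (\- f) x) phi).
rewrite (dotDl mO)// ?(dotZl mO)//; [|exact: st'..].
have -> : dotO phi1 (laplacian phi) = dotO (\- f) phi by case: lap1 => _; apply.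
rewrite (dot_sumr _ mO sc); last by move=> i; apply/st'/test_partial/test_partial.
rewrite big1 ?addr0// => i _.
have [_ ->] := (is_gradP oO _ _).1 (is_grad_cst oO bO c) i; last exact: test_partial.
by rewrite /dot; under eq_Rintegral do rewrite mul0r; rewrite Rintegral_cst// mul0r oppr0.
Qed.

Lemma affine_spaceV t c : spaceV Omega (affine t c).
Proof.
have [sa ga] := affine_grad t c; split; last by eexists; exact: affine_laplacian.
by split; [exact/(L2_sqint mO)|eexists; exact: ga].
Qed.

Lemma J_affine C t c : 0 <= t <= 1 -> J Omega C f (affine t c) =
  C * ((1 - t) * (lambda1 * N)) + t * (Num.sqrt lambda1 * N).
Proof.
move=> /andP[t0 t1]; have [sa ga] := affine_grad t c.
rewrite /J (norm0_dlaplacian oO bO (affine_laplacian t c) sf) (seminorm1E oO bO ga).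
congr (_ * _ + _).
  rewrite (_ : _ \+ _ = fun x => ((1 - t) * lambda1) * phi1 x); last first.
    by apply/funext => x /=; ring.
  by rewrite (nrmZ mO)// ger0_norm ?mulrA// mulr_ge0 ?subr_ge0// ltW.
rewrite (_ : energy _ _ _ = t ^+ 2 * E gp); last first.
  rewrite /energy mulr_sumr; apply: eq_bigr => i _.
  by rewrite (dotZl mO)// ?(dotZr mO)//; [ring|exact: sqintZ].
by rewrite sqrtrM ?sqr_ge0// sqrtr_sqr ger0_norm// sqrt_energy_phi1.
Qed.

(** Testing an arbitrary competitor against the eigenfunction: the residual
    term and the energy term each control one of the two terms of Green's
    formula, with constants that match exactly at the Poincare constant. *)
Lemma J_ge w : spaceV Omega w ->
  Num.sqrt lambda1 * N <= J Omega (Num.sqrt lambda1)^-1 f w.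
Proof.
move=> [[/(L2_sqint mO) sw [g0 wg0]] [l0' wl0]].
have wg := gradP wg0; have wl := dlaplacianP wl0.
set g := grad Omega w in wg *; set l := dlaplacian Omega w in wl *.
have sl : sqO l by exact/(L2_sqint mO)/(proj1 wl).
have sg i : sqO (g i) by have [] := (is_gradP oO _ _).1 wg i.
have slf := sqintD mO sl sf.
rewrite /J -/l (norm0E mO slf) (seminorm1E oO bO wg).
have gr := green_H10 oO bO sw wg wl pair1.
have cs1 := cauchy_schwarz mO slf s1.
have cs2 := cauchy_schwarz_energy oO sg sg1.
have e1 : dotO (l \+ f) phi1 = - energy Omega g gp + lambda1 * N ^+ 2.
  apply: etrans (dotDl mO sl sf s1) _; congr (_ + _); first exact: gr.
  by apply: etrans (dotZl mO lambda1 s1 s1) _; rewrite nrm2.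
have {}cs1 : - energy Omega g gp + lambda1 * N ^+ 2 <= nrmO (l \+ f) * N.
  by rewrite -e1.
have {}cs2 : energy Omega g gp <= Num.sqrt (E g) * (Num.sqrt lambda1 * N).
  by rewrite -sqrt_energy_phi1.
set r := Num.sqrt lambda1 in cs2 *.
have lE : lambda1 = r ^+ 2 by rewrite sqr_sqrtr// ltW.
have key : lambda1 * N <= nrmO (l \+ f) + Num.sqrt (E g) * r.
  rewrite -(ler_pM2r N0) mulrDl; move: cs1 cs2; rewrite expr2 mulrA.
  move: (energy Omega g gp) (nrmO (l \+ f) * N) (Num.sqrt (E g)) => a b c.
  by rewrite mulrA; lra.
rewrite -(ler_pM2l sqrt_l0) mulrA -expr2 -/r -lE mulrDr mulVKf ?gt_eqF//.
by rewrite (mulrC r).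
Qed.

End first_eigenfunction.

Theorem proposition2p3 (R : realType) (n : nat) (Omega : set 'rV[R]_n.+1)
    (lambda1 : R) (phi1 : 'rV[R]_n.+1 -> R) :
  lipschitz_domain Omega ->
  first_dirichlet_eigenpair Omega lambda1 phi1 ->
  let CP := poincare_constant Omega in
  let f := fun x => lambda1 * phi1 x in
  [/\ CP = (Num.sqrt lambda1)^-1,
      dirichlet_solution Omega f phi1 /\
      (forall u, dirichlet_solution Omega f u ->
         u = phi1 %[ae lebesgue_rV R n.+1 in Omega]),
      (forall C, C = CP -> forall t c : R, 0 <= t <= 1 ->
         minimizer Omega C f (fun x => t * phi1 x + c)) &
      (forall C, 0 < C < CP -> ~ minimizer Omega C f phi1)].
Proof.
move=> [oO _ _ bO _] eig CP f.
have CPE : CP = (Num.sqrt lambda1)^-1.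
  exact: (poincare_constantE oO bO eig).
have [l0 _] := rayleighE oO bO eig.
have r0 : 0 < Num.sqrt lambda1 by rewrite sqrtr_gt0.
have N0 : 0 < nrm (lebesgue_rV R n.+1) Omega phi1.
  by rewrite sqrtr_gt0; exact: (phi1_gt0 oO bO eig).
have Cl : CP * lambda1 = Num.sqrt lambda1.
  by rewrite CPE -[X in _ * X = _](sqr_sqrtr (ltW l0)) expr2 mulKf ?gt_eqF.
split.
- exact: CPE.
- split; first by case: eig => -[].
  move=> u; exact: (dirichlet_solution_unique oO bO eig).
- move=> C -> t c t01; split; first exact: (affine_spaceV oO bO eig).
  move=> w wV; rewrite (J_affine oO bO eig CP c t01) mulrCA (mulrA CP) Cl -mulrDl.
  by rewrite subrK mul1r CPE; exact: (J_ge oO bO eig).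
- move=> C /andP[C0 Clt] [_ /(_ _ (affine_spaceV oO bO eig 0 0))].
  have t0 : 0 <= (0 : R) <= 1 by rewrite lexx ler01.
  have t1 : 0 <= (1 : R) <= 1 by rewrite lexx ler01.
  have := J_affine oO bO eig C 0 t1.
  rewrite (_ : (fun x => 1 * phi1 x + 0) = phi1); last first.
    by apply/funext => x; rewrite mul1r addr0.
  move=> ->; rewrite (J_affine oO bO eig C 0 t0).
  rewrite subrr mul0r mulr0 add0r mul1r subr0 mul1r mul0r addr0 leNgt.
  by rewrite mulrA ltr_pM2r// -Cl ltr_pM2r// Clt.
Qed.
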